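(* For any $n, k, d, d_0 \in \mathbb{N}$ with $d_0 \le d$ and any $\epsilon, \delta, \gamma > 0$, there exists a one-query $(O(\epsilon d_0), k\delta+\gamma)$-steward for $k$ adaptively chosen $(\epsilon,\delta)$-concentrated functions $f_1,\dots,f_k: \{0,1\}^n \to \mathbb{R}^d$ with randomness complexity \[ n + O\left(\frac{kd\log(d_0+1)}{d_0} + (\log k)\log(1/\gamma)\right). \] The total running time of the steward is $\mathrm{poly}(n,k,d,\log(1/\epsilon),\log(1/\gamma))$.
   Context: A function $f: \{0,1\}^n \to \mathbb{R}^d$ is $(\epsilon,\delta)$-concentrated at $\mu \in \mathbb{R}^d$ if $\Pr_{X}[\|f(X) - \mu\|_\infty > \epsilon] \le \delta$ for uniform $X\in\{0,1\}^n$. An $(\epsilon', \delta')$-steward for $k$ adaptively chosen $(\epsilon,\delta)$-concentrated functions is a randomized algorithm $\mathsf{S}$ interacting with an arbitrary (possibly randomized) owner $\mathsf{O}$: for $i = 1,\dots,k$, $\mathsf{O}$ adaptively chooses $f_i$ that is $(\epsilon,\delta)$-concentrated at some $\mu_i\in\mathbb{R}^d$ and gives it to $\mathsf{S}$, which returns $Y_i \in \mathbb{R}^d$; for every $\mathsf{O}$, $\Pr[\max_i \|Y_i - \mu_i\|_\infty > \epsilon'] \le \delta'$. It is one-query if it accesses each $f_i$ only by evaluating it at a single point $X_i$ (not seen by the owner). Randomness complexity is the number of random bits used by the steward. $O(\cdot)$ constants are absolute. *)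

(* Defs.v *)
From HB Require Import structures.
From mathcomp Require Import all_boot all_order all_algebra.
From mathcomp Require Import all_classical all_reals all_analysis.
Set Implicit Arguments.
Unset Strict Implicit.
Unset Printing Implicit Defensive.
Import Order.TTheory GRing.Theory Num.Theory.
Import numFieldNormedType.Exports.
Local Open Scope ring_scope.

Definition uprob (R : realType) (T : finType) (E : {set T}) : R :=
  #|E|%:R / #|T|%:R.

(* The norm of 'rV[R]_d is the sup norm. *)
Definition concentrated (R : realType) (n d : nat) (eps delta : R)
    (f : n.-tuple bool -> 'rV[R]_d) (mu : 'rV[R]_d) : Prop :=
  uprob R [set x | eps < `|f x - mu| ] <= delta.

(* Stewards are programs of a random-access machine that has natural-number
   registers N[0], N[1], .. and real registers R[0], R[1], .. , flips fair
   coins, and talks to the owner; every step costs one unit of time.  The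
   functions f_i return arbitrary real vectors, and the time bound does not
   depend on their magnitude, so real arithmetic has to be exact and of unit
   cost.  There is on purpose no multiplication or division: the only nonlinear
   operation, [RRound], rounds a real to a multiple of another one.  So, on
   rational data, t steps increase bit lengths by O(t) only, and unit cost is
   polynomially equivalent to bit cost. *)
Inductive instr : Type :=
| NSet of nat & nat            (* NSet a c     : N[a] := c *)
| NAdd of nat & nat & nat      (* NAdd a b c   : N[a] := N[b] + N[c] *)
| NSub of nat & nat & nat      (* NSub a b c   : N[a] := N[b] - N[c], truncated *)
| NHalf of nat & nat           (* NHalf a b    : N[a] := N[b] / 2, rounded down *)
| NLoad of nat & nat           (* NLoad a b    : N[a] := N[N[b]] *)
| NStore of nat & nat          (* NStore a b   : N[N[a]] := N[b] *)
| RCast of nat & nat           (* RCast a b    : R[a] := N[b] *)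
| RAdd of nat & nat & nat      (* RAdd a b c   : R[a] := R[b] + R[c] *)
| RSub of nat & nat & nat      (* RSub a b c   : R[a] := R[b] - R[c] *)
| RHalf of nat & nat           (* RHalf a b    : R[a] := R[b] / 2 *)
| RRound of nat & nat & nat    (* RRound a b c : R[a] := floor(R[b]/R[c]) * R[c] *)
| RLoad of nat & nat           (* RLoad a b    : R[a] := R[N[b]] *)
| RStore of nat & nat          (* RStore a b   : R[N[a]] := R[b] *)
| Flip of nat                  (* Flip a       : N[a] := next random bit *)
| Query of nat & nat           (* Query a b    : evaluate the current f_i at the
                                  point N[N[a]], .., N[N[a]+n-1] (nonzero means
                                  true); value into R[N[b]], .., R[N[b]+d-1] *)
| Answer of nat.               (* Answer a     : give R[N[a]], .., R[N[a]+d-1] to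
                                  the owner as Y_i; the next round starts *)

Inductive test : Type :=
| NLe of nat & nat
| RLe of nat & nat.

Inductive cmd : Type :=
| Do of instr
| Seq of cmd & cmd
| If of test & cmd & cmd
| While of test & cmd.

Section Machine.
Variables (R : realType) (n d : nat).

(* A deterministic owner: the function it chooses after having received the
   answers listed in the history (the earliest first).  It sees neither the
   points at which the steward evaluates nor the coins of the steward. *)
Definition owner : Type := seq 'rV[R]_d -> (n.-tuple bool -> 'rV[R]_d).

Record state : Type := State {
  nmem : nat -> nat;
  rmem : nat -> R;
  flips : nat;               (* number of random bits consumed *)
  queries : seq nat;         (* the rounds, from 0, at which queries occurred *)
  answers : seq 'rV[R]_d     (* the answers so far, the earliest first *)
}.

Definition upd (V : Type) (m : nat -> V) (a : nat) (v : V) : nat -> V :=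
  fun b => if b == a then v else m b.

Definition setn (s : state) (a v : nat) : state :=
  State (upd (nmem s) a v) (rmem s) (flips s) (queries s) (answers s).

Definition setr (s : state) (a : nat) (v : R) : state :=
  State (nmem s) (upd (rmem s) a v) (flips s) (queries s) (answers s).

Definition read_point (m : nat -> nat) (a : nat) : n.-tuple bool :=
  [tuple m (a + i)%N != 0%N | i < n].

Definition read_vec (m : nat -> R) (a : nat) : 'rV[R]_d :=
  \row_(j < d) m (a + j)%N.

Definition write_vec (m : nat -> R) (a : nat) (y : 'rV[R]_d) : nat -> R :=
  fun b => if (a <= b)%N then oapp (fun j : 'I_d => y 0 j) (m b) (insub (b - a)%N)
           else m b.

Definition exec (O : owner) (tape : seq bool) (i : instr) (s : state) : state :=
  let: N := nmem s in
  let: M := rmem s in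
  match i with
  | NSet a c => setn s a c
  | NAdd a b c => setn s a (N b + N c)
  | NSub a b c => setn s a (N b - N c)
  | NHalf a b => setn s a (N b)./2
  | NLoad a b => setn s a (N (N b))
  | NStore a b => setn s (N a) (N b)
  | RCast a b => setr s a (N b)%:R
  | RAdd a b c => setr s a (M b + M c)
  | RSub a b c => setr s a (M b - M c)
  | RHalf a b => setr s a (M b / 2)
  | RRound a b c => setr s a ((Num.floor (M b / M c))%:~R * M c)
  | RLoad a b => setr s a (M (N b))
  | RStore a b => setr s (N a) (M b)
  | Flip a => State (upd N a (nth false tape (flips s))) M
                (flips s).+1 (queries s) (answers s)
  | Query a b => State N (write_vec M (N b) (O (answers s) (read_point N (N a))))
                   (flips s) (rcons (queries s) (size (answers s))) (answers s)
  | Answer a => State N M (flips s) (queries s)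
                  (rcons (answers s) (read_vec M (N a)))
  end.

Definition holds (t : test) (s : state) : bool :=
  match t with
  | NLe a b => (nmem s a <= nmem s b)%N
  | RLe a b => rmem s a <= rmem s b
  end.

(* A configuration: the commands still to be executed, and the state. *)
Definition config : Type := (seq cmd * state)%type.

Definition step (O : owner) (tape : seq bool) (cf : config) : config :=
  let: (K, s) := cf in
  match K with
  | [::] => cf
  | Do i :: K' => (K', exec O tape i s)
  | Seq c1 c2 :: K' => (c1 :: c2 :: K', s)
  | If t c1 c2 :: K' => ((if holds t s then c1 else c2) :: K', s)
  | While t c :: K' => (if holds t s then c :: K else K', s)
  end.

(* The inputs are placed in the first registers; the others contain 0. *)
Definition init (nin : seq nat) (rin : seq R) : state :=
  State (nth 0%N nin) (nth 0 rin) 0 [::] [::].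

Definition run (S : cmd) (nin : seq nat) (rin : seq R) (O : owner)
    (tape : seq bool) (T : nat) : config :=
  iter T (step O tape) ([:: S], init nin rin).

Definition final (S : cmd) (nin : seq nat) (rin : seq R) (O : owner)
    (tape : seq bool) (T : nat) : state :=
  (run S nin rin O tape T).2.

End Machine.

Section Steward.
Variables (R : realType) (n k d : nat) (eps delta : R).
Variables (S : cmd) (nin : seq nat) (rin : seq R).

Definition valid_owner (O : owner R n d) : Prop :=
  forall h, exists mu, concentrated eps delta (O h) mu.

(* Against every owner, the steward halts within T steps after k rounds. *)
Definition runs_in_time (r T : nat) : Prop :=
  forall (O : owner R n d) (tape : r.-tuple bool), valid_owner O ->
    (run S nin rin O tape T).1 = [::] /\
    size (answers (final S nin rin O tape T)) = k.

(* It reads no random bit beyond the r given ones. *)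
Definition uses_bits (r T : nat) : Prop :=
  forall (O : owner R n d) (tape : r.-tuple bool), valid_owner O ->
    (flips (final S nin rin O tape T) <= r)%N.

(* Each of the k functions is evaluated at most once. *)
Definition one_query (r T : nat) : Prop :=
  forall (O : owner R n d) (tape : r.-tuple bool), valid_owner O ->
    let q := queries (final S nin rin O tape T) in
    uniq q /\ all (fun i => (i < k)%N) q.

(* mu h is the point at which the function chosen after history h is
   concentrated. *)
Definition fails (eps' : R) (r T : nat) (O : owner R n d)
    (mu : seq 'rV[R]_d -> 'rV[R]_d) : {set r.-tuple bool} :=
  [set tape : r.-tuple bool |
    let Y := answers (final S nin rin O tape T) in
    [exists i : 'I_k, eps' < `|nth 0 Y i - mu (take i Y)| ] ].

(* A randomized owner draws w from an arbitrary probability space, independently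
   of the steward's coins.  The failure probability is the iterated integral
   that defines the product of P and the uniform measure on the tapes; for a
   nonnegative integrand it is meaningful (and the bound below is required)
   even if the failure event is not measurable. *)
Definition is_steward (eps' delta' : R) (r T : nat) : Prop :=
  forall (disp : measure_display) (Om : measurableType disp)
    (P : probability Om R) (O : Om -> owner R n d)
    (mu : Om -> seq 'rV[R]_d -> 'rV[R]_d),
  (forall w h, concentrated eps delta (O w h) (mu w h)) ->
  (\int[P]_w (uprob R (fails eps' r T (O w) (mu w)))%:E <= delta'%:E)%E.

End Steward.

(* Inside O(.) and poly(.), the logarithm of 1/x is replaced by 0 for x >= 1. *)
Definition log_inv (R : realType) (x : R) : R := Num.max 0 (ln x^-1).

(* Main.v *)
(* The steward evaluates f_i at the i-th block of a pseudorandom generator and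
   rounds the value coordinatewise to a grid of mesh 2 eps (d0 + 1), after a
   shift by a multiple of 2 eps that is chosen separately for each group of d0
   coordinates: each coordinate of a group is too close to a grid point for at
   most one of the d0 + 1 shifts.  If f_i(X_i) is eps-close to mu_i, then the
   answer depends on mu_i and on the shifts only.  So, until the first failure,
   the interaction is a decision tree whose nodes have at most
   M = (d0 + 1) ^ ceil(d / d0) children, and it suffices that the generator
   fools these trees.

   The generator doubles the number of blocks: if G_i produces 2^i blocks from
   a vertex of the Margulis-Gabber-Galil graph on (Z/2^h)^2, then G_{i+1} maps a
   vertex and the label of a walk of length t_i to the blocks produced from the
   two endpoints of the walk.  By expander mixing, summed over the at most
   M^(2^i) outcomes of the first half, this costs an error gamma / 2^m as soon
   as t_i is a large multiple of 2^i log M + m + log (1 / gamma).  The lengths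
   t_i sum up to O(k log M + (log k) log (1 / gamma)).

   The spectral gap is proved as by Gabber and Galil: on the Fourier side the
   form is a weighted sum over the edges of the graph of the dual linear maps,
   which is estimated by AM-GM with weights 5/4 and 4/5 oriented by the distance
   to the origin.  Vertices are pairs of unreduced natural numbers, and functions
   on the graph are periodic functions on pairs of natural numbers, so the
   program never has to reduce modulo 2^h. *)
Require Import Defs.
From HB Require Import structures.
From mathcomp Require Import all_boot all_order all_algebra.
From mathcomp Require Import all_classical all_reals all_analysis.
From mathcomp Require Import ring lra zify.
Set Implicit Arguments.
Unset Strict Implicit.
Unset Printing Implicit Defensive.
Import Order.TTheory GRing.Theory Num.Theory.
Import numFieldNormedType.Exports.
Local Open Scope ring_scope.

(** * The Margulis-Gabber-Galil expander *)

(** The expander enters through a single inequality: averaging a mean-zero function over the steps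
    of the walk shrinks its mean square. The walk uses the four shears in the forward direction
    only, so its operator is not self-adjoint and a bound on eigenvalues would not suffice. Standing
    still with probability 1/2 removes this obstacle: when the square of [f / 2 + spread f / 8] is
    expanded, only an upper bound on the form [f * spread f] and the trivial bound on [spread f] are
    needed. A lazy step has 16 labels, one base-4 digit for each coordinate. A vertex together with
    the label of a walk is therefore again a pair of numbers, with the vertex in the high digits and
    the label in the low ones, and the seeds of all levels are of the same kind. Adaptivity is
    handled by conditioning: once the node reached after the first half of the blocks is fixed, the
    functions of the second half no longer depend on the seed, while the label of the walk is still
    fresh. The events of reaching the different nodes are disjoint, so their total measure, and not
    their number, multiplies the main term of the error. *)

Definition cdist (M z : nat) : nat := minn (z %% M) (M - z %% M).

(** An edge of the dual graph changes one coordinate only, so it is enough to compare the distances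
    [a] and [b] of that coordinate before and after. The two directions of an edge carry reciprocal
    weights, as AM-GM requires. *)
Definition ggw (R : realType) (a b : nat) : R :=
  if (b < a)%N then 5 / 4 else if (a < b)%N then 4 / 5 else 1.

Lemma cdistD (M z : nat) : cdist M (z + M) = cdist M z.
Proof. by rewrite /cdist modnDr. Qed.

(** In this diamond around the origin the residues compare as integers do: [q + 2p] and [q - 2p] are
    both farther out than [q] when [|q| < |p|], exactly one is when [0 < |p| < |q|], and on the
    diagonals one of them is [-q]. The natural number [M - p] stands for [-p]. *)
Lemma cdist_neighbours (M p q : nat) : (p < M)%N -> (q < M)%N ->
    (2 * (cdist M p + cdist M q) < M)%N ->
    let u := cdist M (q + 2 * p) in let w := cdist M (q + 2 * (M - p)) in
    let x := cdist M p in let y := cdist M q in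
  [/\ x = 0%N -> u = y /\ w = y,
      (0 < x < y)%N -> ((y < u) && (w < y) || (y < w) && (u < y))%N,
      (0 < x)%N -> x = y -> ((u == y) && (y < w) || (w == y) && (y < u))%N
    & (y < x)%N -> (y < u)%N && (y < w)%N].
Proof.
move=> pM qM.
have cases z : (z < 3 * M)%N -> exists r, [/\ (r < M)%N,
    cdist M z = minn r (M - r) & z = r \/ z = (r + M)%N \/ z = (r + 2 * M)%N].
  move=> zM; exists (z %% M)%N; split => //; first by rewrite ltn_mod; lia.
  have : (z %/ M < 3)%N by rewrite ltn_divLR; lia.
  have := divn_eq z M; case: (z %/ M)%N => [|[|[|//]]]; lia.
have -> : cdist M p = minn p (M - p) by rewrite /cdist modn_small.
have -> : cdist M q = minn q (M - q) by rewrite /cdist modn_small.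
have [|r [rM -> hr]] := cases (q + 2 * p)%N; first lia.
have [p0|p0] := posnP p.
  subst p => /=.
  have -> : cdist M (q + 2 * (M - 0)) = minn q (M - q).
    by rewrite subn0 mul2n -addnn addnA !cdistD /cdist modn_small.
  move=> h; split; lia.
have [|s [sM -> hs]] := cases (q + 2 * (M - p))%N; first lia.
by move=> h; split; lia.
Qed.

(** Off the axes and diagonals one neighbour is nearer to the origin and three are farther, which
    gives 5/4 + 3 * 4/5 = 73/20. On an axis or a diagonal two neighbours are at equal distance and
    two are farther, which gives only 18/5. *)
Lemma ggw_sum_le (R : realType) (M p q : nat) : (p < M)%N -> (q < M)%N ->
    (2 * (cdist M p + cdist M q) < M)%N -> (0 < p + q)%N ->
  ggw R (cdist M q) (cdist M (q + 2 * p))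
  + ggw R (cdist M q) (cdist M (q + 2 * (M - p)))
  + (ggw R (cdist M p) (cdist M (p + 2 * q))
  + ggw R (cdist M p) (cdist M (p + 2 * (M - q)))) <= 73 / 20.
Proof.
move=> pM qM h pq0.
have [a1 a2 a3 a4] := cdist_neighbours pM qM h.
have [|b1 b2 b3 b4] := cdist_neighbours qM pM; first by rewrite addnC.
have pos : (0 < cdist M p + cdist M q)%N.
  by rewrite /cdist !modn_small //; lia.
move: a1 a2 a3 a4 b1 b2 b3 b4 pos; move: (cdist _ (q + 2 * p)) (cdist _ (q + 2 * (M - p))).
move: (cdist _ (p + 2 * q)) (cdist _ (p + 2 * (M - q))).
move: (cdist M p) (cdist M q) => x y u w u' w' a1 a2 a3 a4 b1 b2 b3 b4 pos.
rewrite /ggw.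
case: (ltngtP x y) => xy.
- have [x0|x0] := posnP x.
    have [-> ->] := a1 x0; have /andP[] := b4 xy; rewrite !ltnn => e1 e2.
    by rewrite !e1 !e2 !(ltnNge _ x) !(ltnW e1) !(ltnW e2) /=; lra.
  have /andP[e1 e2] := b4 xy.
  rewrite !e1 !e2 !(ltnNge _ x) !(ltnW e1) !(ltnW e2) /=.
  have xy2 : (0 < x < y)%N by rewrite x0.
  have /orP[/andP[f1 f2]|/andP[f1 f2]] := a2 xy2.
    by rewrite f1 f2 (ltnNge u') (ltnW f1) /=; lra.
  by rewrite f1 f2 (ltnNge w') (ltnW f1) /=; lra.
- have [y0|y0] := posnP y.
    have [-> ->] := b1 y0; have /andP[] := a4 xy; rewrite !ltnn => e1 e2.
    by rewrite !e1 !e2 !(ltnNge _ y) !(ltnW e1) !(ltnW e2) /=; lra.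
  have /andP[e1 e2] := a4 xy.
  rewrite !e1 !e2 !(ltnNge _ y) !(ltnW e1) !(ltnW e2) /=.
  have yx2 : (0 < y < x)%N by rewrite y0.
  have /orP[/andP[f1 f2]|/andP[f1 f2]] := b2 yx2.
    by rewrite f1 f2 (ltnNge u) (ltnW f1) /=; lra.
  by rewrite f1 f2 (ltnNge w) (ltnW f1) /=; lra.
- subst y; have x0 : (0 < x)%N by lia.
  have /orP[/andP[/eqP f1 f2]|/andP[/eqP f1 f2]] := a3 x0 erefl;
  have /orP[/andP[/eqP g1 g2]|/andP[/eqP g1 g2]] := b3 x0 erefl;
  rewrite ?f1 ?g1 ?ltnn ?f2 ?g2 !(ltnNge _ x) ?(ltnW f2) ?(ltnW g2) /=; lra.
Qed.

Lemma ggw_le (R : realType) a b : ggw R a b <= 5 / 4.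
Proof. by rewrite /ggw; case: ifP => _; [|case: ifP => _]; lra. Qed.

Lemma ggw_gt0 (R : realType) a b : 0 < ggw R a b.
Proof. by rewrite /ggw; case: ifP => _; [|case: ifP => _]; lra. Qed.

Lemma ggw_mul (R : realType) a b : ggw R a b * ggw R b a = 1.
Proof. by rewrite /ggw; case: ltngtP => _; lra. Qed.

(** * Cosines of half-angles modulo M *)

Section Angles.
Variables (R : realType) (M : nat).
Hypothesis M0 : (0 < M)%N.
Implicit Types (p q : nat).

(** Half of the angle of the frequency [p], because 1 + exp(2ix) = 2 cos(x) exp(ix): summing over
    the two offsets of a shear produces the cosine of the half-angle. *)
Definition hang (p : nat) : R := pi * p%:R / M%:R.

Let Mr0 : M%:R != 0 :> R.
Proof. by rewrite pnatr_eq0 -lt0n. Qed.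

Lemma cos_piD (k : nat) (x : R) : cos (x + pi *+ k) = (-1) ^+ k * cos x.
Proof.
elim: k => [|k IH]; first by rewrite mulr0n addr0 mul1r.
by rewrite mulrSr addrA cosDpi IH exprS; ring.
Qed.

(** Adding [M] to [p] adds pi to the half-angle, which only changes the sign of the cosine;
    reflection at [M] does the same. *)
Lemma norm_cos_hang p : `|cos (hang p)| = cos (hang (cdist M p)).
Proof.
have hM k r : hang (r + k * M) = hang r + pi *+ k.
  by rewrite /hang natrD natrM -mulr_natr; field.
have -> : `|cos (hang p)| = `|cos (hang (p %% M))|.
  rewrite {1}(divn_eq p M) addnC hM cos_piD normrM normrX normrN1 expr1n mul1r.
  by [].
have := ltn_pmod p M0; rewrite /cdist; move: (p %% M)%N => r rM.
have nneg s : (2 * s <= M)%N -> 0 <= cos (hang s).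
  move=> sM; apply: cos_ge0_pihalf.
  have h0 : 0 <= hang s by rewrite /hang !mulr_ge0 ?pi_ge0 // invr_ge0.
  rewrite (le_trans _ h0) /=; last by rewrite oppr_le0 divr_ge0 // pi_ge0.
  rewrite /hang -mulrA ler_wpM2l ?pi_ge0 //.
  rewrite ler_pdivrMr ?ltr0n // -(ler_pM2l (_ : 0 < 2)) // mulrA mulfV // mul1r.
  by rewrite -natrM ler_nat.
case: (leqP r (M - r)) => h; first by rewrite ger0_norm // nneg //; lia.
have -> : hang r = - hang (M - r) + pi.
  by rewrite /hang natrB ?(ltnW rM) //; field.
by rewrite cosDpi cosN normrN ger0_norm // nneg //; lia.
Qed.

Lemma hang_itv s : (s <= M)%N -> hang s \in `[0, pi].
Proof.
move=> sM; rewrite in_itv /=; apply/andP; split.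
  by rewrite /hang !mulr_ge0 ?pi_ge0 // invr_ge0.
by rewrite /hang ler_pdivrMr ?ltr0n // ler_wpM2l ?pi_ge0 // ler_nat.
Qed.

(** The two reduced angles add up to at least pi/2, so one cosine is at most the sine of the other
    angle, and cos + sin is at most the square root of 2, which 36/25 exceeds. *)
Lemma cos_outside p q : (M <= 2 * (cdist M p + cdist M q))%N ->
  `|cos (hang p)| + `|cos (hang q)| <= 36 / 25.
Proof.
rewrite !norm_cos_hang.
have : (cdist M p <= M)%N by rewrite /cdist; have := ltn_pmod p M0; lia.
have : (cdist M q <= M)%N by rewrite /cdist; have := ltn_pmod q M0; lia.
have : (2 * cdist M p <= M)%N by rewrite /cdist; have := ltn_pmod p M0; lia.
move: (cdist M p) (cdist M q) => x y x2 yM xM xy.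
have h : cos (hang y) <= sin (hang x).
  rewrite -cosBpihalf -(cosN (hang x - _)) opprB leNgt ltr_cos -?leNgt; last 2 first.
  - exact: hang_itv.
  - have := hang_itv xM; rewrite !in_itv /= => /andP[h1 h2].
    have := pi_ge0 R; have : hang x <= pi / 2.
      rewrite /hang -mulrA ler_wpM2l ?pi_ge0 // ler_pdivrMr ?ltr0n //.
      by rewrite mulrC ler_pdivlMr // -natrM ler_nat mulnC.
    by move=> h3 h4; apply/andP; split; lra.
  rewrite /hang.
  have -> : pi / 2 = (pi * M%:R / M%:R) / 2 :> R by field.
  rewrite lerBlDr -mulrDl -mulrDr -!mulrA ler_wpM2l ?pi_ge0 // mulrA.
  rewrite mulrAC ler_wpM2r ?invr_ge0 // ler_pdivrMr // -natrD -natrM ler_nat; lia.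
apply: (le_trans (lerD (lexx _) h)).
have := cos2Dsin2 (hang x); move: (cos _) (sin _) => c s cs.
have : (c + s) ^+ 2 <= 2 by have := sqr_ge0 (c - s); nra.
by move=> h2; nra.
Qed.

End Angles.

(** * Sums of periodic functions and their invariance under shears *)

Definition periodic1 (R : realType) (M : nat) (F : nat -> R) :=
  forall x, F (x + M)%N = F x.

Definition periodic2 (R : realType) (M : nat) (f : nat -> nat -> R) :=
  (forall y, periodic1 M (f^~ y)) /\ (forall x, periodic1 M (f x)).

Definition sum2 (R : realType) (M : nat) (f : nat -> nat -> R) : R :=
  \sum_(x < M) \sum_(y < M) f x y.

Section PeriodicSums.
Variable (R : realType).
Implicit Types (F : nat -> R) (f g : nat -> nat -> R).

Lemma sum_shift M F c : periodic1 M F ->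
  \sum_(x < M) F (x + c)%N = \sum_(x < M) F x.
Proof.
move=> per; elim: c => [|c IH]; first by apply: eq_bigr => x _; rewrite addn0.
rewrite -IH; case: M per {IH} => [|m] per; first by rewrite !big_ord0.
rewrite big_ord_recr [RHS]big_ord_recl /= addrC add0n.
have -> : (m + c.+1)%N = (c + m.+1)%N by lia.
rewrite per; congr (_ + _); apply: eq_bigr => x _.
by rewrite /bump /= add1n addSnnS.
Qed.

Variable M : nat.
Local Notation periodic1 := (periodic1 M).
Local Notation periodic2 := (periodic2 M).
Local Notation sum2 := (sum2 M).

Lemma sum_shift_dep (f : nat -> nat -> R) (c : nat -> nat) :
    (forall x, periodic1 (f x)) ->
  sum2 (fun x y => f x (y + c x)%N) = sum2 f.
Proof. by move=> per; apply: eq_bigr => x _; rewrite sum_shift. Qed.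

Lemma sum2_swap f : sum2 f = sum2 (fun x y => f y x).
Proof. by rewrite /sum2 exchange_big. Qed.

Lemma eq_sum2 f g : (forall x y, (x < M)%N -> (y < M)%N -> f x y = g x y) ->
  sum2 f = sum2 g.
Proof. by move=> fg; apply: eq_bigr => x _; apply: eq_bigr => y _; exact: fg. Qed.

Lemma ler_sum2 f g : (forall x y, (x < M)%N -> (y < M)%N -> f x y <= g x y) ->
  sum2 f <= sum2 g.
Proof. by move=> fg; apply: ler_sum => x _; apply: ler_sum => y _; exact: fg. Qed.

Lemma sum2D f g : sum2 (fun x y => f x y + g x y) = sum2 f + sum2 g.
Proof. by rewrite /sum2 -big_split; apply: eq_bigr => x _; rewrite big_split. Qed.

Lemma sum2Z a f : sum2 (fun x y => a * f x y) = a * sum2 f.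
Proof. by rewrite /sum2 mulr_sumr; apply: eq_bigr => x _; rewrite mulr_sumr. Qed.

Lemma sum2_ge0 f : (forall x y, 0 <= f x y) -> 0 <= sum2 f.
Proof. by move=> f0; apply: sumr_ge0 => x _; apply: sumr_ge0. Qed.

Lemma sum2_const (c : R) : sum2 (fun _ _ => c) = M%:R ^+ 2 * c.
Proof.
by rewrite /sum2 !(sumr_const, card_ord) -[LHS]mulr_natl -(mulr_natl c) mulrA expr2.
Qed.

Lemma sum2_pair f : sum2 f = \sum_(v : 'I_M * 'I_M) f v.1 v.2.
Proof. by rewrite /sum2 pair_bigA. Qed.

Lemma periodic2M f g : periodic2 f -> periodic2 g ->
  periodic2 (fun x y => f x y * g x y).
Proof. by move=> [f1 f2] [g1 g2]; split=> ? ?; rewrite ?f1 ?f2 ?g1 ?g2. Qed.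

Lemma periodic2_swap f : periodic2 f -> periodic2 (fun x y => f y x).
Proof. by move=> [f1 f2]; split=> ? ?; rewrite ?f1 ?f2. Qed.

Lemma periodic1_mul F k x : periodic1 F -> F (x + k * M)%N = F x.
Proof.
move=> per; elim: k => [|k IH]; first by rewrite addn0.
by rewrite mulSn (addnC M) addnA per.
Qed.

Lemma periodic2_shear f e : periodic2 f ->
  periodic2 (fun x y => f (x + 2 * y + e)%N y).
Proof.
move=> [f1 f2]; split=> [y x|x y].
  by rewrite -(f1 y (x + 2 * y + e)%N); congr (f _ _); lia.
rewrite f2 -(@periodic1_mul (f^~ y) 2 (x + 2 * y + e)%N) //; congr (f _ _); lia.
Qed.

Lemma sum2_shear f e : periodic2 f ->
  sum2 (fun x y => f (x + 2 * y + e)%N y) = sum2 f.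
Proof.
move=> [f1 f2]; rewrite sum2_swap [RHS]sum2_swap.
rewrite -(@sum_shift_dep (fun y x => f x y) (fun y => 2 * y + e)%N) //.
by apply: eq_sum2 => x y _ _; rewrite addnA.
Qed.

End PeriodicSums.

(** * Real Fourier transform on the torus of pairs modulo M *)

Section Fourier.
Variables (R : realType) (M : nat).
Hypothesis M0 : (0 < M)%N.
Implicit Types (f g : nat -> nat -> R) (p q x y : nat).

Let Mr0 : M%:R != 0 :> R.
Proof. by rewrite pnatr_eq0 -lt0n. Qed.

Local Notation ang := (@hang R M).

Lemma hangD p q : ang (p + q) = ang p + ang q.
Proof. by rewrite /hang natrD; field. Qed.

Lemma hangM p q : ang (p * q) = p%:R * ang q.
Proof. by rewrite /hang natrM; field. Qed.

Lemma hang_period k : ang (2 * (k * M)) = (pi *+ 2) *+ k.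
Proof. by rewrite /hang !natrM -(mulr_natr _ k) -(mulr_natr pi 2); field. Qed.

Lemma cos_hang_period (c : R) k : cos (c + ang (2 * (k * M))) = cos c.
Proof. by rewrite hang_period periodicn //; exact: cosD2pi. Qed.

Lemma sin_hang_period (c : R) k : sin (c + ang (2 * (k * M))) = sin c.
Proof. by rewrite hang_period periodicn //; exact: sinD2pi. Qed.

Lemma cos_sub_period (c : R) k : cos (c - ang (2 * (k * M))) = cos c.
Proof. by rewrite -(cos_hang_period _ k) subrK. Qed.

Lemma sin_sub_period (c : R) k : sin (c - ang (2 * (k * M))) = sin c.
Proof. by rewrite -(sin_hang_period _ k) subrK. Qed.

Lemma cos_neq1 x x' : (x < M)%N -> (x' < M)%N -> x != x' ->
  cos (ang (2 * x) - ang (2 * x')) != 1.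
Proof.
move=> xM x'M; wlog lt_x : x x' xM x'M / (x' < x)%N => [hw|_].
  rewrite neq_ltn => /orP[] h; last by apply: hw => //; rewrite gtn_eqF.
  by rewrite -cosN opprB; apply: hw => //; rewrite gtn_eqF.
have -> : ang (2 * x) - ang (2 * x') = ang (x - x') *+ 2.
  by rewrite !hangM -mulrBr mulr_natl -{1}(subnK (ltnW lt_x)) hangD addrK.
have s0 : 0 < sin (ang (x - x')).
  apply: sin_gt0_pi; rewrite /hang; apply/andP; split.
    by rewrite divr_gt0 ?mulr_gt0 ?pi_gt0 ?ltr0n ?subn_gt0.
  by rewrite ltr_pdivrMr ?ltr0n // ltr_pM2l ?pi_gt0 // ltr_nat; lia.
rewrite cos_mulr2n cos2sin2; apply/eqP => h.
have : 0 < sin (ang (x - x')) ^+ 2 by rewrite exprn_gt0.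
by lra.
Qed.

(** By periodicity the vector of the cosine sum and the sine sum is unchanged when the summation
    index moves by one; but this move rotates the vector by [a], and a nontrivial rotation fixes
    only 0. *)
Lemma sum_cos_orth x x' (c : R) : (x < M)%N -> (x' < M)%N ->
  \sum_(p < M) cos (p%:R * (ang (2 * x) - ang (2 * x')) + c) =
  (x == x')%:R * M%:R * cos c.
Proof.
move=> xM x'M; have [->|ne] := eqVneq x x'.
  rewrite subrr mul1r (eq_bigr (fun _ => cos c)); last first.
    by move=> p _; rewrite mulr0 add0r.
  by rewrite sumr_const card_ord mulr_natl.
rewrite !mul0r; have := cos_neq1 xM x'M ne; set a := _ - _ => ca.
set A := \sum_(p < M) cos _; pose B := \sum_(p < M) sin (p%:R * a + c).
have per : M%:R * a = ang (2 * (x * M)) - ang (2 * (x' * M)).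
  by rewrite /a (mulnC x) (mulnC x') !hangM; ring.
have pA : periodic1 M (fun p => cos (p%:R * a + c)).
  move=> p; rewrite natrD mulrDl per addrAC addrA cos_sub_period.
  by rewrite cos_hang_period.
have pB : periodic1 M (fun p => sin (p%:R * a + c)).
  move=> p; rewrite natrD mulrDl per addrAC addrA sin_sub_period.
  by rewrite sin_hang_period.
have eA : A = A * cos a - B * sin a.
  rewrite {1}/A -(sum_shift 1 pA) !mulr_suml -sumrB; apply: eq_bigr => p _.
  by rewrite natrD mulrDl mul1r addrAC cosD.
have eB : B = B * cos a + A * sin a.
  rewrite {1}/B -(sum_shift 1 pB) !mulr_suml -big_split; apply: eq_bigr => p _.
  by rewrite natrD mulrDl mul1r addrAC sinD.
have h1 : A * (1 - cos a) = - (B * sin a) by rewrite mulrBr mulr1 {1}eA; ring.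
have h2 : B * (1 - cos a) = A * sin a by rewrite mulrBr mulr1 {1}eB; ring.
have h : A * ((1 - cos a) ^+ 2 + sin a ^+ 2) = 0.
  by rewrite mulrDr {1}expr2 mulrA h1 mulNr mulrAC h2; ring.
have /eqP := h; rewrite mulf_eq0 => /orP[/eqP //|].
rewrite paddr_eq0 ?sqr_ge0 // => /andP[]; rewrite sqrf_eq0 subr_eq0 eq_sym.
by rewrite (negbTE ca).
Qed.

Definition phase p q x y : R := ang (2 * (p * x + q * y)).

(** With [fsin], the real and (up to sign) imaginary part of the unnormalised Fourier transform of
    the real function [f]. *)
Definition fcos f p q : R := sum2 M (fun x y => f x y * cos (phase p q x y)).
Definition fsin f p q : R := sum2 M (fun x y => f x y * sin (phase p q x y)).
Definition fnorm f p q : R := fcos f p q ^+ 2 + fsin f p q ^+ 2.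

(** The polarised form is needed: with a shear of [f] as the second function, it moves the quadratic
    form of the walk to the Fourier side. *)
Lemma parseval f g :
  sum2 M (fun p q => fcos f p q * fcos g p q + fsin f p q * fsin g p q) =
  M%:R ^+ 2 * sum2 M (fun x y => f x y * g x y).
Proof.
pose I := ('I_M * 'I_M)%type.
transitivity (\sum_(u : I) \sum_(v : I) \sum_(w : I) f v.1 v.2 * g w.1 w.2 *
    cos (u.1%:R * (ang (2 * v.1) - ang (2 * w.1)) +
         u.2%:R * (ang (2 * v.2) - ang (2 * w.2)))).
  rewrite sum2_pair; apply: eq_bigr => u _.
  rewrite /fcos /fsin !sum2_pair !big_distrlr -big_split; apply: eq_bigr => v _.
  rewrite -big_split; apply: eq_bigr => w _ /=.
  have -> : u.1%:R * (ang (2 * v.1) - ang (2 * w.1)) +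
         u.2%:R * (ang (2 * v.2) - ang (2 * w.2)) =
         phase u.1 u.2 v.1 v.2 - phase u.1 u.2 w.1 w.2.
    by rewrite /phase !hangM !hangD !hangM; ring.
  by rewrite cosB; ring.
rewrite exchange_big sum2_pair mulr_sumr; apply: eq_bigr => v _.
rewrite exchange_big (bigD1 v) //= [X in _ + X]big1 ?addr0; last first.
  move=> w wv; rewrite -mulr_sumr -(pair_bigA _ (fun (i j : 'I_M) =>
    cos (i%:R * (ang (2 * v.1) - ang (2 * w.1)) +
         j%:R * (ang (2 * v.2) - ang (2 * w.2))))) /=.
  under eq_bigr => i _ do
    (under eq_bigr => j _ do rewrite addrC; rewrite sum_cos_orth //).
  have [e2|ne2] := eqVneq (v.2 : nat) w.2; last first.
    by rewrite big1 ?mulr0 // => i _; rewrite !mul0r.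
  rewrite -mulr_sumr; under eq_bigr => i _ do rewrite -[X in cos X]addr0.
  rewrite sum_cos_orth //; have [e1|ne1] := eqVneq (v.1 : nat) w.1.
    case/eqP: wv.
    by case: v w e1 e2 => [v1 v2] [w1 w2] /= /val_inj -> /val_inj ->.
  by rewrite !mul0r !mulr0.
rewrite (eq_bigr (fun _ => f v.1 v.2 * g v.1 v.2)); last first.
  by move=> u _; rewrite !subrr !mulr0 addr0 cos0 mulr1.
by rewrite sumr_const card_prod card_ord -[LHS]mulr_natl natrM expr2.
Qed.

Lemma fcos_swap f p q : fcos (fun x y => f y x) p q = fcos f q p.
Proof.
by rewrite /fcos sum2_swap; apply: eq_sum2 => x y _ _; rewrite /phase addnC.
Qed.

Lemma fsin_swap f p q : fsin (fun x y => f y x) p q = fsin f q p.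
Proof.
by rewrite /fsin sum2_swap; apply: eq_sum2 => x y _ _; rewrite /phase addnC.
Qed.

Lemma fcos_period f p : periodic1 M (fcos f p).
Proof.
move=> q; apply: eq_sum2 => x y _ _; congr (_ * _).
rewrite -[RHS](cos_hang_period _ y) -hangD; congr (cos (ang _)); lia.
Qed.

Lemma fsin_period f p : periodic1 M (fsin f p).
Proof.
move=> q; apply: eq_sum2 => x y _ _; congr (_ * _).
rewrite -[RHS](sin_hang_period _ y) -hangD; congr (sin (ang _)); lia.
Qed.

End Fourier.

(** * Contraction of the lazy walk operator *)

Definition shear (R : realType) (f : nat -> nat -> R) x y : R :=
  \sum_(e < 2) f (x + 2 * y + e)%N y.

Definition gg_step (R : realType) (f : nat -> nat -> R) x y : R :=
  f x y / 2 + \sum_(e < 2) (f (x + 2 * y + e)%N y + f x (y + 2 * x + e)%N) / 8.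

Section Contraction.
Variables (R : realType) (M : nat).
Hypothesis M0 : (0 < M)%N.
Implicit Types (f g : nat -> nat -> R) (p q x y : nat).

Local Notation ang := (@hang R M).
Local Notation phase := (@phase R M).
Local Notation fcos := (@fcos R M).
Local Notation fsin := (@fsin R M).
Local Notation fnorm := (@fnorm R M).
Local Notation sum2 := (@sum2 R M).

Lemma periodic2_phase (c : R) p q (h : R -> R) :
    (forall t k, h (t + ang (2 * (k * M))) = h t) ->
  periodic2 M (fun x y => h (phase p q x y + c)).
Proof.
move=> hp; split=> [y x|x y] /=.
  have -> : phase p q (x + M)%N y = phase p q x y + ang (2 * (p * M)).
    by rewrite /phase -hangD //; congr (ang _); lia.
  by rewrite addrAC hp.
have -> : phase p q x (y + M)%N = phase p q x y + ang (2 * (q * M)).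
  by rewrite /phase -hangD //; congr (ang _); lia.
by rewrite addrAC hp.
Qed.

(** Since [p x + (q + 2p) y = p (x + 2y + e) + q y - p e], the transform of the shear at
    [(p, q + 2p)] is that of [f] at [(p, q)], multiplied by the sum over [e] of exp(-2i e [ang p])
    in the conjugate or the direct sense. This factor has modulus 2 |cos| and half-angle phase. *)
Lemma fcos_shear f p q : periodic2 M f ->
  fcos (shear f) p (q + 2 * p) =
  2 * cos (ang p) * (cos (ang p) * fcos f p q + sin (ang p) * fsin f p q).
Proof.
move=> per; pose F e x y := f x y * cos (phase p q x y - ang (2 * (p * e))).
have pF e : periodic2 M (F e).
  apply: periodic2M => //; apply: periodic2_phase => t k; exact: cos_hang_period.
transitivity (sum2 (fun x y => F 0%N (x + 2 * y + 0)%N y + F 1%N (x + 2 * y + 1)%N y)).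
  apply: eq_sum2 => x y _ _.
  rewrite /shear !big_ord_recr big_ord0 /= add0r mulrDl /F.
  by congr (_ * cos _ + _ * cos _); rewrite /phase /hang !(natrD, natrM); ring.
rewrite sum2D !sum2_shear // mulrDr !mulrA -!sum2Z -!sum2D.
apply: eq_sum2 => x y _ _; rewrite /F muln0 muln0 muln1 [ang 0]/hang mulr0 mul0r subr0.
rewrite (mulnC 2) mulnC hangM // mulr_natl cosB cos_mulr2n sin_mulr2n; ring.
Qed.

Lemma fsin_shear f p q : periodic2 M f ->
  fsin (shear f) p (q + 2 * p) =
  2 * cos (ang p) * (cos (ang p) * fsin f p q - sin (ang p) * fcos f p q).
Proof.
move=> per; pose F e x y := f x y * sin (phase p q x y - ang (2 * (p * e))).
have pF e : periodic2 M (F e).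
  apply: periodic2M => //; apply: periodic2_phase => t k; exact: sin_hang_period.
transitivity (sum2 (fun x y => F 0%N (x + 2 * y + 0)%N y + F 1%N (x + 2 * y + 1)%N y)).
  apply: eq_sum2 => x y _ _.
  rewrite /shear !big_ord_recr big_ord0 /= add0r mulrDl /F.
  by congr (_ * sin _ + _ * sin _); rewrite /phase /hang !(natrD, natrM); ring.
rewrite sum2D !sum2_shear // mulrBr !mulrA -!sum2Z -mulN1r -sum2Z -!sum2D.
apply: eq_sum2 => x y _ _; rewrite /F muln0 muln0 muln1 [ang 0]/hang mulr0 mul0r subr0.
rewrite (mulnC 2) mulnC hangM // mulr_natl sinB cos_mulr2n sin_mulr2n; ring.
Qed.

(* [w] and [w'] are the weights of the two endpoints of an edge; the rotation
   by the phase [(C, S)] disappears in a sum of two squares. *)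
Lemma weighted_amgm (w w' a b c d C S : R) :
    0 < w -> 0 < w' -> w * w' = 1 -> C ^+ 2 + S ^+ 2 = 1 ->
  a * (2 * C * (C * c + S * d)) + b * (2 * C * (C * d - S * c)) <=
  `|C| * (w * (c ^+ 2 + d ^+ 2) + w' * (a ^+ 2 + b ^+ 2)).
Proof.
move=> w0 w'0 ww CS; set X := a * (C * c + S * d) + b * (C * d - S * c).
have -> : a * (2 * C * (C * c + S * d)) + b * (2 * C * (C * d - S * c)) = C * (2 * X).
  by rewrite /X; ring.
set Y := _ + _ : R.
suff : `|2 * X| <= Y.
  by move=> h; rewrite (le_trans (ler_norm _)) // normrM ler_wpM2l.
have e s : s ^+ 2 = 1 -> w * (Y - s * (2 * X)) = (w * c - s * (a * C - b * S)) ^+ 2 +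
    (w * d - s * (a * S + b * C)) ^+ 2.
  move=> s1; rewrite /Y mulrBr mulrDr (mulrA w w') ww mul1r.
  have -> : a ^+ 2 + b ^+ 2 = s ^+ 2 * (C ^+ 2 + S ^+ 2) * (a ^+ 2 + b ^+ 2).
    by rewrite s1 CS !mul1r.
  by rewrite /X; ring.
rewrite ler_norml; apply/andP; split.
  have : 0 <= w * (Y - (-1) * (2 * X)) by rewrite e ?sqrrN ?expr1n // addr_ge0 ?sqr_ge0.
  by rewrite pmulr_rge0 // mulN1r opprK -lerBlDr sub0r => h; lra.
have : 0 <= w * (Y - 1 * (2 * X)) by rewrite e ?expr1n // addr_ge0 ?sqr_ge0.
by rewrite pmulr_rge0 // mul1r subr_ge0.
Qed.

Lemma shear_form_le f : periodic2 M f ->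
  M%:R ^+ 2 * sum2 (fun x y => f x y * shear f x y) <=
  sum2 (fun p q => `|cos (ang p)| *
     (ggw R (cdist M q) (cdist M (q + 2 * p)) +
      ggw R (cdist M q) (cdist M (q + 2 * (M - p)))) * fnorm f p q).
Proof.
move=> per; rewrite -parseval //.
have cdp : forall q k, cdist M (q + k * M) = cdist M q.
  by move=> q; elim=> [|k IH]; rewrite ?addn0 // mulSn (addnC M) addnA cdistD IH.
(* Reindexing by [q + 2 * p] evaluates the transform of the shear where [fcos_shear] computes it, so
   that each summand is one edge of the dual graph. *)
rewrite -(@sum_shift_dep _ M _ (fun p => 2 * p)%N); last first.
  by move=> p q; rewrite !(fcos_period, fsin_period).
pose H p q := `|cos (ang p)| *
  (ggw R (cdist M q) (cdist M (q + 2 * (M - p))) * fnorm f p q).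
apply: (@le_trans _ _ (sum2 (fun p q =>
    `|cos (ang p)| * (ggw R (cdist M q) (cdist M (q + 2 * p)) * fnorm f p q) +
    H p (q + 2 * p)%N))).
  apply: ler_sum2 => p q pM _; rewrite fcos_shear // fsin_shear // /H.
  have -> : cdist M (q + 2 * p + 2 * (M - p)) = cdist M q.
    by rewrite -(cdp q 2%N); congr (cdist M _); lia.
  rewrite -mulrDr; apply: weighted_amgm; rewrite ?ggw_gt0 ?ggw_mul //.
  exact: cos2Dsin2.
(* The terms of the far endpoints are shifted back, so every frequency collects the weights of both
   of its edges, to [q + 2p] and to [q - 2p]. *)
rewrite sum2D sum_shift_dep -?sum2D; last first.
  move=> p q; rewrite /H /fnorm fcos_period // fsin_period //.
  by rewrite addnAC !cdistD.
by apply: ler_sum2 => p q _ _; rewrite /H -mulrDr -mulrDl mulrA.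
Qed.

Lemma fnorm_swap f p q : fnorm (fun x y => f y x) p q = fnorm f q p.
Proof. by rewrite /fnorm fcos_swap fsin_swap. Qed.

(** The zero frequency is its own neighbour four times and admits no gain; mean zero removes it. *)
Lemma fnorm00 f : sum2 f = 0 -> fnorm f 0 0 = 0.
Proof.
have h (t : R) (g : R -> R) : t = g 0 -> sum2 (fun x y => f x y * g (phase 0 0 x y)) = t * sum2 f.
  move=> tg; rewrite -sum2Z; apply: eq_sum2 => x y _ _.
  by rewrite /phase !mul0n muln0 /hang mulr0 mul0r tg mulrC.
move=> f0; rewrite /fnorm /fcos /fsin (h 1) ?cos0 // (h 0) ?sin0 //.
by rewrite f0 !mulr0 expr0n addr0.
Qed.

Definition spread f x y : R := \sum_(e < 2) (f (x + 2 * y + e)%N y + f x (y + 2 * x + e)%N).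

(** Frequency by frequency: inside the diamond the cosines are bounded by 1 and the four weights by
    73/20; outside, each pair of weights is only bounded by 5/2, but the cosines give 36/25 * 5/2 =
    18/5. Swapping the coordinates reduces the second family of shears to the first. *)
Lemma spread_form_le f : periodic2 M f -> sum2 f = 0 ->
  sum2 (fun x y => f x y * spread f x y) <= 73 / 20 * sum2 (fun x y => f x y ^+ 2).
Proof.
move=> per f0.
have M2 : 0 < M%:R ^+ 2 :> R by rewrite exprn_gt0 // ltr0n.
rewrite -(ler_pM2l M2).
pose g x y := f y x.
have perg : periodic2 M g by exact: periodic2_swap.
have -> : sum2 (fun x y => f x y * spread f x y) =
   sum2 (fun x y => f x y * shear f x y) + sum2 (fun x y => g x y * shear g x y).
  rewrite [X in _ + X]sum2_swap -sum2D; apply: eq_sum2 => x y _ _.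
  by rewrite /spread big_split mulrDr.
rewrite mulrDr (le_trans (lerD (shear_form_le per) (shear_form_le perg))) //.
rewrite [X in _ + X]sum2_swap -sum2D mulrCA.
have -> : sum2 (fun x y => f x y ^+ 2) = sum2 (fun x y => f x y * f x y) by [].
rewrite -parseval // -sum2Z; apply: ler_sum2 => p q pM qM.
have -> : fnorm g q p = fnorm f p q by exact: fnorm_swap.
rewrite -mulrDl -!expr2 -/(fnorm f p q).
have fn0 : 0 <= fnorm f p q by rewrite addr_ge0 ?sqr_ge0.
have [/eqP|pq0] := posnP (p + q).
  by rewrite addn_eq0 => /andP[/eqP-> /eqP->]; rewrite (fnorm00 f0) !mulr0.
rewrite ler_wpM2r //.
case: (ltnP (2 * (cdist M p + cdist M q)) M) => h.
  have := ggw_sum_le R pM qM h pq0.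
  have := cos_max (ang p); have := cos_max (ang q).
  set s := ggw _ _ _ + ggw _ _ _; set s' := ggw _ _ _ + ggw _ _ _ => c1 c2.
  apply: le_trans; apply: lerD; rewrite ler_piMl // /s /s' addr_ge0 // ltW // ggw_gt0 //.
have := cos_outside R M0 h.
have := normr_ge0 (cos (ang p)); have := normr_ge0 (cos (ang q)).
move: `|_| `|_| => c c' c0 c'0 hc.
have hs a b a' b' : ggw R a b + ggw R a' b' <= 5 / 2.
  by have := ggw_le R a b; have := ggw_le R a' b'; lra.
apply: (le_trans (lerD (ler_wpM2l c'0 (hs _ _ _ _)) (ler_wpM2l c0 (hs _ _ _ _)))).
by lra.
Qed.

(** Cauchy-Schwarz for four terms, each of which is [f] composed with a bijection of the torus. *)
Lemma spread_sqr_le f : periodic2 M f ->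
  sum2 (fun x y => spread f x y ^+ 2) <= 16 * sum2 (fun x y => f x y ^+ 2).
Proof.
move=> per; have per2 : periodic2 M (fun x y => f x y ^+ 2) by exact: periodic2M.
have per2' : periodic2 M (fun x y => f y x ^+ 2) by exact: periodic2_swap.
have e (k : nat) : sum2 (fun x y => f x (y + 2 * x + k)%N ^+ 2) = sum2 (fun x y => f x y ^+ 2).
  by rewrite sum2_swap (sum2_shear k per2') sum2_swap.
apply: (@le_trans _ _ (sum2 (fun x y => 4 * (
   (f (x + 2 * y + 0)%N y ^+ 2 + f (x + 2 * y + 1)%N y ^+ 2) +
   (f x (y + 2 * x + 0)%N ^+ 2 + f x (y + 2 * x + 1)%N ^+ 2))))).
  apply: ler_sum2 => x y _ _; rewrite /spread !big_ord_recr big_ord0 /= add0r.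
  move: (f _ _) (f _ _) (f _ _) (f _ _) => a b c d.
  have := sqr_ge0 (a - b); have := sqr_ge0 (a - c); have := sqr_ge0 (a - d).
  have := sqr_ge0 (b - c); have := sqr_ge0 (b - d); have := sqr_ge0 (c - d).
  by rewrite !expr2; lra.
rewrite sum2Z !sum2D !e !(sum2_shear _ per2); lra.
Qed.

(** The three terms of the expanded square contribute 1/4, (73/20)/8 and 16/64, in total 153/160. *)
Lemma gg_step_contracts f : periodic2 M f -> sum2 f = 0 ->
  sum2 (fun x y => gg_step f x y ^+ 2) <= 153 / 160 * sum2 (fun x y => f x y ^+ 2).
Proof.
move=> per f0; have h1 := spread_form_le per f0; have h2 := spread_sqr_le per.
have -> : sum2 (fun x y => gg_step f x y ^+ 2) =
   4^-1 * sum2 (fun x y => f x y ^+ 2) + 8^-1 * sum2 (fun x y => f x y * spread f x y)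
   + 64^-1 * sum2 (fun x y => spread f x y ^+ 2).
  rewrite -!sum2Z -!sum2D; apply: eq_sum2 => x y _ _.
  by rewrite /gg_step -mulr_suml -/(spread f x y); field.
by lra.
Qed.

Lemma periodic2_gg_step f : periodic2 M f -> periodic2 M (gg_step f).
Proof.
move=> per; have pers := periodic2_swap per; split=> [y x|x y]; rewrite /gg_step.
  rewrite per.1; congr (_ + _); apply: eq_bigr => e _.
  by rewrite (periodic2_shear e per).1 (periodic2_shear e pers).2.
rewrite per.2; congr (_ + _); apply: eq_bigr => e _.
by rewrite (periodic2_shear e per).2 (periodic2_shear e pers).1.
Qed.

Lemma sum2_gg_step f : periodic2 M f -> sum2 (gg_step f) = sum2 f.
Proof.
move=> per; have pers := periodic2_swap per.
have e (k : nat) : sum2 (fun x y => f x (y + 2 * x + k)%N) = sum2 f.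
  by rewrite sum2_swap (sum2_shear k pers) sum2_swap.
have -> : sum2 (gg_step f) = sum2 (fun x y => 2^-1 * f x y +
   8^-1 * ((f (x + 2 * y + 0)%N y + f (x + 2 * y + 1)%N y) +
   (f x (y + 2 * x + 0)%N + f x (y + 2 * x + 1)%N))).
  by apply: eq_sum2 => x y _ _; rewrite /gg_step !big_ord_recr big_ord0 /=; field.
rewrite sum2D !sum2Z !sum2D !e !(sum2_shear _ per); lra.
Qed.

Lemma gg_step_iter_contracts t f : periodic2 M f -> sum2 f = 0 ->
  sum2 (fun x y => iter t (@gg_step R) f x y ^+ 2) <=
  (153 / 160) ^+ t * sum2 (fun x y => f x y ^+ 2).
Proof.
elim: t f => [|t IH] f per f0; first by rewrite mul1r.
rewrite iterSr (le_trans (IH _ _ _)) ?sum2_gg_step //.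
  exact: periodic2_gg_step.
rewrite exprSr -mulrA; apply: ler_wpM2l; last exact: gg_step_contracts.
by rewrite exprn_ge0 // divr_ge0.
Qed.

End Contraction.

(** * The pseudorandom generator *)

(** In the lowest base-4 digit of [l.1], the upper bit decides whether to move and the lower bit
    which coordinate moves; the parity of [l.2] is the offset. So 8 of the 16 labels stand still and
    every move has 2, as in [gg_step]. *)
Definition vstep (l v : nat * nat) : nat * nat :=
  if odd l.1./2 then
    if odd l.1 then (v.1, v.2 + 2 * v.1 + odd l.2)%N
    else (v.1 + 2 * v.2 + odd l.2, v.2)%N
  else v.

Fixpoint walk (t : nat) (l v : nat * nat) : nat * nat :=
  if t is t'.+1 then walk t' (l.1./2./2, l.2./2./2) (vstep l v) else v.

Definition shr (t : nat) (v : nat * nat) : nat * nat :=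
  (v.1 %/ 4 ^ t, v.2 %/ 4 ^ t)%N.

Definition veq (M : nat) (v w : nat * nat) : Prop :=
  (v.1 = w.1 %[mod M] /\ v.2 = w.2 %[mod M])%N.

Lemma half_half x : x./2./2 = (x %/ 4)%N.
Proof. by rewrite -!divn2 -divnMA. Qed.

Lemma eqmod_add M a b c d : (a = b %[mod M] -> c = d %[mod M] ->
  a + c = b + d %[mod M])%N.
Proof. by move=> e1 e2; rewrite -modnDm e1 e2 modnDm. Qed.

Lemma eqmod_mul2 M a b : (a = b %[mod M] -> 2 * a = 2 * b %[mod M])%N.
Proof. by move=> e; rewrite !mul2n -!addnn; apply: eqmod_add. Qed.

Lemma veq_vstep M l v w : veq M v w -> veq M (vstep l v) (vstep l w).
Proof.
move=> [e1 e2]; rewrite /vstep; case: ifP => // _; case: ifP => _; split=> //=;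
by do !apply: eqmod_add => //; apply: eqmod_mul2.
Qed.

Lemma veq_walk M t l v w : veq M v w -> veq M (walk t l v) (walk t l w).
Proof. by elim: t l v w => // t IH l v w vw; apply: IH; exact: veq_vstep. Qed.

Lemma veq_shr M t v w : (0 < M)%N -> veq (M * 4 ^ t) v w -> veq M (shr t v) (shr t w).
Proof.
have K0 : (0 < 4 ^ t)%N by rewrite expn_gt0.
have h a b : (0 < M)%N -> (a = b %[mod M * 4 ^ t] -> a %/ 4 ^ t = b %/ 4 ^ t %[mod M])%N.
  move=> M0 e; rewrite (divn_eq a (M * 4 ^ t)) (divn_eq b (M * 4 ^ t)) e !mulnA.
  by rewrite !divnMDl // !modnMDl.
by move=> M0 [e1 e2]; split; apply: h.
Qed.

Lemma vstep_low l l' v : (l.1 = l'.1 %[mod 4] -> l.2 = l'.2 %[mod 4] ->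
  vstep l v = vstep l' v)%N.
Proof.
have o a b : (a = b %[mod 4] -> odd a = odd b /\ odd a./2 = odd b./2)%N.
  move=> e; rewrite (divn_eq a 4) (divn_eq b 4) e.
  move: (b %% 4)%N => r; split; lia.
by move=> /o[e1 e2] /o[e3 _]; rewrite /vstep e1 e2 e3.
Qed.

Lemma walk_low t l l' v :
  (l.1 = l'.1 %[mod 4 ^ t] -> l.2 = l'.2 %[mod 4 ^ t] -> walk t l v = walk t l' v)%N.
Proof.
elim: t l l' v => // t IH l l' v e1 e2 /=.
have h a b : (a = b %[mod 4 ^ t.+1] -> a = b %[mod 4] /\ a./2./2 = b./2./2 %[mod 4 ^ t])%N.
  move=> e; split; last first.
    rewrite !half_half (divn_eq a (4 ^ t.+1)) (divn_eq b (4 ^ t.+1)) e.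
    by rewrite expnSr !mulnA !divnMDl // !modnMDl.
  have d4 : (4 %| 4 ^ t.+1)%N by rewrite expnS dvdn_mulr.
  by rewrite -(modn_dvdm a d4) e modn_dvdm.
have [a1 b1] := h _ _ e1; have [a2 b2] := h _ _ e2.
by rewrite (vstep_low v a1 a2); apply: IH.
Qed.

(** * Averages over the labels of a walk *)

Section Walks.
Variable R : realType.
Implicit Types f : nat -> nat -> R.

Lemma sum_mixed_radix (M K : nat) (F : nat -> R) :
  \sum_(a < M * K) F a = \sum_(a < M) \sum_(c < K) F (a * K + c)%N.
Proof.
elim: M => [|M IH]; first by rewrite mul0n !big_ord0.
rewrite big_ord_recr /= -IH mulSnr -(big_mkord xpredT) /index_iota subn0.
rewrite iotaD big_cat add0n -[in RHS](big_mkord xpredT F) /index_iota subn0.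
congr (_ + _); rewrite -[X in iota X]addn0 iotaDl big_map.
by rewrite -(big_mkord xpredT (fun c => F (M * K + c)%N)) /index_iota subn0.
Qed.

Lemma sum2_mixed_radix (M K : nat) f :
  sum2 (M * K) f =
  sum2 M (fun a b => sum2 K (fun c c' => f (a * K + c)%N (b * K + c')%N)).
Proof.
rewrite /sum2 (sum_mixed_radix _ _ (fun x => \sum_(y < M * K) f x y)).
apply: eq_bigr => a _; rewrite [RHS]exchange_big /=; apply: eq_bigr => c _.
exact: (sum_mixed_radix _ _ (f _)).
Qed.

Lemma sum_vstep f v :
  sum2 4 (fun c c' => f (vstep (c, c') v).1 (vstep (c, c') v).2) =
  16 * gg_step f v.1 v.2.
Proof.
rewrite /sum2 /gg_step !big_ord_recr !big_ord0 /vstep /=; lra.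
Qed.

Lemma sum_walk t f v :
  sum2 (4 ^ t) (fun c c' => f (walk t (c, c') v).1 (walk t (c, c') v).2) =
  16 ^+ t * iter t (@gg_step R) f v.1 v.2.
Proof.
elim: t v => [|t IH] v; first by rewrite /sum2 !big_ord1 mul1r.
(* The lowest digit of a label drives the first step, the remaining digits the other [t] steps; the
   sums are exchanged so that the walk of length [t] is averaged first. *)
rewrite expnSr sum2_mixed_radix /sum2.
under eq_bigr => a _.
  under eq_bigr => b _.
    under eq_bigr => c _.
      under eq_bigr => c' _.
        have -> : walk t.+1 (a * 4 + c, b * 4 + c')%N v =
                  walk t (a : nat, b : nat) (vstep (c : nat, c' : nat) v).
          rewrite /= !half_half !divnMDl // !divn_small // !addn0.
          by congr walk; apply: vstep_low => /=; rewrite modnMDl.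
        over.
      over.
    over.
  rewrite exchange_big /=.
  over.
rewrite exchange_big /=.
under eq_bigr => c _.
  under eq_bigr => a _ do rewrite exchange_big /=.
  rewrite exchange_big /=.
  under eq_bigr => c' _ do rewrite -/(sum2 (4 ^ t)
     (fun a b => f (walk t (a, b) (vstep (c : nat, c' : nat) v)).1
                   (walk t (a, b) (vstep (c : nat, c' : nat) v)).2)) IH.
  rewrite -mulr_sumr.
  over.
rewrite -mulr_sumr -/(sum2 4 (fun c c' => iter t (@gg_step R) f
  (vstep (c, c') v).1 (vstep (c, c') v).2)) sum_vstep.
by rewrite exprSr mulrA.
Qed.

End Walks.

Section Generator.
Variables (X : Type) (point : nat * nat -> X) (t : nat -> nat).

(** The seed [v] has a double role: its quotient by [4 ^ t i'] is the start of the walk, and its low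
    digits are the label. [walk] reads only these low digits, so it may be given [v] unreduced. *)
Fixpoint points (i : nat) (v : nat * nat) : seq X :=
  if i is i'.+1 then
    points i' (shr (t i') v) ++ points i' (walk (t i') v (shr (t i') v))
  else [:: point v].

Fixpoint modulus (M0 i : nat) : nat :=
  if i is i'.+1 then modulus M0 i' * 4 ^ t i' else M0.

Lemma size_points i v : size (points i v) = (2 ^ i)%N.
Proof. by elim: i v => //= i IH v; rewrite size_cat !IH addnn expnS mul2n. Qed.

Lemma modulus_gt0 M0 i : (0 < M0)%N -> (0 < modulus M0 i)%N.
Proof. by move=> ?; elim: i => //= i IH; rewrite muln_gt0 IH expn_gt0. Qed.

Lemma points_congr M0 i v w : (0 < M0)%N ->
    (forall v w, veq M0 v w -> point v = point w) ->
  veq (modulus M0 i) v w -> points i v = points i w.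
Proof.
move=> M0p pc; elim: i v w => [|i IH] v w vw /=; first by rewrite (pc _ _ vw).
have vw' : veq (modulus M0 i) (shr (t i) v) (shr (t i) w).
  by apply: veq_shr => //; exact: modulus_gt0.
rewrite (IH _ _ vw'); congr (_ ++ _); apply: IH.
have -> : walk (t i) v (shr (t i) v) = walk (t i) w (shr (t i) v).
  have h a b : (a = b %[mod modulus M0 i * 4 ^ t i] -> a = b %[mod 4 ^ t i])%N.
    have d : (4 ^ t i %| modulus M0 i * 4 ^ t i)%N by rewrite dvdn_mull.
    by move=> e; rewrite -(modn_dvdm a d) e modn_dvdm.
  by case: vw => [e1 e2]; apply: walk_low; exact: h.
exact: veq_walk.
Qed.

End Generator.

(** * Decision trees and the fooling induction *)

Section DecisionTree.
Variables (X : Type) (L : Type) (F : seq L -> X -> option L).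

Fixpoint descend (h : seq L) (p : seq X) : option (seq L) :=
  if p is x :: p' then
    if F h x is Some l then descend (rcons h l) p' else None
  else Some h.

Lemma descend_cat h p q :
  descend h (p ++ q) = obind (descend^~ q) (descend h p).
Proof. by elim: p h => //= x p IH h; case: (F h x). Qed.

Lemma descend_tuple h p h' : descend h p = Some h' ->
  exists2 u : (size p).-tuple L, h' = h ++ u & True.
Proof.
elim: p h => [|x p IH] h /=; first by case=> <-; exists [tuple]; rewrite ?cats0.
case: (F h x) => // l /IH[u -> _]; exists [tuple of l :: u] => //.
by rewrite cat_rcons.
Qed.

End DecisionTree.

Section Fooling.
Variables (R : realType) (X : Type) (point : nat * nat -> X) (t : nat -> nat).
Variables (L : finType) (F : seq L -> X -> option L).
Variables (M0 : nat) (delta eta : nat -> R).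

Fixpoint fooling_error (i : nat) : R :=
  if i is i'.+1 then 2 * fooling_error i' + eta i' else 0.

Definition misses h i v : R := (descend F h (points point t i v) == None)%:R.

Hypothesis M0_gt0 : (0 < M0)%N.
Hypothesis point_congr : forall v w, veq M0 v w -> point v = point w.
Hypothesis delta_ge0 : forall j, 0 <= delta j.
Hypothesis eta_gt0 : forall i, 0 < eta i.
Hypothesis step_miss : forall h,
  sum2 M0 (fun a b => (F h (point (a, b)) == None)%:R) <= M0%:R ^+ 2 * delta (size h).

Local Notation Mi i := (modulus t M0 i).

Lemma fooling_error_ge0 i : 0 <= fooling_error i.
Proof. by elim: i => //= i IH; rewrite addr_ge0 ?mulr_ge0 // ltW. Qed.

Lemma periodic2_misses h i : periodic2 (Mi i) (fun a b => misses h i (a, b)).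
Proof.
by split=> [b a|a b]; rewrite /misses; congr ((_ == _)%:R); congr descend;
  apply: points_congr M0_gt0 point_congr _; split=> //=; rewrite modnDr.
Qed.

Lemma misses01 h i v : 0 <= misses h i v <= 1.
Proof. by rewrite /misses; case: (_ == _); rewrite ?lexx ?ler01. Qed.

(* AM-GM replaces the square root of the expander mixing lemma. *)
Lemma expander_mixing M (A : nat -> nat -> bool) (B : nat -> nat -> R) s (e : R) :
    (0 < M)%N -> 0 < e -> periodic2 M B -> (forall x y, 0 <= B x y <= 1) ->
  sum2 M (fun x y => (A x y)%:R * iter s (@gg_step R) B x y) <=
  (sum2 M B / M%:R ^+ 2 + e / 2) * sum2 M (fun x y => (A x y)%:R)
    + (153 / 160) ^+ s * M%:R ^+ 2 / (2 * e).
Proof.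
move=> M_gt0 e0 per B01.
have M2 : 0 < M%:R ^+ 2 :> R by rewrite exprn_gt0 // ltr0n.
set b := sum2 M B / M%:R ^+ 2.
have b01 : 0 <= b <= 1.
  rewrite /b ler_pdivlMr // ler_pdivrMr // mul0r mul1r; apply/andP; split.
    by apply: sum2_ge0 => x y; case/andP: (B01 x y).
  rewrite -[leRHS]mulr1 -sum2_const; apply: ler_sum2 => x y _ _.
  by case/andP: (B01 x y).
pose B' x y := B x y - b.
have per' : periodic2 M B' by split=> ? ?; rewrite /B' ?per.1 ?per.2.
have B'0 : sum2 M B' = 0.
  by rewrite /B' sum2D sum2_const mulrN /b mulrCA mulfV ?mulr1 ?subrr ?gt_eqF.
have it : forall s x y, iter s (@gg_step R) B x y = iter s (@gg_step R) B' x y + b.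
  elim=> [|u IH] x y; first by rewrite /= /B' subrK.
  rewrite !iterS /gg_step !big_ord_recr !big_ord0 /= !IH; lra.
have B'sq : sum2 M (fun x y => B' x y ^+ 2) <= M%:R ^+ 2.
  rewrite -[leRHS]mulr1 -sum2_const; apply: ler_sum2 => x y _ _.
  by have := B01 x y; rewrite /B'; case/andP: b01 => b0 b1 /andP[h0 h1]; nra.
have con : sum2 M (fun x y => iter s (@gg_step R) B' x y ^+ 2) <=
    (153 / 160) ^+ s * M%:R ^+ 2.
  apply: le_trans (gg_step_iter_contracts M_gt0 s per' B'0) _.
  by rewrite ler_wpM2l // exprn_ge0 // divr_ge0.
apply: (@le_trans _ _ (sum2 M (fun x y => (b + e / 2) * (A x y)%:R +
    (2 * e)^-1 * iter s (@gg_step R) B' x y ^+ 2))).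
  apply: ler_sum2 => x y _ _; rewrite it; move: (iter s _ _ _ _) => z.
  case: (A x y); last by rewrite mul0r mulr0 add0r mulr_ge0 ?sqr_ge0 // invr_ge0 mulr_ge0 // ltW.
  have e2 : 0 < 2 * e by rewrite mulr_gt0.
  have : z <= e / 2 + (2 * e)^-1 * z ^+ 2.
    rewrite -(ler_pM2l e2) mulrDr mulVKf ?gt_eqF //.
    by have := sqr_ge0 (z - e); lra.
  by rewrite mul1r mulr1; lra.
rewrite sum2D !sum2Z lerD2l mulrC ler_wpM2r // invr_ge0 mulr_ge0 // ltW //.
Qed.

(** Either the first half already misses, or it ends in exactly one node [h ++ u] and the second
    half has to miss from there; at most one term of the sum is nonzero. *)
Lemma misses_recursion h i v :
  misses h i.+1 v = misses h i (shr (t i) v) +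
    \sum_(u : (2 ^ i).-tuple L)
      (descend F h (points point t i (shr (t i) v)) == Some (h ++ u))%:R *
      misses (h ++ u) i (walk (t i) v (shr (t i) v)).
Proof.
rewrite {1 2}/misses /= descend_cat; case e: (descend F h _) => [h'|] /=; last first.
  by rewrite big1 ?addr0 // => u _; rewrite mul0r.
have [u eu _] := descend_tuple e; rewrite add0r.
move: u eu; rewrite size_points => u ->.
rewrite (bigD1 u) //= eqxx mul1r big1 ?addr0 // => u' nu.
case: eqP => [[/eqP]|_]; last by rewrite mul0r.
by rewrite eqseq_cat // eqxx => /= /eqP/val_inj uu; rewrite uu eqxx in nu.
Qed.

(** The last term of [expander_mixing] is paid once for each of the at most [#|L| ^ (2 ^ i)] nodes.
    Taken with [e = eta i], these terms then add up to at most [eta i / 2] of the vertices; the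
    disjoint events of reaching the nodes cost the other half. *)
Hypothesis walk_long : forall i,
  (#|L| ^ (2 ^ i))%:R * (153 / 160) ^+ t i <= eta i ^+ 2.

Lemma generator_fools h i :
  sum2 (Mi i) (fun a b => misses h i (a, b)) <=
  (Mi i)%:R ^+ 2 * (\sum_(j < 2 ^ i) delta (size h + j) + fooling_error i).
Proof.
elim: i h => [|i IH] h.
  rewrite big_ord1 addn0 addr0 /=; apply: le_trans (step_miss h).
  by apply: ler_sum2 => a b _ _; rewrite /misses /=; case: (F h _).
set M := Mi i; set K := (4 ^ t i)%N; have M_gt0 : (0 < M)%N by exact: modulus_gt0.
have M2 : 0 < M%:R ^+ 2 :> R by rewrite exprn_gt0 // ltr0n.
have K_gt0 : (0 < K)%N by rewrite expn_gt0.
set D1 := \sum_(j < 2 ^ i) delta (size h + j) + fooling_error i.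
pose D2 := \sum_(j < 2 ^ i) delta (size h + 2 ^ i + j) + fooling_error i.
pose A (u : (2 ^ i).-tuple L) x y := descend F h (points point t i (x, y)) == Some (h ++ u).
pose B (u : (2 ^ i).-tuple L) x y := misses (h ++ u) i (x, y).
(* The seed is split into vertex and label; for a fixed vertex and node, the average over the labels
   is the iterated walk operator. *)
have -> : sum2 (Mi i.+1) (fun a b => misses h i.+1 (a, b)) = K%:R ^+ 2 *
    (sum2 M (fun x y => misses h i (x, y)) +
     \sum_u sum2 M (fun x y => (A u x y)%:R * iter (t i) (@gg_step R) (B u) x y)).
  rewrite [Mi _]/= sum2_mixed_radix.
  have -> : \sum_u sum2 M (fun x y => (A u x y)%:R * iter (t i) (@gg_step R) (B u) x y) =
     sum2 M (fun x y => \sum_u (A u x y)%:R * iter (t i) (@gg_step R) (B u) x y).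
    by rewrite /sum2 exchange_big; apply: eq_bigr => x _; rewrite exchange_big.
  rewrite -sum2D -sum2Z; apply: eq_sum2 => x y _ _.
  have shrE c c' : (c < K)%N -> (c' < K)%N -> shr (t i) (x * K + c, y * K + c')%N = (x, y).
    by move=> cK c'K; rewrite /shr /= !divnMDl // !divn_small // !addn0.
  have -> : sum2 K (fun c c' => misses h i.+1 (x * K + c, y * K + c')%N) =
     sum2 K (fun c c' => misses h i (x, y) + \sum_u (A u x y)%:R *
        misses (h ++ u) i (walk (t i) (c, c') (x, y))).
    apply: eq_sum2 => c c' cK c'K; rewrite misses_recursion shrE //.
    congr (_ + _); apply: eq_bigr => u _; congr (_ * misses _ _ _).
    by apply: walk_low => /=; rewrite modnMDl.
  rewrite sum2D mulrDr; congr (_ + _).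
    by rewrite sum2_const.
  rewrite mulr_sumr /sum2.
  under eq_bigr => c _ do rewrite exchange_big /=.
  rewrite exchange_big /=; apply: eq_bigr => u _.
  transitivity ((A u x y)%:R * sum2 K (fun c c' => misses (h ++ u) i (walk (t i) (c, c') (x, y)))).
    by rewrite -sum2Z.
  rewrite mulrCA; congr (_ * _).
  have := sum_walk (t i) (B u) (x, y); rewrite /B /= => e.
  transitivity (16 ^+ t i * iter (t i) (@gg_step R) (B u) x y).
    by rewrite -e; apply: eq_sum2 => c c' _ _; rewrite -surjective_pairing.
  by rewrite /K natrX -exprM mulnC exprM; congr (_ ^+ _ * _); ring.
have sizeu (u : (2 ^ i).-tuple L) : size (h ++ u) = (size h + 2 ^ i)%N by rewrite size_cat size_tuple.
have D2_ge0 : 0 <= D2 by rewrite addr_ge0 ?fooling_error_ge0 ?sumr_ge0.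
have hB u : sum2 M (B u) / M%:R ^+ 2 <= D2.
  by rewrite ler_pdivrMr // mulrC; have := IH (h ++ u); rewrite sizeu.
(* A vertex leads the first half to at most one node, so the sets [A u] are disjoint. *)
have sumA : \sum_u sum2 M (fun x y => (A u x y)%:R) <= M%:R ^+ 2 :> R.
  have -> : \sum_u sum2 M (fun x y => (A u x y)%:R) = sum2 M (fun x y => \sum_u (A u x y)%:R) :> R.
    by rewrite /sum2 exchange_big; apply: eq_bigr => x _; rewrite exchange_big.
  rewrite -[leRHS]mulr1 -sum2_const; apply: ler_sum2 => x y _ _.
  case: (pickP (fun u => A u x y)) => [u /[dup] Au /eqP eu|none]; last first.
    by rewrite big1 // => u _; rewrite none.
  rewrite (bigD1 u) //= Au big1 ?addr0 // => u' nu; rewrite /A eu.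
  case: eqP => [[/eqP]|//]; rewrite eqseq_cat // eqxx => /= /eqP/val_inj uu.
  by rewrite uu eqxx in nu.
have sumAB : \sum_u sum2 M (fun x y => (A u x y)%:R * iter (t i) (@gg_step R) (B u) x y)
    <= M%:R ^+ 2 * (D2 + eta i).
  apply: (@le_trans _ _ (\sum_u ((D2 + eta i / 2) * sum2 M (fun x y => (A u x y)%:R)
      + (153 / 160) ^+ t i * M%:R ^+ 2 / (2 * eta i)))).
    apply: ler_sum => u _.
    apply: le_trans (expander_mixing _ _ M_gt0 (eta_gt0 i) (periodic2_misses _ _) _) _.
      by move=> x y; exact: misses01.
    rewrite lerD2r ler_wpM2r ?lerD2r ?hB //.
    by apply: sum2_ge0 => x y; case: (A _ _ _).
  rewrite big_split -mulr_sumr /= sumr_const card_tuple.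
  have -> : M%:R ^+ 2 * (D2 + eta i) = (D2 + eta i / 2) * M%:R ^+ 2 + M%:R ^+ 2 * (eta i / 2).
    by lra.
  apply: lerD; first by rewrite ler_wpM2l // addr_ge0 // divr_ge0 // ltW.
  rewrite -[X in X <= _]mulr_natl [X in X <= _]mulrA ler_pdivrMr ?mulr_gt0 //.
  rewrite [X in X <= _]mulrA.
  have -> : M%:R ^+ 2 * (eta i / 2) * (2 * eta i) = eta i ^+ 2 * M%:R ^+ 2 by lra.
  by rewrite ler_wpM2r // ltW.
rewrite natrM exprMn -/K [leRHS]mulrAC [leRHS]mulrC.
rewrite ler_wpM2l ?sqr_ge0 //.
have -> : \sum_(j < 2 ^ i.+1) delta (size h + j) =
  \sum_(j < 2 ^ i) delta (size h + j) + \sum_(j < 2 ^ i) delta (size h + 2 ^ i + j).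
  rewrite expnS mul2n -addnn big_split_ord /=; congr (_ + _).
  by apply: eq_bigr => j _; rewrite addnA.
have -> : M%:R ^+ 2 * (\sum_(j < 2 ^ i) delta (size h + j) +
    \sum_(j < 2 ^ i) delta (size h + 2 ^ i + j) + (2 * fooling_error i + eta i)) =
  M%:R ^+ 2 * D1 + M%:R ^+ 2 * (D2 + eta i) by rewrite /D1 /D2; ring.
by rewrite lerD // IH.
Qed.

End Fooling.

(** * From the random tape to seeds and points *)

Fixpoint bits (n : nat) (v : nat * nat) : seq bool :=
  if n is n'.+1 then odd v.1 :: bits n' (v.2, v.1./2) else [::].

Definition bits_tuple (n : nat) (v : nat * nat) : n.-tuple bool :=
  [tuple nth false (bits n v) i | i < n].

Fixpoint load (h : nat) (s : seq bool) (v : nat * nat) : nat * nat :=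
  if h is h'.+1 then
    load h' (drop 2 s) (2 * v.1 + nth false s 0, 2 * v.2 + nth false s 1)%N
  else v.

Lemma size_bits n v : size (bits n v) = n.
Proof. by elim: n v => //= n IH v; rewrite IH. Qed.

Lemma val_bits_tuple n v : val (bits_tuple n v) = bits n v.
Proof.
apply: (@eq_from_nth _ false); rewrite size_tuple ?size_bits // => i ni.
by rewrite -(tnth_nth _ _ (Ordinal ni)) tnth_mktuple.
Qed.

Lemma bits_congr n h1 h2 v w : (uphalf n <= h1)%N -> (n./2 <= h2)%N ->
  (v.1 = w.1 %[mod 2 ^ h1] -> v.2 = w.2 %[mod 2 ^ h2] -> bits n v = bits n w)%N.
Proof.
elim: n h1 h2 v w => // n IH [|h1] h2 v w //=; rewrite ltnS => n1 n2 e1 e2.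
have [ea eb] : odd v.1 = odd w.1 /\ (v.1./2 = w.1./2 %[mod 2 ^ h1])%N.
  split.
    have d2 : (2 %| 2 ^ h1.+1)%N by rewrite expnS dvdn_mulr.
    by have := modn_dvdm v.1 d2; rewrite e1 modn_dvdm // !modn2; case: odd; case: odd.
  rewrite -!divn2 (divn_eq v.1 (2 ^ h1.+1)) (divn_eq w.1 (2 ^ h1.+1)) e1.
  by rewrite expnSr !mulnA !divnMDl // !modnMDl.
by rewrite ea (IH h2 h1 (v.2, v.1./2) (w.2, w.1./2)).
Qed.

Section Sums.
Variable R : realType.
Implicit Types G : seq bool -> R.

Lemma sum_tupleS n G : \sum_(u : n.+1.-tuple bool) G u =
  \sum_(b : bool) \sum_(u : n.-tuple bool) G (b :: u).
Proof.
rewrite pair_bigA (reindex (fun p : bool * n.-tuple bool => [tuple of p.1 :: p.2])) //=.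
exists (fun u => (thead u, [tuple of behead u])) => [[b u] _|u _] /=.
  by congr (_, _); apply: val_inj.
by apply: val_inj => /=; case/tupleP: u.
Qed.

Lemma sum_bool (g : bool -> R) : \sum_(b : bool) g b = g true + g false.
Proof. by rewrite big_bool. Qed.

Lemma sum_half (h : nat) (g : bool -> nat -> R) :
  \sum_(a < 2 ^ h.+1) g (odd a) a./2 = \sum_(b : bool) \sum_(a < 2 ^ h) g b a.
Proof.
rewrite expnSr (sum_mixed_radix _ _ (fun a => g (odd a) a./2)) sum_bool -big_split.
apply: eq_bigr => a _; rewrite !big_ord_recr big_ord0 /= add0r addrC.
have -> : odd (a * 2 + 1) = true by lia.
have -> : odd (a * 2 + 0) = false by lia.
have -> : ((a * 2 + 1)./2 = a)%N by lia.
by have -> : ((a * 2 + 0)./2 = a)%N by lia.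
Qed.

(** Bits are drawn from the two coordinates in turn, so [uphalf n] binary digits in each suffice and
    the base level wastes at most one bit. The exponents [h1] and [h2] are separate because [bits]
    swaps the coordinates at every step. *)
Lemma sum_bits n h1 h2 G : (uphalf n <= h1)%N -> (n./2 <= h2)%N ->
  2 ^+ n * \sum_(a < 2 ^ h1) \sum_(b < 2 ^ h2) G (bits n (a : nat, b : nat)) =
  2 ^+ (h1 + h2) * \sum_(u : n.-tuple bool) G u.
Proof.
elim: n h1 h2 G => [|n IH] h1 h2 G.
  move=> _ _; rewrite mul1r /= !(sumr_const, card_ord).
  rewrite (big_pred1 [tuple]) => [|u]; last by apply/esym/eqP; exact: tuple0.
  by rewrite -mulrnA -[LHS]mulr_natl -expnD natrX addnC.
case: h1 => [//|h1] /=; rewrite ltnS => n1 n2.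
under eq_bigr => a _ do rewrite /=.
rewrite (sum_half h1 (fun o a => \sum_(b < 2 ^ h2) G (o :: bits n (b : nat, a)))).
rewrite sum_tupleS !mulr_sumr; apply: eq_bigr => o _.
rewrite exchange_big exprS -mulrA (IH h2 h1 (fun s => G (o :: s))) //.
by rewrite addSn exprS mulrA addnC.
Qed.

(** The prefix [v] already read is kept general for the induction; from [(0, 0)] a uniform tape
    gives a uniform vertex. *)
Lemma sum_load h (f : nat -> nat -> R) (v : nat * nat) :
  \sum_(u : (h.*2).-tuple bool) f (load h u v).1 (load h u v).2 =
  sum2 (2 ^ h) (fun x y => f (v.1 * 2 ^ h + x)%N (v.2 * 2 ^ h + y)%N).
Proof.
elim: h v => [|h IH] v.
  rewrite /sum2 !big_ord1 (big_pred1 [tuple]) /= ?muln1 ?addn0 // => u.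
  by apply/esym/eqP; exact: tuple0.
rewrite (sum_tupleS _ (fun u => f (load h.+1 u v).1 (load h.+1 u v).2)).
under eq_bigr => b _.
  rewrite (sum_tupleS _ (fun u => f (load h.+1 (b :: u) v).1 (load h.+1 (b :: u) v).2)).
  under eq_bigr => b' _.
    under eq_bigr => u _ do rewrite /= drop0.
    rewrite IH /=.
    over.
  over.
rewrite !sum_bool expnS sum2_mixed_radix [RHS]/sum2 !big_ord_recr !big_ord0 /= !add0r.
have e a x : (a * (2 * 2 ^ h) + (0 * 2 ^ h + x) = 2 * a * 2 ^ h + x)%N by lia.
have e1 a x : (a * (2 * 2 ^ h) + (1 * 2 ^ h + x) = (2 * a + 1) * 2 ^ h + x)%N by lia.
rewrite [LHS]addrC [X in X + _]addrC [X in _ + X]addrC.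
by congr (_ + _ + (_ + _)); apply: eq_sum2 => x y _ _; rewrite ?(e, e1, addn0).
Qed.

End Sums.

(** Sixteen steps at least halve the mixing error. Of the halvings, [2 ^ i * b] pay for the number
    of nodes, at most [2 ^ (2 ^ i * b)], and [2 * ell] for the square of [gamma / 2 ^ m]. *)
Definition walk_length (b ell i : nat) : nat := 16 * (2 ^ i * b + 2 * ell).

Fixpoint half_seed (h0 : nat) (t : nat -> nat) (m : nat) : nat :=
  if m is m'.+1 then half_seed h0 t m' + 2 * t m' else h0.

Lemma modulus_pow2 t h0 m : modulus t (2 ^ h0) m = (2 ^ half_seed h0 t m)%N.
Proof. by elim: m => //= m ->; rewrite expnD expnM. Qed.

Section GeneratorProbability.
Variables (R : realType) (n m b ell : nat) (L : finType).
Variables (F : seq L -> n.-tuple bool -> option L) (delta : nat -> R) (gamma : R).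

Let t := walk_length b ell.
Let H := half_seed (uphalf n) t m.

Lemma gap_pow16 : (153 / 160) ^+ 16 <= 1 / 2 :> R.
Proof.
have e2 : (153 / 160) ^+ 2 <= 183 / 200 :> R by rewrite expr2; lra.
have p s (x y : R) : 0 <= x -> x <= y -> y ^+ 2 <= s -> x ^+ 2 <= s.
  by move=> x0 xy; apply: le_trans; rewrite lerXn2r ?nnegrE // (le_trans x0).
have -> : 16%N = (2 * 2 * 2 * 2)%N by [].
rewrite !exprM; apply: (p _ _ (707 / 1000)); last by rewrite expr2; lra.
  by rewrite sqr_ge0.
apply: (p _ _ (84 / 100)); last by rewrite expr2; lra.
  by rewrite sqr_ge0.
apply: (p _ _ (183 / 200)); [exact: sqr_ge0|exact: e2|by rewrite expr2; lra].
Qed.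

Lemma uprob_load (f : nat * nat -> bool) :
  uprob R [set u : (H.*2).-tuple bool | f (load H u (0, 0)%N)] =
  sum2 (2 ^ H) (fun a c => (f (a, c))%:R) / (2 ^ H)%:R ^+ 2.
Proof.
rewrite /uprob; congr (_ / _); last first.
  by rewrite card_tuple card_bool -muln2 expnM natrX.
rewrite -sum1_card natr_sum.
have := sum_load H (fun a c => (f (a, c))%:R : R) (0, 0)%N.
rewrite /= => <-; rewrite big_mkcond /=.
by apply: eq_bigr => u _; rewrite inE -surjective_pairing; case: (f _).
Qed.

Hypotheses (Lb : (#|L| <= 2 ^ b)%N) (gamma0 : 0 < gamma).
Hypothesis ellP : 2 ^+ m <= 2 ^+ ell * gamma.
Hypothesis delta_ge0 : forall j, 0 <= delta j.
Hypothesis F_miss : forall h, uprob R [set x | F h x == None] <= delta (size h).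

Lemma generator_uprob :
  uprob R [set u : (H.*2).-tuple bool |
    descend F [::] (points (@bits_tuple n) t m (load H u (0, 0)%N)) == None] <=
  \sum_(j < 2 ^ m) delta j + gamma.
Proof.
(* With the same error at all levels, the recursion [2 * err + eta] gives
   [(2 ^ m - 1) * (gamma / 2 ^ m)], which is below [gamma]. *)
pose eta (i : nat) : R := gamma / 2 ^+ m.
have eta0 i : 0 < eta i by rewrite divr_gt0 // exprn_gt0.
have M0 : (0 < 2 ^ uphalf n)%N by rewrite expn_gt0.
have pc v w : veq (2 ^ uphalf n) v w -> bits_tuple n v = bits_tuple n w.
  move=> [e1 e2]; apply: val_inj; rewrite !val_bits_tuple.
  apply: (bits_congr (leqnn _) _ e1 e2); lia.
have miss h : sum2 (2 ^ uphalf n) (fun a c => (F h (bits_tuple n (a, c)) == None)%:R) <=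
    (2 ^ uphalf n)%:R ^+ 2 * delta (size h).
  have p2 : 0 < 2 ^+ n :> R by rewrite exprn_gt0.
  pose G s : R := (F h [tuple nth false s i | i < n] == None)%:R.
  have n2 : (n./2 <= uphalf n)%N by lia.
  have := sum_bits G (leqnn (uphalf n)) n2; rewrite -/(sum2 (2 ^ uphalf n)
    (fun a c => G (bits n (a, c)))) => e.
  rewrite -(ler_pM2l p2) {}e.
  have -> : \sum_(u : n.-tuple bool) G u = #|[set x | F h x == None]|%:R.
    rewrite -sum1_card natr_sum [RHS]big_mkcond; apply: eq_bigr => u _.
    rewrite inE /G; have -> : [tuple nth false u i | i < n] = u.
      by apply: eq_from_tnth => i; rewrite tnth_mktuple (tnth_nth false).
    by case: (_ == _).
  have := F_miss h; rewrite /uprob card_tuple card_bool ler_pdivrMr ?ltr0n ?expn_gt0 //.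
  move=> le; rewrite natrX -exprM mulrCA muln2 -addnn ler_wpM2l ?exprn_ge0 //.
  by rewrite (le_trans le) // mulrC natrX.
have wl i : (#|L| ^ (2 ^ i))%:R * (153 / 160) ^+ t i <= eta i ^+ 2.
  rewrite /t /walk_length exprM.
  have r0 : 0 <= (153 / 160) ^+ 16 :> R by apply: exprn_ge0; lra.
  move: (_ ^+ 16) r0 gap_pow16 => r r0 r2.
  apply: (@le_trans _ _ (2 ^+ (2 ^ i * b) * (1 / 2) ^+ (2 ^ i * b + 2 * ell))).
    apply: ler_pM; [exact: ler0n|exact: exprn_ge0| |].
      by rewrite -natrX ler_nat mulnC expnM leq_exp2r ?expn_gt0.
    by rewrite lerXn2r ?nnegrE ?divr_ge0.
  rewrite exprD mulrA -exprMn mulrA mulr1 mulfV // expr1n !mul1r mulnC exprM.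
  apply: lerXn2r; rewrite ?nnegrE ?exprn_ge0 ?(ltW (eta0 i)) //.
  rewrite /eta ler_pdivlMr ?exprn_gt0 // exprVn.
  by rewrite ler_pdivrMl ?exprn_gt0.
have := generator_fools M0 pc delta_ge0 eta0 miss wl [::] m.
rewrite modulus_pow2 -/H => fools.
rewrite (uprob_load (fun v =>
  descend F [::] (points (@bits_tuple n) t m v) == None)) ler_pdivrMr; last first.
  by rewrite exprn_gt0 // ltr0n expn_gt0.
rewrite mulrC (le_trans fools) // ler_wpM2l ?sqr_ge0 // lerD2l.
have fe i : fooling_error eta i = (2 ^+ i - 1) * (gamma / 2 ^+ m).
  by elim: i => [|i /= ->]; rewrite ?subrr ?mul0r // exprS /eta; lra.
rewrite fe mulrCA ger_pMr // ler_pdivrMr ?exprn_gt0 // mul1r; lra.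
Qed.

End GeneratorProbability.

(** * Rounding *)

Lemma rV_norm_leP (R : realType) (d : nat) (x : 'rV[R]_d) (e : R) : 0 <= e ->
  reflect (forall j, `|x 0 j| <= e) (`|x| <= e).
Proof.
move=> e0; rewrite [`|x|]mx_normrE; apply: (iffP idP) => [h j|h].
  apply: le_trans h; exact: (le_bigmax _ (fun ij => `|x ij.1 ij.2|) (0, j)).
by apply: bigmax_le => // -[i j] _; rewrite ord1 /= h.
Qed.

Section Rounding.
Variables (R : realType) (d d0 : nat) (eps : R).

Definition grid : R := (d0.+1)%:R * (2 * eps).
Definition round_down (x : R) : R := (Num.floor (x / grid))%:~R * grid.
Definition shifted (s : nat) (x : R) : R := x + s%:R * (2 * eps).
(** The next grid point above the shifted value is at distance at most [2 eps]. Only this side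
    matters, because the answer is compared with the rounding of [mu + eps], which lies between the
    value and the value plus [2 eps]. *)
Definition unsafe (x : R) (s : nat) : bool :=
  round_down (shifted s x) + grid <= shifted s x + 2 * eps.
Definition unshifted (s : nat) (x : R) : R := round_down (shifted s x) - s%:R * (2 * eps).

Definition safe_shift (W : 'rV[R]_d) (c s : nat) : bool :=
  [forall j : 'I_d, (j %/ d0 == c)%N ==> ~~ unsafe (W 0 j) s].

Definition first_safe (W : 'rV[R]_d) (c : nat) : nat :=
  find (safe_shift W c) (iota 0 d0.+1).

Definition rounded (W : 'rV[R]_d) : 'rV[R]_d :=
  \row_j unshifted (first_safe W (j %/ d0)) (W 0 j).

(** For positive [d], [(d.-1 %/ d0).+1] is d / d0 rounded up, the number of groups. *)
Definition label := {ffun 'I_(d.-1 %/ d0).+1 -> 'I_d0.+1}.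

Definition label_of (W : 'rV[R]_d) : label := [ffun c : 'I__ => inord (first_safe W c)].

(* [mu] determines the answer up to the label, since [W + s (2 eps)] and
   [W + (s + 1) (2 eps)] enclose [mu + eps + s (2 eps)] in the same grid cell. *)
Definition decode (mu : 'rV[R]_d) (l : label) : 'rV[R]_d :=
  \row_j unshifted (l (inord (j %/ d0))) (mu 0 j + eps).

Hypotheses (eps0 : 0 < eps) (d0_gt0 : (0 < d0)%N).

Lemma grid_gt0 : 0 < grid.
Proof. by rewrite mulr_gt0 ?ltr0n // mulr_gt0. Qed.

Lemma round_down_itv x : round_down x <= x < round_down x + grid.
Proof.
have g0 := grid_gt0; have /andP[h1 h2] := floor_itv (x / grid).
rewrite /round_down -ler_pdivlMr // h1 /=.
by rewrite -[X in _ + X]mul1r -mulrDl -ltr_pdivrMr // -(intrD _ _ 1).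
Qed.

Lemma round_down_eq x y : round_down x <= y < round_down x + grid ->
  round_down y = round_down x.
Proof.
have g0 := grid_gt0; move=> /andP[h1 h2]; congr (_%:~R * _).
apply: floor_def; rewrite ler_pdivlMr // h1 /= ltr_pdivrMr //.
by rewrite intrD mulrDl mul1r.
Qed.

(** Of two unsafe shifts the larger would be close to a later grid point, at least one mesh beyond
    the first; but the [d0 + 1] shifts, even lengthened by the margin [2 eps], span no more than one
    mesh. *)
Lemma unsafe_uniq x s s' : (s <= d0)%N -> (s' <= d0)%N ->
  unsafe x s -> unsafe x s' -> s = s'.
Proof.
have g0 := grid_gt0.
wlog : s s' / (s < s')%N => [hw sd s'd u u'|ss sd s'd].
  by case: (ltngtP s s') => // h; [|symmetry]; apply: hw.
rewrite /unsafe.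
have /andP[_ a1] := round_down_itv (shifted s x).
have /andP[_ a2] := round_down_itv (shifted s' x).
move=> a3 a4; have e2 : 0 < 2 * eps by rewrite mulr_gt0.
have ss1 : s%:R * (2 * eps) + 2 * eps <= s'%:R * (2 * eps).
  by rewrite -[X in _ + X]mul1r -mulrDl ler_pM2r // natr1 ler_nat.
have kk : round_down (shifted s x) + grid <= round_down (shifted s' x).
  rewrite /round_down -[X in _ + X]mul1r -mulrDl ler_pM2r // -(intrD _ _ 1) ler_int.
  rewrite lezD1 -(ltr_int R) -(ltr_pM2r g0) -(ltrD2r grid).
  by apply: le_lt_trans a3 _; apply: le_lt_trans a2; rewrite /shifted -addrA lerD2l.
have : s'%:R * (2 * eps) <= d0%:R * (2 * eps) by rewrite ler_pM2r // ler_nat.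
have : 0 <= s%:R * (2 * eps) by rewrite mulr_ge0 // ltW.
have : grid = d0%:R * (2 * eps) + 2 * eps by rewrite /grid -natr1; ring.
move: (round_down (shifted s x)) (round_down _) a1 a4 kk => r r'.
by move: ss1; rewrite /shifted => *; exfalso; lra.
Qed.

(** Pigeonhole: otherwise each of the [d0 + 1] shifts would have its own unsafe coordinate in the
    group, and the coordinates of a group have only [d0] residues modulo [d0]. *)
Lemma exists_safe W c : has (safe_shift W c) (iota 0 d0.+1).
Proof.
apply: contraT => /hasPn none.
have bad (s : 'I_d0.+1) : exists j : 'I_d, (j %/ d0 == c)%N && unsafe (W 0 j) s.
  have := none s; rewrite mem_iota /= add0n ltn_ord => /(_ isT).
  by rewrite negb_forall => /existsP[j]; rewrite negb_imply negbK => ?; exists j.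
pose g s := xchoose (bad s); have gP s : (g s %/ d0 == c)%N && unsafe (W 0 (g s)) s := xchooseP (bad s).
pose r (s : 'I_d0.+1) := inord (g s %% d0) : 'I_d0.-1.+1.
suff /leq_card : injective r by rewrite !card_ord prednK // ltnn.
move=> s s' /(congr1 val); rewrite /= !inordK ?prednK ?ltn_mod // => e.
have /andP[/eqP c1 u1] := gP s; have /andP[/eqP c2 u2] := gP s'.
have gg : g s = g s'.
  by apply: val_inj; rewrite /= (divn_eq (g s) d0) (divn_eq (g s') d0) c1 c2 e.
rewrite -gg in u2; apply: val_inj.
exact: (unsafe_uniq (ltn_ord s) (ltn_ord s') u1 u2).
Qed.

Lemma first_safe_le W c : (first_safe W c <= d0)%N.
Proof. by have := exists_safe W c; rewrite has_find size_iota ltnS. Qed.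

Lemma first_safeP W c : safe_shift W c (first_safe W c).
Proof.
have := nth_find 0%N (exists_safe W c).
by rewrite nth_iota ?add0n // ltnS first_safe_le.
Qed.

Lemma first_safe_min W c s : (s < first_safe W c)%N -> ~~ safe_shift W c s.
Proof.
move=> sf; have := before_find 0%N sf; rewrite nth_iota => [->//|].
by rewrite (leq_trans sf) // leqW // first_safe_le.
Qed.

Lemma rounded_decode W mu : `|W - mu| <= eps -> rounded W = decode mu (label_of W).
Proof.
move=> /(rV_norm_leP _ (ltW eps0)) close; apply/rowP => j; rewrite !mxE ffunE.
have jd : (j %/ d0 < (d.-1 %/ d0).+1)%N.
  by rewrite ltnS leq_div2r //; have := ltn_ord j; lia.
rewrite !inordK // ?ltnS ?first_safe_le //.
have /forallP/(_ j)/implyP/(_ (eqxx _)) := first_safeP W (j %/ d0).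
move: (first_safe _ _) => s; rewrite /unsafe -ltNge => h.
rewrite /unshifted; congr (_ - _); symmetry; apply: round_down_eq.
have /andP[h1 _] := round_down_itv (shifted s (W 0 j)).
have := close j; rewrite !mxE ler_norml => /andP[c1 c2].
apply/andP; split; first by apply: (le_trans h1); rewrite /shifted; lra.
by apply: le_lt_trans h; rewrite /shifted; lra.
Qed.

(** Rounding [mu + eps] down moves it by less than one mesh, so the error is at most the mesh minus
    [eps], that is [(2 d0 + 1) eps]. *)
Lemma decode_close mu l : `|decode mu l - mu| <= 4 * (eps * d0%:R).
Proof.
have d1 : (1 <= d0%:R :> R) by rewrite ler1n.
have e1 : eps <= eps * d0%:R by rewrite ler_peMr // ltW.
have g : grid = 2 * (eps * d0%:R) + 2 * eps by rewrite /grid -natr1; ring.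
apply/rV_norm_leP; first by rewrite !mulr_ge0 // ltW.
move=> j; rewrite !mxE /unshifted; move: (nat_of_ord _) => s.
have /andP[h1 h2] := round_down_itv (shifted s (mu 0 j + eps)).
rewrite g {}/shifted in h1 h2 *; rewrite ler_norml.
by apply/andP; split; lra.
Qed.

Lemma card_label : #|{: label}| = (d0.+1 ^ (d.-1 %/ d0).+1)%N.
Proof. by rewrite card_ffun !card_ord. Qed.

End Rounding.

(** * Programs and their running time *)

Local Open Scope nat_scope.

Fixpoint straight (i : instr) (l : seq instr) : cmd :=
  if l is j :: l' then Seq (Do i) (straight j l') else Do i.

(* Register 4 holds the constant 1 when loops are run. *)
Definition loop (cnt : nat) (c : cmd) : cmd :=
  While (NLe 4 cnt) (Seq c (Do (NSub cnt cnt 4))).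

Arguments straight : simpl never.

Section Triples.
Variables (R : realType) (n d : nat) (O : owner R n d) (tape : seq bool).
Notation state := (state R d).
Implicit Types (s : state) (Q : state -> Prop) (c : cmd).

(** Total correctness with a time bound, from one given state. Quantifying over the pending commands
    [K] makes triples compose. *)
Definition triple c s (T : nat) Q : Prop :=
  exists t s', [/\ t <= T, forall K, iter t (step O tape) (c :: K, s) = (K, s') & Q s'].

Lemma triple_weaken c s T T' Q Q' : triple c s T Q -> T <= T' ->
  (forall s', Q s' -> Q' s') -> triple c s T' Q'.
Proof.
move=> [t [s' [tT h q]]] TT' QQ; exists t, s'; split=> //; last exact: QQ.
exact: leq_trans TT'.
Qed.

Lemma triple_post c s T Q Q' : triple c s T Q ->
  (forall s', Q s' -> Q' s') -> triple c s T Q'.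
Proof. by move=> h q; exact: triple_weaken h (leqnn _) q. Qed.

Lemma triple_do i s T Q : 0 < T -> Q (exec O tape i s) -> triple (Do i) s T Q.
Proof. by move=> T0 q; exists 1, (exec O tape i s). Qed.

Lemma triple_seq c1 c2 s T1 T2 Q1 Q : triple c1 s T1 Q1 ->
  (forall s', Q1 s' -> triple c2 s' T2 Q) -> triple (Seq c1 c2) s (T1 + T2).+1 Q.
Proof.
move=> [t1 [s1 [tT1 h1 q1]]] /(_ _ q1)[t2 [s2 [tT2 h2 q2]]].
exists (t2 + t1).+1, s2; split=> //; first by rewrite ltnS addnC leq_add.
by move=> K; rewrite iterSr /= iterD h1 h2.
Qed.

Lemma triple_if b c1 c2 s T Q :
    (holds b s -> triple c1 s T Q) -> (~~ holds b s -> triple c2 s T Q) ->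
  triple (If b c1 c2) s T.+1 Q.
Proof.
move=> h1 h2; case e: (holds b s).
  have [t [s' [tT h q]]] := h1 e; exists t.+1, s'; split=> // K.
  by rewrite iterSr /= e h.
have [t [s' [tT h q]]] := h2 (negbT e); exists t.+1, s'; split=> // K.
by rewrite iterSr /= e h.
Qed.

Lemma triple_while b c (I : nat -> state -> Prop) Tb N s Q :
    I N s ->
    (forall i s', I i s' -> i <= N -> holds b s' ->
       triple c s' Tb (fun s'' => exists2 i', i' < i & I i' s'')) ->
    (forall i s', I i s' -> ~~ holds b s' -> Q s') ->
  triple (While b c) s (N * Tb.+1).+1 Q.
Proof.
elim/ltn_ind: N s => N IH s iN body done_.
case e: (holds b s); last first.
  exists 1, s; split; [by []| |exact: done_ iN (negbT e)].
  by move=> K; rewrite /= e.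
have [t1 [s1 [tT1 h1 [N' NN' q1]]]] := body _ _ iN (leqnn _) e.
have [|t2 [s2 [tT2 h2 q2]]] := IH _ NN' _ q1 _ done_.
  by move=> i s' ii iN'; apply: body => //; exact: leq_trans iN' (ltnW NN').
exists (t2 + t1).+1, s2; split=> //; last first.
  by move=> K; rewrite iterSr /= e iterD h1 h2.
have : (N'.+1 * Tb.+1 <= N * Tb.+1) by rewrite leq_mul2r NN' orbT.
by rewrite mulSn; lia.
Qed.

Lemma triple_straight i l s T Q : (size l).*2.+1 <= T ->
  Q (foldl (fun s i => exec O tape i s) s (i :: l)) -> triple (straight i l) s T Q.
Proof.
elim: l i s T => [|j l IH] i s T /= lT q; first by apply: triple_do => //; lia.
apply: (@triple_weaken _ _ (1 + (size l).*2.+1).+1 _ Q); [|lia|by []].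
apply: (triple_seq (Q1 := fun s' => s' = exec O tape i s)); first exact: triple_do.
by move=> s' ->; apply: IH.
Qed.

(** The body leaves the counter alone, so the invariant for the next pass is required of the state
    in which the counter has been decremented. *)
Lemma triple_loop cnt c N Tb (I : nat -> state -> Prop) s :
    cnt != 4 -> I 0 s -> nmem s 4 = 1 -> nmem s cnt = N ->
    (forall i s', i < N -> I i s' -> nmem s' 4 = 1 -> nmem s' cnt = N - i ->
      triple c s' Tb (fun s'' => [/\ nmem s'' 4 = 1, nmem s'' cnt = N - i
                                  & I i.+1 (setn s'' cnt (N - i.+1))])) ->
  triple (loop cnt c) s (N * (Tb + 3)).+1
    (fun s' => [/\ nmem s' 4 = 1, nmem s' cnt = 0 & I N s']).
Proof.
move=> c4 i0 s4 sc body.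
pose J j s' := exists2 i, i + j = N & [/\ nmem s' 4 = 1, nmem s' cnt = j & I i s'].
apply: (@triple_weaken _ _ (N * (Tb + 1).+2).+1); [|by rewrite ltnS leq_mul2l; lia|by move=> s'; exact].
  apply: (triple_while (I := J)); first by exists 0.
    move=> j s' [i ij [h4 hc hi]] jN; rewrite /= h4 hc => j0.
    apply: (triple_seq (T1 := Tb)).
      by apply: (body i) => //; [lia|rewrite hc; lia].
    move=> s'' [g4 gc gi]; apply: triple_do => //=; exists j.-1; first lia.
    exists i.+1; first lia.
    rewrite /= gc g4; split.
    - by rewrite /upd eq_sym (negbTE c4).
    - by rewrite /upd eqxx; lia.
    - by have <- : N - i.+1 = N - i - 1 by lia.
  move=> j s' [i ij [h4 hc hi]]; rewrite /= h4 hc -ltnNge ltnS leqn0 => /eqP j0.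
  by split; rewrite // ?hc //; rewrite j0 addn0 in ij; rewrite -ij.
Qed.

Definition io s := (flips s, queries s, answers s).

Definition frame (P P' : pred nat) s s' : Prop :=
  (forall r, ~~ P r -> nmem s' r = nmem s r) /\
  (forall r, ~~ P' r -> rmem s' r = rmem s r).

Lemma frame_refl P P' s : frame P P' s s.
Proof. by []. Qed.

Lemma frame_trans P P' s1 s2 s3 :
  frame P P' s1 s2 -> frame P P' s2 s3 -> frame P P' s1 s3.
Proof. by move=> [a1 b1] [a2 b2]; split=> r h; rewrite ?a2 ?a1 ?b2 ?b1. Qed.

Lemma frame_sub (P P' U U' : pred nat) s1 s2 :
    (forall r, P r -> U r) -> (forall r, P' r -> U' r) ->
  frame P P' s1 s2 -> frame U U' s1 s2.
Proof.
by move=> h h' [a b]; split=> r; [move/(contra (h r)); exact: a|move/(contra (h' r)); exact: b].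
Qed.

Lemma frame_setn (P P' : pred nat) s s' a v : P a -> frame P P' s s' ->
  frame P P' s (setn s' a v).
Proof.
move=> Pa [h h']; split=> //= r Pr; rewrite /upd; case: eqP Pr => [->|_]; first by rewrite Pa.
exact: h.
Qed.

Lemma frame_setr (P P' : pred nat) s s' a v : P' a -> frame P P' s s' ->
  frame P P' s (setr s' a v).
Proof.
move=> Pa [h h']; split=> //= r Pr; rewrite /upd; case: eqP Pr => [->|_]; first by rewrite Pa.
exact: h'.
Qed.

End Triples.

(** * The steward *)

(* Natural registers: 0-3 the inputs n, k, d, d0; 4 and 17 the constants 1 and 0;
   5 and 6 the number 2^m >= k and m; 7 and 9 the numbers 32 ell and 2^m (16 b),
   whose sum at level i, with 2^i for 2^m, is the walk length; 8 the number 16 b;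
   10 half the seed length; 11 and 12 the seed; 13 the round; 14 and 15 the
   addresses of the value (also of the query point) and of the answer; 16 the
   rounds left; from 18 on scratch.  Real registers: 3 the number 2 eps; 4 the
   mesh of the grid; 7 the constant 0. *)
Definition copy (a b : nat) : instr := NAdd a b 17.

Definition among (l : seq nat) : pred nat := fun r => r \in l.

(** Register 20 holds [2 ^ e + 1], so that the non-strict test means [2 ^ e < k]. *)
Definition pow_cmd : cmd :=
  Seq (straight (NSet 4 1) [:: NSet 17 0; NSet 5 1; NSet 6 0; NAdd 20 5 4])
  (While (NLe 20 1) (straight (NAdd 5 5 5) [:: NAdd 6 6 4; NAdd 20 5 4])).

(** Register 7 counts from [m] up to [ell = m + g], with [g] the first exponent for which
    [gamma * 2 ^ g] exceeds 1; five doublings then multiply it by 32. *)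
Definition gamma_cmd : cmd :=
  Seq (straight (RCast 5 4) [:: RSub 7 5 5; RAdd 6 2 7; copy 7 6])
  (Seq (While (RLe 6 5) (straight (RAdd 6 6 6) [:: NAdd 7 7 4]))
  (straight (NAdd 7 7 7) [:: NAdd 7 7 7; NAdd 7 7 7; NAdd 7 7 7; NAdd 7 7 7])).

(** Multiplication by counting: the first loop adds 16 for each doubling up to the first power of 2
    above [d0], and the second adds the result once for each multiple of [d0] below [d]. *)
Definition label_cmd : cmd :=
  Seq (straight (NSet 20 1) [:: NSet 21 0; NSet 22 16])
  (Seq (While (NLe 20 3) (straight (NAdd 20 20 20) [:: NAdd 21 21 22]))
  (Seq (straight (NSet 20 1) [:: NSet 8 0])
  (While (NLe 20 2) (straight (NAdd 20 20 3) [:: NAdd 8 8 21])))).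

(** Half the seed starts as [(n + 1) / 2], which is [uphalf n]; each walk length is added twice
    since a base-4 digit consists of two bits. *)
Definition length_cmd : cmd :=
  Seq (straight (NAdd 10 0 4) [:: NHalf 10 10; copy 9 8; copy 27 6])
  (loop 27 (straight (NAdd 20 9 7) [:: NAdd 10 10 20; NAdd 10 10 20; NAdd 9 9 9])).

Definition seed_cmd : cmd :=
  Seq (straight (NSet 11 0) [:: NSet 12 0; copy 27 10])
  (loop 27 (straight (Flip 20) [:: NAdd 11 11 11; NAdd 11 11 20;
     Flip 20; NAdd 12 12 12; NAdd 12 12 20])).

Definition grid_cmd : cmd :=
  Seq (straight (RAdd 3 0 0) [:: RAdd 4 3 7; copy 27 3])
  (Seq (loop 27 (Do (RAdd 4 4 3)))
  (straight (NSet 14 100) [:: NAdd 15 14 2; NSet 13 0; copy 16 1])).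

Definition setup_cmd : cmd :=
  Seq pow_cmd (Seq gamma_cmd (Seq label_cmd (Seq length_cmd (Seq seed_cmd grid_cmd)))).

Lemma leq_pow2 k e : (k <= 2 ^ e) = (up_log 2 k <= e).
Proof.
apply/idP/idP => [|h]; first exact: up_log_min.
by rewrite (leq_trans (up_logP k (isT : 1 < 2))) // leq_exp2l.
Qed.

Lemma exists_pow2_gt (R : realType) (x : R) : (0 < x)%R ->
  exists e, (1 < x * 2 ^+ e)%R.
Proof.
move=> x0; exists (Num.bound x^-1); have i0 : (0 < x^-1)%R by rewrite invr_gt0.
have h := archi_boundP (ltW i0); rewrite -(ltr_pM2l x0) mulfV ?gt_eqF // in h.
by rewrite (lt_le_trans h) // ler_pM2l // -natrX ler_nat ltnW // ltn_expl.
Qed.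

Definition gamma_exp (R : realType) (x : R) (x0 : (0 < x)%R) : nat :=
  ex_minn (exists_pow2_gt x0).

(** The program finds [gamma] in a register, equal to the parameter only by a proof, so the two
    positivity proofs have different types. *)
Lemma gamma_exp_eq (R : realType) (x y : R) (x0 : (0 < x)%R) (y0 : (0 < y)%R) :
  x = y -> gamma_exp x0 = gamma_exp y0.
Proof.
move=> e; rewrite /gamma_exp; case: ex_minnP => u pu minu; case: ex_minnP => w pw minw.
by apply/eqP; rewrite eqn_leq minu ?minw // ?e // -e.
Qed.

Section Setup.
Variables (R : realType) (n d : nat) (O : owner R n d) (tape : seq bool).
Notation state := (state R d).
Notation triple := (@triple R n d O tape).
Implicit Types (s : state).

Lemma pow_spec s k : nmem s 1 = k -> 0 < k ->
  triple pow_cmd s (12 + up_log 2 k * 7) (fun s' =>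
    [/\ [/\ nmem s' 4 = 1, nmem s' 17 = 0, nmem s' 5 = 2 ^ up_log 2 k & nmem s' 6 = up_log 2 k],
        frame (among [:: 4; 5; 6; 17; 20]) pred0 s s' & io s' = io s]).
Proof.
move=> sk k0; set m := up_log 2 k; set Q := (fun s' => _).
pose I j s' := exists2 e, e + j = m &
  [/\ [/\ nmem s' 4 = 1, nmem s' 17 = 0, nmem s' 5 = 2 ^ e, nmem s' 6 = e & nmem s' 20 = (2 ^ e).+1],
      frame (among [:: 4; 5; 6; 17; 20]) pred0 s s' & io s' = io s].
apply: (@triple_weaken _ _ _ _ _ _ _ (10 + (m * 7).+1).+1 _ Q); [|lia|by []].
apply: (triple_seq (Q1 := I m)).
  apply: triple_straight => //=; exists 0 => //; split => //.
  by do ![apply: frame_setn => //].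
move=> s1 Im; apply: (triple_while (I := I)) => //.
  move=> j s' [e ej [[h4 h17 h5 h6 h20] fr hio]] jm.
  rewrite /= h20 (fr.1 1 isT) sk => e_lt; move: e_lt; rewrite ltnNge leq_pow2 -/m -ltnNge => e_lt.
  apply: triple_straight => //=; exists j.-1; [lia|exists e.+1; [lia|]].
  split => //=; first by rewrite /upd /= h4 h17 h5 h6 addn1 expnS mul2n addnn addn1.
  by do ![apply: frame_setn => //].
move=> j s' [e ej [[h4 h17 h5 h6 h20] fr hio]].
rewrite /= h20 (fr.1 1 isT) sk -leqNgt leq_pow2 -/m => ke.
have em : e = m by lia.
by split; rewrite ?h5 ?h6 ?em.
Qed.

Lemma gamma_spec s m (x0 : (0 < rmem s 2)%R) : let g := gamma_exp x0 in
    nmem s 4 = 1 -> nmem s 17 = 0 -> nmem s 6 = m ->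
  triple gamma_cmd s (21 + g * 5) (fun s' =>
    [/\ nmem s' 7 = 32 * (m + g), rmem s' 7 = 0%R,
        frame (among [:: 7]) (among [:: 5; 6; 7]) s s' & io s' = io s]).
Proof.
move=> g h4 h17 h6; set Q := (fun s' => _).
pose I j s' := exists2 e, e + j = g &
  [/\ [/\ nmem s' 7 = m + e, rmem s' 7 = 0%R, rmem s' 5 = 1%R & rmem s' 6 = (rmem s 2 * 2 ^+ e)%R],
      frame (among [:: 7]) (among [:: 5; 6; 7]) s s' & io s' = io s].
apply: (@triple_weaken _ _ _ _ _ _ _ (8 + ((g * 5).+1 + 10).+1).+1 _ Q); [|lia|by []].
apply: (triple_seq (Q1 := I g)).
  apply: triple_straight => //=; exists 0 => //; split => //=.
    by rewrite /upd /= h4 h17 h6 !addn0 subrr mulr1 addr0.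
  by do ![apply: frame_setn => //|apply: frame_setr => //].
move=> s1 Ig; apply: (triple_seq (Q1 := I 0)).
  apply: (triple_while (I := I)) => //.
    move=> j s' [e ej [[h7 r7 r5 r6] fr hio]] jg; rewrite [holds _ _]/= r5 r6 => e_le.
    have eg : e != g.
      apply/eqP => eg; move: e_le; rewrite eg /g /gamma_exp; case: ex_minnP => u u1 _.
      by rewrite leNgt u1.
    apply: triple_straight => //=; exists j.-1; [by lia|exists e.+1; [by lia|]].
    split => //=.
      by rewrite /upd /= h7 r7 r5 r6 (fr.1 4 isT) h4 addn1 addnS exprS mulrCA mulr2n mulrDl mul1r.
    by do ![apply: frame_setn => //|apply: frame_setr => //].
  move=> j s' [e ej [[h7 r7 r5 r6] fr hio]]; rewrite [holds _ _]/= r5 r6 -ltNge => e_gt.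
  exists e; last by split.
  rewrite addn0; apply/eqP; rewrite eqn_leq; apply/andP; split; first lia.
  by rewrite /g /gamma_exp; case: ex_minnP => u _; apply.
move=> s2 [e eg [[h7 r7 r5 r6] fr hio]]; apply: triple_straight => //=; split=> //=.
  by rewrite /upd /= h7; lia.
by do ![apply: frame_setn => //].
Qed.

Lemma label_spec s d0 : nmem s 4 = 1 -> nmem s 3 = d0 -> nmem s 2 = d ->
    0 < d -> 0 < d0 ->
  let e0 := up_log 2 d0.+1 in let b := (d.-1 %/ d0).+1 in
  triple label_cmd s (16 + e0 * 5 + b * 5) (fun s' =>
    [/\ nmem s' 8 = b * (16 * e0), frame (among [:: 8; 20; 21; 22]) pred0 s s' & io s' = io s]).
Proof.
move=> h4 h3 h2 d_gt0 d0_gt0 e0 b; set Q := (fun s' => _).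
pose fr s' := frame (among [:: 8; 20; 21; 22]) pred0 s s' /\ io s' = io s.
pose I j s' := exists2 e, e + j = e0 & [/\ nmem s' 20 = 2 ^ e, nmem s' 21 = 16 * e, nmem s' 22 = 16 & fr s'].
pose J j s' := exists2 c, c + j = b &
  [/\ nmem s' 20 = (c * d0).+1, nmem s' 8 = c * (16 * e0), nmem s' 21 = 16 * e0 & fr s'].
apply: (@triple_weaken _ _ _ _ _ _ _
  (6 + ((e0 * 5).+1 + (4 + (b * 5).+1).+1).+1).+1 _ Q); [|lia|by []].
apply: (triple_seq (Q1 := I e0)).
  apply: triple_straight => //=; exists 0 => //; split => //; split=> //.
  by do ![apply: frame_setn => //].
move=> s1 I1; apply: (triple_seq (Q1 := I 0)).
  apply: (triple_while (I := I)) => //.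
    move=> j s' [e ej [h20 h21 h22 [f hio]]] _; rewrite [holds _ _]/= h20 (f.1 3 isT) h3 => e_le.
    have : e < e0 by rewrite ltnNge -leq_pow2 -ltnNge ltnS.
    move=> ee; apply: triple_straight => //=; exists j.-1; [by lia|exists e.+1; [by lia|]].
    split; rewrite /= /upd /= ?h20 ?h21 ?h22 //; [by rewrite expnS mul2n addnn|lia|].
    by split=> //; do ![apply: frame_setn => //].
  move=> j s' [e ej [h20 h21 h22 [f hio]]]; rewrite [holds _ _]/= h20 (f.1 3 isT) h3.
  rewrite -ltnNge leq_pow2 -/e0 => ee; exists e; [lia|by []].
move=> s2 [e ee [h20 h21 h22 [f hio]]]; rewrite addn0 in ee; apply: (triple_seq (Q1 := J b)).
  apply: triple_straight => //=; exists 0 => //; split => //.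
    by rewrite /= /upd /= h21 ee.
  by split=> //; do ![apply: frame_setn => //].
move=> s3 J3; apply: (triple_while (I := J)) => //.
  move=> j s' [c cj [h20' h8 h21' [f' hio']]] _; rewrite [holds _ _]/= h20' (f'.1 2 isT) h2 => c_le.
  have cb : c < b by rewrite ltnS leq_divRL //; lia.
  apply: triple_straight => //=; exists j.-1; [by lia|exists c.+1; [by lia|]].
  split; rewrite /= /upd /= ?h20' ?h8 ?h21' ?(f'.1 3 isT) ?h3 //; [lia|lia|].
  by split=> //; do ![apply: frame_setn => //].
move=> j s' [c cj [h20' h8 h21' [f' hio']]]; rewrite [holds _ _]/= h20' (f'.1 2 isT) h2 => c_le.
have cb : ~~ (c < b) by rewrite ltnS leq_divRL //; lia.
by split=> //; rewrite h8; congr (_ * _); lia.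
Qed.

Lemma length_spec s b ell m : nmem s 4 = 1 -> nmem s 17 = 0 -> nmem s 0 = n ->
    nmem s 8 = 16 * b -> nmem s 7 = 32 * ell -> nmem s 6 = m ->
  triple length_cmd s (10 + m * 11) (fun s' =>
    [/\ nmem s' 9 = 2 ^ m * (16 * b), nmem s' 10 = half_seed (uphalf n) (walk_length b ell) m,
        frame (among [:: 9; 10; 20; 27]) pred0 s s' & io s' = io s]).
Proof.
move=> h4 h17 h0 h8 h7 h6; set Q := (fun s' => _).
pose I i s' := [/\ nmem s' 9 = 2 ^ i * (16 * b),
   nmem s' 10 = half_seed (uphalf n) (walk_length b ell) i,
   frame (among [:: 9; 10; 20; 27]) pred0 s s' & io s' = io s].
apply: (@triple_weaken _ _ _ _ _ _ _ (8 + (m * (8 + 3)).+1).+1 _ Q); [|lia|by []].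
apply: (triple_seq (Q1 := fun s' => [/\ I 0 s', nmem s' 4 = 1 & nmem s' 27 = m])).
  apply: triple_straight => //=; split; rewrite /= /upd /= ?h17 ?h6 ?addn0 //.
  split; rewrite /= /upd /= ?h17 ?h8 ?h0 ?h4 ?addn0 ?mul1n ?addn1 ?uphalfE //.
  by do ![apply: frame_setn => //].
move=> s1 [I0 s14 s127]; apply: triple_post.
  apply: (triple_loop (I := I)); [by []|exact: I0|by []|exact: s127|].
  move=> i s' im [h9 h10 f hio] h4' h27; apply: triple_straight => //=.
  split; rewrite /= /upd //=.
  split; rewrite /= /upd /= ?h9 ?h10 ?(f.1 7 isT) ?h7 //.
  - by rewrite expnS; lia.
  - by rewrite /walk_length; lia.
  - by do ![apply: frame_setn => //].
by move=> s' [_ _].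
Qed.

Lemma seed_spec s h : nmem s 4 = 1 -> nmem s 17 = 0 -> nmem s 10 = h -> flips s = 0 ->
  triple seed_cmd s (8 + h * 15) (fun s' =>
    [/\ (nmem s' 11, nmem s' 12) = load h tape (0, 0),
        frame (among [:: 11; 12; 20; 27]) pred0 s s'
      & io s' = (h.*2, queries s, answers s)]).
Proof.
move=> h4 h17 h10 hf; set Q := (fun s' => _).
pose I i s' := [/\ load (h - i) (drop i.*2 tape) (nmem s' 11, nmem s' 12) = load h tape (0, 0),
   frame (among [:: 11; 12; 20; 27]) pred0 s s' & io s' = (i.*2, queries s, answers s)].
apply: (@triple_weaken _ _ _ _ _ _ _ (6 + (h * (12 + 3)).+1).+1 _ Q); [|lia|by []].
apply: (triple_seq (Q1 := fun s' => [/\ I 0 s', nmem s' 4 = 1 & nmem s' 27 = h])).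
  apply: triple_straight => //=; split; rewrite /= /upd /= ?h17 ?h10 ?addn0 //.
  split; rewrite /= ?subn0 ?drop0 ?/io /= ?hf //.
  by do ![apply: frame_setn => //].
move=> s1 [I0 s14 s127]; apply: triple_post.
  apply: (triple_loop (I := I)); [by []|exact: I0|by []|exact: s127|].
  move=> i s' ih [hl f [hfl hq ha]] h4' h27; apply: triple_straight => //=.
  split; rewrite /= /upd //=.
  split; rewrite /= /upd /=.
  - rewrite -hl; have -> : h - i = (h - i.+1).+1 by lia.
    rewrite /= drop_drop !nth_drop hfl addn0 addn1 add2n.
    by congr (load _ _ (_, _)); lia.
  - split=> r hr; last exact: f.2.
    rewrite /= /upd; move: hr; rewrite /among !inE !negb_or => /and4P[r1 r2 r3 r4].
    rewrite (negbTE r1) (negbTE r2) (negbTE r3) (negbTE r4) f.1 //.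
    by rewrite /among !inE !negb_or r1 r2 r3 r4.
  - by rewrite /io /= hfl hq ha doubleS.
move=> s' [_ _ [hl f hio]]; split=> //.
by rewrite subnn /= in hl.
Qed.

Lemma grid_spec s eps d0 k : nmem s 4 = 1 -> nmem s 17 = 0 -> nmem s 1 = k ->
    nmem s 2 = d -> nmem s 3 = d0 -> rmem s 0 = eps -> rmem s 7 = 0%R ->
  triple grid_cmd s (18 + d0 * 4) (fun s' =>
    [/\ [/\ rmem s' 3 = (2 * eps)%R & rmem s' 4 = grid d0 eps],
        [/\ nmem s' 13 = 0, nmem s' 14 = 100, nmem s' 15 = 100 + d & nmem s' 16 = k],
        frame (among [:: 13; 14; 15; 16; 27]) (among [:: 3; 4]) s s' & io s' = io s]).
Proof.
move=> h4 h17 h1 h2 h3 r0 r7; set Q := (fun s' => _).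
pose I i s' := [/\ rmem s' 3 = (2 * eps)%R, rmem s' 4 = (i.+1%:R * (2 * eps))%R,
   frame (among [:: 13; 14; 15; 16; 27]) (among [:: 3; 4]) s s' & io s' = io s].
apply: (@triple_weaken _ _ _ _ _ _ _ (6 + ((d0 * (1 + 3)).+1 + 8).+1).+1 _ Q); [|lia|by []].
apply: (triple_seq (Q1 := fun s' => [/\ I 0 s', nmem s' 4 = 1 & nmem s' 27 = d0])).
  apply: triple_straight => //=; split; rewrite /= /upd /= ?h17 ?h3 ?addn0 //.
  split; rewrite /= /upd /= ?r0 ?r7 ?addr0 ?mul1r ?mulr2n ?mulrDl ?mul1r //.
  by do ![apply: frame_setn => //|apply: frame_setr => //].
move=> s1 [I0 s14 s127]; apply: (triple_seq (Q1 := I d0)).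
  apply: (@triple_post _ _ _ _ _ _ _ _
    (fun s' => [/\ nmem s' 4 = 1, nmem s' 27 = 0 & I d0 s'])); last by move=> s' [].
  apply: (triple_loop (I := I)); [by []|exact: I0|by []|exact: s127|].
  move=> i s' ih [r3 r4 f hio] h4' h27; apply: triple_do => //=.
  split; rewrite //=; split; rewrite /= /upd /= ?r3 ?r4 //.
  - by rewrite -(natr1 i.+1) [RHS]mulrDl mul1r.
  - by do ![apply: frame_setn => //|apply: frame_setr => //].
move=> s2 [r3 r4 f hio]; apply: triple_straight => //=; split=> //=.
- by rewrite /upd /= (f.1 2 isT) (f.1 1 isT) (f.1 17 isT) h2 h1 h17 addn0.
- by do ![apply: frame_setn => //].
Qed.

End Setup.

(** * Computing one point of the generator *)

Definition skip : cmd := Do (NSet 19 0).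

Definition vstep_cmd : cmd :=
  Seq (straight (NHalf 32 25) [:: NSub 29 25 32; NSub 29 29 32; NHalf 25 32; NSub 30 32 25])
  (Seq (straight (NSub 30 30 25) [:: NHalf 33 26; NSub 31 26 33; NSub 31 31 33; NHalf 26 33])
  (If (NLe 4 30)
    (If (NLe 4 29) (straight (NAdd 23 23 22) [:: NAdd 23 23 22; NAdd 23 23 31])
                   (straight (NAdd 22 22 23) [:: NAdd 22 22 23; NAdd 22 22 31]))
    skip)).

(** Halving registers 20 and 21 goes down one level, after which 21 and 7 add up to the walk length.
    The seed is saved in 25 and 26 as the label before its low digits are shifted out. *)
Definition level_cmd : cmd :=
  Seq (straight (NHalf 20 20) [:: NHalf 21 21; NAdd 28 21 7; copy 25 22; copy 26 23; copy 27 28])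
  (Seq (loop 27 (straight (NHalf 22 22) [:: NHalf 22 22; NHalf 23 23; NHalf 23 23]))
  (If (NLe 20 24) (Seq (straight (NSub 24 24 20) [:: copy 27 28]) (loop 27 vstep_cmd)) skip)).

Definition vertex_cmd : cmd :=
  Seq (straight (copy 20 5) [:: copy 21 9; copy 22 11; copy 23 12; copy 24 13; copy 18 6])
  (loop 18 level_cmd).

Definition point_cmd : cmd :=
  Seq (straight (copy 34 14) [:: copy 27 0])
  (loop 27 (straight (NHalf 32 22) [:: NSub 29 22 32; NSub 29 29 32; NStore 34 29;
     NAdd 34 34 4; copy 22 23; copy 23 32])).

(** Follows the binary digits of [j] down the doubling construction, so a single block is computed
    without its siblings. *)
Fixpoint nth_vertex (t : nat -> nat) (i : nat) (v : nat * nat) (j : nat) : nat * nat :=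
  if i is i'.+1 then
    let w := shr (t i') v in
    if 2 ^ i' <= j then nth_vertex t i' (walk (t i') v w) (j - 2 ^ i')
    else nth_vertex t i' w j
  else v.

Lemma nth_points (X : Type) (x0 : X) (point : nat * nat -> X) t i v j : j < 2 ^ i ->
  nth x0 (points point t i v) j = point (nth_vertex t i v j).
Proof.
elim: i v j => [|i IH] v j /=; first by rewrite expn0 ltnS leqn0 => /eqP ->.
rewrite expnS mul2n -addnn nth_cat size_points => jlt.
case: leqP => h; last exact: IH.
by apply: IH; lia.
Qed.

Section Rounds.
Variables (R : realType) (n d : nat) (O : owner R n d) (tape : seq bool).
Notation state := (state R d).
Notation triple := (@triple R n d O tape).
Implicit Types (s : state).

Lemma vstep_spec s la lb v : nmem s 4 = 1 -> nmem s 25 = la -> nmem s 26 = lb ->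
    (nmem s 22, nmem s 23) = v ->
  triple vstep_cmd s 29 (fun s' =>
    [/\ (nmem s' 25, nmem s' 26) = (la./2./2, lb./2./2),
        (nmem s' 22, nmem s' 23) = vstep (la, lb) v,
        frame (among [:: 19; 22; 23; 25; 26; 29; 30; 31; 32; 33]) pred0 s s' & io s' = io s]).
Proof.
move=> h4 h25 h26 <-; set Q := (fun s' => _).
pose Q1 s' := [/\ (nmem s' 25, nmem s' 26) = (la./2./2, lb./2./2),
   [/\ nmem s' 29 = odd la, nmem s' 30 = odd la./2 & nmem s' 31 = odd lb],
   (nmem s' 22, nmem s' 23) = (nmem s 22, nmem s 23),
   frame (among [:: 19; 22; 23; 25; 26; 29; 30; 31; 32; 33]) pred0 s s' & io s' = io s].
apply: (@triple_weaken _ _ _ _ _ _ _ (9 + (9 + 8).+1).+1 _ Q); [|lia|by []].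
have sub_half x : x - x./2 - x./2 = odd x by lia.
pose Q0 s' := [/\ [/\ nmem s' 25 = la./2./2, nmem s' 26 = lb, nmem s' 29 = odd la
     & nmem s' 30 = la./2 - la./2./2],
   (nmem s' 22, nmem s' 23) = (nmem s 22, nmem s 23),
   frame (among [:: 19; 22; 23; 25; 26; 29; 30; 31; 32; 33]) pred0 s s' & io s' = io s].
apply: (triple_seq (Q1 := Q0)).
  apply: triple_straight => //=; split=> //=.
  - by rewrite /upd /= h25 h26 sub_half.
  - by do ![apply: frame_setn => //].
move=> s0 [[k25 k26 k29 k30] [k22 k23] f0 io0]; apply: (triple_seq (Q1 := Q1)).
  apply: triple_straight => //=; split=> //=.
  - by rewrite /upd /= k25 k26.
  - by rewrite /upd /= k25 k26 k29 k30 !sub_half.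
  - by rewrite /upd /= k22 k23.
  - by do ![apply: frame_setn => //].
move=> s1 [[h25' h26'] [h29 h30 h31] [h22 h23] f hio]; rewrite /Q /vstep.
apply: triple_if; rewrite [holds _ _]/= (f.1 4 isT) h4 h30; case: (odd la./2) => //= _.
  apply: triple_if; rewrite [holds _ _]/= (f.1 4 isT) h4 h29; case: (odd la) => //= _.
    apply: triple_straight => //=; split; rewrite /= /upd /= ?h25' ?h26' ?h22 ?h23 ?h31 //.
      by congr (_, _); lia.
    by do ![apply: frame_setn => //].
  apply: triple_straight => //=; split; rewrite /= /upd /= ?h25' ?h26' ?h22 ?h23 ?h31 //.
    by congr (_, _); lia.
  by do ![apply: frame_setn => //].
apply: triple_do => //=; split; rewrite /= /upd /= ?h25' ?h26' ?h22 ?h23 //.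
by do ![apply: frame_setn => //].
Qed.

Lemma level_spec s (b ell i j : nat) v : let t := walk_length b ell i in
    nmem s 4 = 1 -> nmem s 17 = 0 -> nmem s 7 = 32 * ell ->
    nmem s 20 = 2 ^ i.+1 -> nmem s 21 = 2 ^ i.+1 * (16 * b) -> nmem s 24 = j ->
    (nmem s 22, nmem s 23) = v ->
  triple level_cmd s (23 + t * 43) (fun s' =>
    [/\ nmem s' 20 = 2 ^ i, nmem s' 21 = 2 ^ i * (16 * b),
        (nmem s' 22, nmem s' 23, nmem s' 24) =
          if 2 ^ i <= j then (walk t v (shr t v), j - 2 ^ i) else (shr t v, j),
        frame (fun r => 19 <= r < 34) pred0 s s' & io s' = io s]).
Proof.
move=> t h4 h17 h7 h20 h21 h24 <-; set Q := (fun s' => _).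
have te : 2 ^ i * (16 * b) + 32 * ell = t by rewrite /t /walk_length; lia.
clearbody t.
pose fr s' := frame (fun r => 19 <= r < 34) pred0 s s' /\ io s' = io s.
pose I1 i' s' := [/\ [/\ nmem s' 20 = 2 ^ i, nmem s' 21 = 2 ^ i * (16 * b), nmem s' 24 = j & nmem s' 28 = t],
  (nmem s' 25, nmem s' 26) = (nmem s 22, nmem s 23),
  (nmem s' 22, nmem s' 23) = shr i' (nmem s 22, nmem s 23) & fr s'].
apply: (@triple_weaken _ _ _ _ _ _ _
  (12 + ((t * (8 + 3)).+1 + (4 + (t * (29 + 3)).+1).+1.+1).+1).+1 _ Q); [|lia|by []].
apply: (triple_seq (Q1 := fun s' => [/\ I1 0 s', nmem s' 4 = 1 & nmem s' 27 = t])).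
  apply: triple_straight => //=; split; rewrite //= /upd /=; last first.
    by rewrite h17 h21 h7 -te expnS -mulnA mul2n doubleK; lia.
  split; rewrite //= /upd /=.
  - rewrite h20 h21 h7 h24 -te; split; rewrite ?expnS -?mulnA ?mul2n ?doubleK //; lia.
  - by rewrite h17 !addn0.
  - by rewrite /shr /= !divn1.
  - by split=> //; do ![apply: frame_setn => //].
move=> s1 [I10 s14 s127]; apply: (triple_seq (Q1 := I1 t)).
  apply: (@triple_post _ _ _ _ _ _ _ _
    (fun s' => [/\ nmem s' 4 = 1, nmem s' 27 = 0 & I1 t s'])); last by move=> s' [].
  apply: (triple_loop (I := I1)); [by []|exact: I10|by []|exact: s127|].
  move=> i' s' _ [hs hl [h22 h23] [f hio]] h4' h27; apply: triple_straight => //=.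
  split; rewrite //=; split; rewrite //= /upd /=.
    by rewrite h22 h23 /shr /= !half_half -!divnMA !expnSr.
  by split=> //; do ![apply: frame_setn => //].
move=> s2 [[g20 g21 g24 g28] hl [g22 g23] [f hio]]; rewrite /Q.
apply: triple_if; rewrite [holds _ _]/= g20 g24 => ij; last first.
  apply: triple_do => //=; rewrite (negbTE ij); split; rewrite //= /upd /= ?g22 ?g23 ?g24 //.
  by do ![apply: frame_setn => //].
rewrite ij.
pose w := shr t (nmem s 22, nmem s 23).
pose I2 i' s' := [/\ [/\ nmem s' 20 = 2 ^ i, nmem s' 21 = 2 ^ i * (16 * b) & nmem s' 24 = j - 2 ^ i],
  walk (t - i') (nmem s' 25, nmem s' 26) (nmem s' 22, nmem s' 23) = walk t (nmem s 22, nmem s 23) w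
  & fr s'].
apply: (triple_seq (Q1 := fun s' => [/\ I2 0 s', nmem s' 4 = 1 & nmem s' 27 = t])).
  apply: triple_straight => //=; split; rewrite //= /upd /= ?(f.1 4 isT) ?(f.1 17 isT) ?h17 ?addn0 //.
  split; rewrite //= /upd /= ?g20 ?g24 //.
    by rewrite hl g22 g23 subn0.
  by split=> //; do ![apply: frame_setn => //].
move=> s3 [I20 s34 s327].
apply: (@triple_post _ _ _ _ _ _ _ _
    (fun s' => [/\ nmem s' 4 = 1, nmem s' 27 = 0 & I2 t s'])).
  apply: (triple_loop (I := I2)); [by []|exact: I20|by []|exact: s327|].
  move=> i' s' it [[k20 k21 k24] hw [f' hio']] h4' h27.
  apply: triple_post (vstep_spec h4' erefl erefl erefl) _.
  move=> s'' [[e25 e26] e2 f'' hio'']; split; rewrite ?(f''.1 4 isT) ?(f''.1 27 isT) //.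
  split; rewrite /= /upd /= ?(f''.1 20 isT) ?(f''.1 21 isT) ?(f''.1 24 isT) //.
    rewrite -hw; have -> : t - i' = (t - i'.+1).+1 by lia.
    by rewrite /= e25 e26 e2.
  split; last by rewrite -hio' -hio''.
  apply: frame_setn => //; apply: (frame_trans f'); apply: frame_sub f'' => // r.
  by rewrite /among !inE => h; lia.
move=> s' [_ _ [[k20 k21 k24] hw [f' hio']]]; split=> //.
by rewrite k24 -hw subnn.
Qed.

Lemma vertex_spec s (b ell m j : nat) v : let t := walk_length b ell in
    nmem s 4 = 1 -> nmem s 17 = 0 -> nmem s 7 = 32 * ell ->
    nmem s 5 = 2 ^ m -> nmem s 9 = 2 ^ m * (16 * b) -> nmem s 6 = m -> nmem s 13 = j ->
    (nmem s 11, nmem s 12) = v ->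
  triple vertex_cmd s (14 + m * (26 + t m * 43)) (fun s' =>
    [/\ (nmem s' 22, nmem s' 23) = nth_vertex t m v j,
        frame (fun r => 18 <= r < 34) pred0 s s' & io s' = io s]).
Proof.
move=> t h4 h17 h7 h5 h9 h6 h13 <-; set Q := (fun s' => _).
pose I i s' := [/\ [/\ nmem s' 20 = 2 ^ (m - i) & nmem s' 21 = 2 ^ (m - i) * (16 * b)],
  nth_vertex t (m - i) (nmem s' 22, nmem s' 23) (nmem s' 24) =
    nth_vertex t m (nmem s 11, nmem s 12) j,
  frame (fun r => 18 <= r < 34) pred0 s s' & io s' = io s].
apply: (@triple_weaken _ _ _ _ _ _ _ (12 + (m * ((23 + t m * 43) + 3)).+1).+1 _ Q); [|lia|by []].
apply: (triple_seq (Q1 := fun s' => [/\ I 0 s', nmem s' 4 = 1 & nmem s' 18 = m])).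
  apply: triple_straight => //=; split; rewrite //= /upd /= ?h17 ?h6 ?addn0 //.
  split; rewrite //= /upd /= ?h17 ?h5 ?h9 ?h13 ?addn0 ?subn0 //.
  by do ![apply: frame_setn => //].
move=> s1 [I0 s14 s118].
apply: (@triple_post _ _ _ _ _ _ _ _
    (fun s' => [/\ nmem s' 4 = 1, nmem s' 18 = 0 & I m s'])).
  apply: (triple_loop (I := I)); [by []|exact: I0|by []|exact: s118|].
  move=> i s' im [[h20 h21] hv f hio] h4' h18.
  have mi : m - i = (m - i.+1).+1 by lia.
  apply: (@triple_weaken _ _ _ _ _ _ _ (23 + t (m - i.+1) * 43)).
    apply: (level_spec (v := (nmem s' 22, nmem s' 23)) (j := nmem s' 24)) => //;
      by rewrite ?(f.1 17 isT) ?(f.1 7 isT) ?h20 ?h21 -?mi.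
  (* Walk lengths grow with the level, so the length at level [m] bounds them all. *)
  - rewrite leq_add2l leq_mul2r /t /walk_length leq_mul2l leq_add2r leq_mul2r leq_exp2l //.
    by rewrite leq_subr orbT.
  move=> s'' [e20 e21 e22 f' hio']; split; rewrite ?(f'.1 4 isT) ?(f'.1 18 isT) //.
  split; rewrite /= /upd /= ?e20 ?e21 //.
  - rewrite -hv mi /=; move: e22; case: ifP => _ e;
    have e1 := congr1 fst e; have e2 := congr1 snd e; rewrite [fst _]/= in e1;
    by rewrite [snd _]/= in e2; rewrite e1 e2.
  - apply: frame_setn => //; apply: (frame_trans f); apply: frame_sub f' => // r; lia.
  - by rewrite -hio -hio'.
move=> s' [_ _ [_ hv f hio]]; split=> //.
by rewrite subnn /= in hv.
Qed.

Lemma point_spec s v : nmem s 4 = 1 -> nmem s 17 = 0 -> nmem s 0 = n -> nmem s 14 = 100 ->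
    (nmem s 22, nmem s 23) = v ->
  triple point_cmd s (6 + n * 17) (fun s' =>
    [/\ read_point n (nmem s') 100 = bits_tuple n v,
        frame (fun r => 18 <= r) pred0 s s' & io s' = io s]).
Proof.
move=> h4 h17 h0 h14 <-; set Q := (fun s' => _).
set B := bits n (nmem s 22, nmem s 23).
pose I i s' := [/\ bits (n - i) (nmem s' 22, nmem s' 23) = drop i B,
  nmem s' 34 = 100 + i /\ (forall i', i' < i -> nmem s' (100 + i') = nth false B i'),
  frame (fun r => 18 <= r) pred0 s s' & io s' = io s].
apply: (@triple_weaken _ _ _ _ _ _ _ (4 + (n * (14 + 3)).+1).+1 _ Q); [|lia|by []].
apply: (triple_seq (Q1 := fun s' => [/\ I 0 s', nmem s' 4 = 1 & nmem s' 27 = n])).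
  apply: triple_straight => //=; split; rewrite //= /upd /= ?h17 ?h0 ?addn0 //.
  split; rewrite //= /upd /= ?h17 ?h14 ?subn0 ?drop0 //.
  by do ![apply: frame_setn => //].
move=> s1 [I0 s14 s127].
apply: (@triple_post _ _ _ _ _ _ _ _
    (fun s' => [/\ nmem s' 4 = 1, nmem s' 27 = 0 & I n s'])).
  apply: (triple_loop (I := I)); [by []|exact: I0|by []|exact: s127|].
  move=> i s' i_n [hb [h34 hp] f hio] h4' h27.
  have ni : n - i = (n - i.+1).+1 by lia.
  have iB : i < size B by rewrite size_bits.
  rewrite ni /= (drop_nth false iB) in hb; case: hb => hb1 hb2.
  apply: triple_straight => //=; split; rewrite //= /upd /= h34 ?h4' //.
  split; rewrite //= /upd /= ?h34 ?h4'.
  - by rewrite (f.1 17 isT) h17 !addn0 hb2.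
  - split; first by lia.
    move=> i'; rewrite ltnS !(eqn_add2l 100) leq_eqVlt => /orP[/eqP ->|i'i].
      by rewrite eqxx; rewrite -hb1; lia.
    by rewrite (ltn_eqF i'i) hp.
  - do ![apply: frame_setn => //].
move=> s' [_ _ [_ [_ hp] f hio]]; split=> //.
apply: val_inj; rewrite val_bits_tuple; apply: (@eq_from_nth _ false).
  by rewrite size_tuple size_bits.
move=> i; rewrite size_tuple => i_n.
by rewrite -(tnth_nth _ _ (Ordinal i_n)) tnth_mktuple /= hp // -/B; case: (nth _ _ _).
Qed.

End Rounds.

(* The shift is increased, and the block restarted, at an unsafe coordinate. *)
Definition block_cmd : cmd :=
  While (NLe 4 39)
    (Seq (straight (RLoad 11 42) [:: RAdd 11 11 10; RRound 12 11 4; RAdd 13 12 4; RAdd 11 11 3])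
    (If (RLe 13 11)
      (straight (RAdd 10 10 3) [:: copy 42 40; copy 43 41; NSub 39 36 35])
      (straight (RSub 12 12 10) [:: RStore 43 12; NAdd 42 42 4; NAdd 43 43 4; NSub 39 39 4]))).

(** Registers 35 and 36 hold the start and the end of the block plus one, so the non-strict test
    with [d] means that the start is below [d]; the last block is cut off at [d]. *)
Definition round_cmd : cmd :=
  Seq (Do (NSet 35 1))
  (While (NLe 35 2)
    (Seq (straight (NAdd 36 35 3) [:: NAdd 37 2 4])
    (Seq (If (NLe 36 37) skip (Do (copy 36 37)))
    (Seq (straight (RSub 10 10 10) [:: NAdd 40 14 35; NSub 40 40 4; NAdd 41 15 35; NSub 41 41 4])
    (Seq (straight (copy 42 40) [:: copy 43 41; NSub 39 36 35])
    (Seq block_cmd (Do (copy 35 36)))))))).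

(** The point and the value share the address 100 without conflict: the bits lie in natural
    registers, the vector in real ones. *)
Definition turn_cmd : cmd :=
  Seq vertex_cmd (Seq point_cmd (Seq (Do (Query 14 14)) (Seq round_cmd
    (straight (Answer 15) [:: NAdd 13 13 4])))).

Definition steward_cmd : cmd := Seq setup_cmd (loop 16 turn_cmd).

(** * Rounding a value and completing a round *)

Section Turn.
Variables (R : realType) (n d : nat) (O : owner R n d) (tape : seq bool).
Notation state := (state R d).
Notation triple := (@triple R n d O tape).
Implicit Types (s : state).
Variables (d0 : nat) (eps : R).
Hypotheses (eps0 : (0 < eps)%R) (d0_gt0 : 0 < d0).

Definition holds_vec s (W : 'rV[R]_d) : Prop := forall j : 'I_d, rmem s (100 + j) = W ord0 j.

Lemma write_vec_read (M : nat -> R) (a : nat) (y : 'rV[R]_d) (j : 'I_d) :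
  write_vec M a y (a + j) = y ord0 j.
Proof. by rewrite /write_vec leq_addr addKn insubT //= => h; congr (y _ _); apply: val_inj. Qed.

Lemma block_spec s c W : let st := c * d0 in let en := minn (st + d0) d in
    nmem s 4 = 1 -> nmem s 17 = 0 -> nmem s 35 = st.+1 -> nmem s 36 = en.+1 ->
    nmem s 40 = 100 + st -> nmem s 41 = 100 + d + st ->
    nmem s 42 = 100 + st -> nmem s 43 = 100 + d + st -> nmem s 39 = en - st -> st <= en ->
    rmem s 10 = 0%R -> rmem s 3 = (2 * eps)%R -> rmem s 4 = grid d0 eps -> holds_vec s W ->
  triple block_cmd s (1 + (d0.+1 * d0.+1) * 23) (fun s' =>
    [/\ forall j : 'I_d, st <= j < en -> rmem s' (100 + d + j) = rounded d0 eps W ord0 j,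
        frame (among [:: 39; 42; 43])
          (fun r => (r \in [:: 10; 11; 12; 13]) || (100 + d + st <= r < 100 + d + en)) s s'
      & io s' = io s]).
Proof.
move=> st en h4 h17 h35 h36 h40 h41 h42 h43 h39 sten r10 r3 r4 hW; set Q := (fun s' => _).
pose P' (r : nat) := (r \in [:: 10; 11; 12; 13]) || (100 + d + st <= r < 100 + d + en).
rewrite /Q -/P' => {Q}; set Q := (fun s' => _).
have blockE (j : 'I_d) : (j %/ d0 == c) = (st <= j < en).
  rewrite eqn_leq -(ltnS _ c) ltn_divLR // leq_divRL // mulSn -/st.
  by have := ltn_ord j; rewrite /en; lia.
(* The variant is lexicographic in the shift and the position: a new shift restarts the block, and
   the factor [d0.+1] exceeds the length of a block. *)
pose I mu s' := exists2 si : nat * nat, let: (sh, i) := si in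
   mu = (d0 - sh) * d0.+1 + (en - st - i) & let: (sh, i) := si in
   [/\ [/\ sh <= d0, i <= en - st & forall sh', sh' < sh -> ~~ safe_shift d0 eps W c sh'],
       forall j : 'I_d, st <= j < st + i ->
          ~~ unsafe d0 eps (W ord0 j) sh /\
          rmem s' (100 + d + j) = unshifted d0 eps sh (W ord0 j),
       [/\ nmem s' 39 = en - st - i, nmem s' 42 = 100 + st + i, nmem s' 43 = 100 + d + st + i
         & rmem s' 10 = (sh%:R * (2 * eps))%R],
       frame (among [:: 39; 42; 43]) P' s s' & io s' = io s].
have enst : en - st <= d0 by rewrite /en; lia.
apply: (@triple_weaken _ _ _ _ _ _ _ (1 + (d0 * d0.+1 + (en - st)) * 23) _ Q); [|nia|by []].
rewrite add1n; apply: (triple_while (I := I)).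
- exists (0, 0); first by rewrite !subn0.
  split=> //; first by move=> j; lia.
  by rewrite !addn0 subn0 mul0r.
- move=> mu s' [[sh i] -> [[shd i_le before] done_ [g39 g42 g43 g10] f hio]] _.
  rewrite [holds _ _]/= g39 (f.1 4 isT) h4 => i_lt.
  have jd : st + i < d by move: i_lt; rewrite /en; lia.
  pose j := Ordinal jd.
  have fW : rmem s' (100 + st + i) = W ord0 j.
    rewrite -hW -addnA f.2 //= /P' !inE; lia.
  pose x := (W ord0 j + sh%:R * (2 * eps))%R.
  pose Q1 s'' := [/\ [/\ rmem s'' 10 = (sh%:R * (2 * eps))%R, rmem s'' 11 = (x + 2 * eps)%R,
      rmem s'' 12 = round_down d0 eps x & rmem s'' 13 = (round_down d0 eps x + grid d0 eps)%R],
    nmem s'' = nmem s', frame (among [:: 39; 42; 43]) P' s s'',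
    (forall r, 100 <= r -> rmem s'' r = rmem s' r) & io s'' = io s].
  apply: (@triple_weaken _ _ _ _ _ _ _ (10 + 11).+1); [|by []|by move=> s''; exact].
  apply: (triple_seq (Q1 := Q1)).
    apply: triple_straight => //=; split=> //=.
    + by rewrite /upd /= g42 g10 fW (f.2 3) ?(f.2 4) ?r3 ?r4 // /P' !inE /=; lia.
    + by do ![apply: frame_setr => //].
    + by move=> [|[|[|[|[|[|[|[|[|[|[|[|[|[|r]]]]]]]]]]]]]].
  move=> s1 [[k10 k11 k12 k13] kn kf kr kio].
  (* All smaller shifts have been refuted and this one is now refuted too, so the first safe shift,
     which is at most [d0], is larger. *)
  have sh_lt : unsafe d0 eps (W ord0 j) sh -> sh < d0.
    move=> un; have := first_safe_le eps0 d0_gt0 W c; rewrite leq_eqVlt.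
    have : sh < first_safe d0 eps W c.
      rewrite ltnNge; apply/negP => le.
      have e : first_safe d0 eps W c = sh.
        apply/eqP; rewrite eqn_leq le /= leqNgt; apply/negP => lt.
        by have := before _ lt; rewrite first_safeP.
      have := first_safeP eps0 d0_gt0 W c; rewrite e => /forallP/(_ j).
      by rewrite blockE /= un; lia.
    by move=> a /orP[/eqP <-//|b]; exact: ltn_trans b.
  have r3' : rmem s1 3 = (2 * eps)%R by rewrite kf.2 ?r3 // /P' !inE /=; lia.
  apply: triple_if; rewrite [holds _ _]/= k11 k13 => hun.
    have un : unsafe d0 eps (W ord0 j) sh by [].
    apply: triple_straight => //=.
    exists ((d0 - sh.+1) * d0.+1 + (en - st - 0)); first by have := sh_lt un; nia.
    exists (sh.+1, 0) => //; split; rewrite /= /upd /=.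
    + split=> //; first exact: sh_lt.
      move=> sh'; rewrite ltnS leq_eqVlt => /orP[/eqP ->|]; last exact: before.
      apply/negP => /forallP/(_ j); rewrite blockE un /=; lia.
    + by move=> j'; lia.
    + rewrite kn (f.1 40 isT) (f.1 41 isT) (f.1 17 isT) (f.1 35 isT) (f.1 36 isT) h40 h41 h17 h35 h36 k10 r3'.
      by rewrite !addn0 subn0 subSS -(natr1 sh); split=> //; rewrite [RHS]mulrDl mul1r.
    + by do ![apply: frame_setn => //|apply: frame_setr => //].
    + by [].
  have sf : ~~ unsafe d0 eps (W ord0 j) sh by [].
  apply: triple_straight => //=.
  exists ((d0 - sh) * d0.+1 + (en - st - i.+1)); first lia.
  exists (sh, i.+1) => //; split; rewrite /= /upd /=.
  + by split=> //; lia.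
  + move=> j' j'_lt; rewrite kn g43 -(addnA (100 + d) st i) (eqn_add2l (100 + d)).
    have [jj|jj] := eqVneq (j' : nat) (st + i).
      have -> : j' = j by apply: val_inj.
      by split=> //; rewrite k12 k10.
    have [|d1 d2] := done_ j'; first lia.
    split=> //; rewrite -d2 -kr ?ltn_addr //; case: eqP => //; lia.
  + by rewrite kn g39 g42 g43 (f.1 4 isT) h4 k10; split; rewrite // ?addn1 ?addnS //; lia.
  + do ![apply: frame_setn => //|apply: frame_setr => //].
    rewrite /P' kn g43 !inE; lia.
  + by [].
- move=> mu s' [[sh i] _ [[shd i_le before] done_ [g39 g42 g43 g10] f hio]].
  rewrite [holds _ _]/= g39 (f.1 4 isT) h4 -ltnNge ltnS leqn0 subn_eq0 => i_ge.
  have e : first_safe d0 eps W c = sh.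
    apply/eqP; rewrite eqn_leq; apply/andP; split; last first.
      by rewrite leqNgt; apply/negP => lt; have := before _ lt; rewrite first_safeP.
    rewrite leqNgt; apply/negP => lt; have := first_safe_min eps0 d0_gt0 lt.
    case/negP; apply/forallP => j; apply/implyP; rewrite blockE => hj.
    by have [] := done_ j; first by lia.
  split=> // j hj; rewrite /rounded mxE; have /eqP -> : j %/ d0 == c by rewrite blockE.
  by rewrite e; have [|_ ->] := done_ j; first by lia.
Qed.

Lemma round_spec s W :
    nmem s 4 = 1 -> nmem s 17 = 0 -> nmem s 2 = d -> nmem s 3 = d0 ->
    nmem s 14 = 100 -> nmem s 15 = 100 + d ->
    rmem s 3 = (2 * eps)%R -> rmem s 4 = grid d0 eps -> holds_vec s W -> 0 < d ->
  triple round_cmd s (3 + d * (31 + (d0.+1 * d0.+1) * 23)) (fun s' =>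
    [/\ read_vec d (rmem s') (100 + d) = rounded d0 eps W,
        frame (fun r => 18 <= r) (fun r => 10 <= r) s s' & io s' = io s]).
Proof.
move=> h4 h17 h2 h3 h14 h15 r3 r4 hW d_gt0; set Q := (fun s' => _).
set B := (d.-1 %/ d0).+1.
(* Only scratch registers and the answer area from [100 + d] on may change, so the value stored
   below it survives all blocks. *)
pose P' (r : nat) := (r \in [:: 10; 11; 12; 13]) || (100 + d <= r).
have P'3 r : r < 10 -> ~~ P' r by rewrite /P' !inE; lia.
pose J j s' := exists2 c, c + j = B &
  [/\ nmem s' 35 = (minn (c * d0) d).+1,
      forall j : 'I_d, j < c * d0 -> rmem s' (100 + d + j) = rounded d0 eps W ord0 j,
      frame (fun r => 18 <= r) P' s s' & io s' = io s].
have Bd : B <= d by rewrite /B (leq_trans (_ : _ <= d.-1.+1)) ?ltnS ?leq_div //; lia.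
set Tb := 31 + (d0.+1 * d0.+1) * 23.
apply: (@triple_weaken _ _ _ _ _ _ _ (1 + (B * Tb).+1).+1 _ Q); [|nia|by []].
apply: (triple_seq (Q1 := J B)).
  apply: triple_do => //; exists 0 => //; split=> //=; first by rewrite min0n.
  by do ![apply: frame_setn => //].
move=> s1 J1; apply: (triple_while (I := J)) => //.
  move=> j s' [c cj [g35 done_ f hio]] _; rewrite [holds _ _]/= g35 (f.1 2 isT) h2 => c_lt.
  have cd : c * d0 < d by move: c_lt; rewrite gtn_min ltnn orbF.
  have cB : c < B by rewrite ltnS leq_divRL //; lia.
  have g35' : nmem s' 35 = (c * d0).+1 by rewrite g35 (minn_idPl _) // ltnW.
  set st := c * d0 in cd g35'; set en := minn (st + d0) d.
  pose fr s'' := [/\ frame (fun r => 18 <= r) P' s s'', io s'' = io s &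
     forall r, 100 <= r -> rmem s'' r = rmem s' r].
  pose Q1 s'' := [/\ nmem s'' 35 = st.+1, nmem s'' 36 = (st + d0).+1, nmem s'' 37 = d.+1 & fr s''].
  pose Q2 s'' := [/\ nmem s'' 35 = st.+1, nmem s'' 36 = en.+1 & fr s''].
  pose Q3 s'' := [/\ Q2 s'', nmem s'' 40 = 100 + st, nmem s'' 41 = 100 + d + st
    & rmem s'' 10 = 0%R].
  pose Q4 s'' := [/\ Q3 s'', nmem s'' 42 = 100 + st, nmem s'' 43 = 100 + d + st
    & nmem s'' 39 = en - st].
  pose Q5 s'' := [/\ nmem s'' 36 = en.+1,
     forall j : 'I_d, st <= j < en -> rmem s'' (100 + d + j) = rounded d0 eps W ord0 j,
     forall r, 100 <= r < 100 + d + st -> rmem s'' r = rmem s' r,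
     frame (fun r => 18 <= r) P' s s'' & io s'' = io s].
  apply: (@triple_weaken _ _ _ _ _ _ _
    (4 + (2 + (10 + (6 + (1 + d0.+1 * d0.+1 * 23 + 1).+1).+1).+1).+1).+1); [|by rewrite /Tb; lia|by move=> s'' h; exact: h].
  apply: (triple_seq (Q1 := Q1)).
    apply: triple_straight => //=; split; rewrite /= /upd /= ?(f.1 _ isT) //.
    - by rewrite g35' (f.1 3 isT) h3.
    - by rewrite (f.1 2 isT) h2 (f.1 4 isT) h4 addn1.
    - by split=> //; do ![apply: frame_setn => //].
  move=> s2 [k35 k36 k37 [f2 hio2 kr2]]; apply: (triple_seq (Q1 := Q2)).
    apply: triple_if; rewrite [holds _ _]/= k36 k37 => le; apply: triple_do => //=.
      split; rewrite /= /upd //=; first by rewrite k36 /en; congr (_.+1); lia.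
      by split=> //; do ![apply: frame_setn => //].
    split; rewrite /= /upd //=.
      by rewrite k37 (f2.1 17 isT) h17 addn0 /en; congr (_.+1); lia.
    by split=> //; do ![apply: frame_setn => //].
  move=> s3 [l35 l36 [f3 hio3 kr3]]; apply: (triple_seq (Q1 := Q3)).
    apply: triple_straight => //=; split; rewrite /= /upd /=.
    - split; rewrite //= /upd /=; split=> //=.
        by do ![apply: frame_setn => //|apply: frame_setr => //].
      by move=> r hr; rewrite /upd; case: eqP => [e|_]; [rewrite e in hr|exact: kr3].
    - by rewrite (f3.1 14 isT) (f3.1 4 isT) h14 h4 l35; lia.
    - by rewrite (f3.1 15 isT) (f3.1 4 isT) h15 h4 l35; lia.
    - by rewrite subrr.
  move=> s4 [[m35 m36 [f4 hio4 kr4]] m40 m41 m10]; apply: (triple_seq (Q1 := Q4)).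
    apply: triple_straight => //=; split; rewrite /= /upd /= ?(f4.1 17 isT) ?h17 ?m40 ?m41 ?m35 ?m36 ?addn0 //.
    split; rewrite //= /upd /=; split=> //=; split=> //=.
    by do ![apply: frame_setn => //].
  move=> s5 [[[u35 u36 [f5 hio5 kr5]] u40 u41 u10] u42 u43 u39]; apply: (triple_seq (Q1 := Q5)).
    apply: triple_post; first apply: (@block_spec s5 c W) => //.
    - by rewrite (f5.1 4 isT).
    - by rewrite (f5.1 17 isT).
    - by rewrite /en; lia.
    - by rewrite f5.2 ?P'3.
    - by rewrite f5.2 ?P'3.
    - by move=> i; rewrite f5.2 ?hW // /P' !inE; have := ltn_ord i; lia.
    move=> s6 [a b hio6]; split=> //.
    - by rewrite (b.1 36 isT).
    - by move=> r hr; rewrite -kr5 ?b.2 // ?inE; lia.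
    - apply: (frame_trans f5); apply: frame_sub b => r.
        by rewrite /among !inE; lia.
      by rewrite /P' !inE -/st; lia.
    - by rewrite hio6.
  move=> s6 [p36 pd pr f6 hio6]; apply: triple_do => //=.
  exists j.-1; first lia.
  exists c.+1; first lia.
  split; rewrite /= /upd /=.
  - rewrite p36 (f6.1 17 isT) h17 addn0 /en mulSn -/st; lia.
  - move=> i; rewrite mulSn -/st => hi; case: (ltnP i st) => si; last first.
      by apply: pd; rewrite /en; have := ltn_ord i; lia.
    by rewrite pr ?done_ //; lia.
  - by do ![apply: frame_setn => //].
  - by [].
move=> j s' [c cj [g35 done_ f hio]]; rewrite [holds _ _]/= g35 (f.1 2 isT) h2 => c_ge.
split=> //.
  apply/rowP => i; rewrite mxE done_ //.
  by have := ltn_ord i; lia.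
by apply: frame_sub f => r; rewrite /P' ?inE; lia.
Qed.

(** The interaction as a function of the points alone: it specifies the program and is the object of
    the probabilistic analysis. *)
Fixpoint transcript (x : nat -> n.-tuple bool) (i : nat) : seq 'rV[R]_d :=
  if i is i'.+1 then
    rcons (transcript x i') (rounded d0 eps (O (transcript x i') (x i')))
  else [::].

Lemma size_transcript x i : size (transcript x i) = i.
Proof. by elim: i => //= i IH; rewrite size_rcons IH. Qed.

Definition turn_frame := frame (R := R) (d := d)
  (fun r => (r == 13) || (r == 16) || (18 <= r)) (fun r => 10 <= r).

Lemma turn_spec s (b ell m j : nat) v : let t := walk_length b ell in
    nmem s 4 = 1 -> nmem s 17 = 0 -> nmem s 0 = n -> nmem s 2 = d -> nmem s 3 = d0 ->
    nmem s 14 = 100 -> nmem s 15 = 100 + d -> nmem s 7 = 32 * ell ->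
    nmem s 5 = 2 ^ m -> nmem s 9 = 2 ^ m * (16 * b) -> nmem s 6 = m -> nmem s 13 = j ->
    (nmem s 11, nmem s 12) = v ->
    rmem s 3 = (2 * eps)%R -> rmem s 4 = grid d0 eps -> 0 < d ->
  triple turn_cmd s (32 + m * (26 + t m * 43) + n * 17 + d * (31 + (d0.+1 * d0.+1) * 23))
    (fun s' => [/\ nmem s' 13 = j.+1, nmem s' 16 = nmem s 16, turn_frame s s' &
       io s' = (flips s, rcons (queries s) (size (answers s)), rcons (answers s)
         (rounded d0 eps (O (answers s) (bits_tuple n (nth_vertex t m v j)))))]).
Proof.
move=> t h4 h17 h0 h2 h3 h14 h15 h7 h5 h9 h6 h13 hv r3 r4 d_gt0; set Q := (fun s' => _).
pose W := O (answers s) (bits_tuple n (nth_vertex t m v j)).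
apply: (@triple_weaken _ _ _ _ _ _ _ ((14 + m * (26 + t m * 43)) + ((6 + n * 17) +
  (1 + ((3 + d * (31 + (d0.+1 * d0.+1) * 23)) + 4).+1).+1).+1).+1 _ Q); [|lia|by []].
apply: triple_seq; first exact: (@vertex_spec _ _ _ O tape s b ell m j v).
move=> s1 [hw f1 hio1]; apply: triple_seq.
  by apply: (point_spec O tape (v := nth_vertex t m v j)); rewrite ?(f1.1 4 isT) ?(f1.1 17 isT) ?(f1.1 0 isT) ?(f1.1 14 isT).
move=> s2 [hp f2 hio2].
have f12 : frame (fun r => 18 <= r) (fun r => 10 <= r) s s2.
  apply: (frame_trans (s2 := s1)); [apply: frame_sub f1|apply: frame_sub f2] => // r; lia.
have [ioA ioB ioC] : [/\ flips s2 = flips s, queries s2 = queries s & answers s2 = answers s].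
  by move: hio1 hio2; rewrite /io => -[a1 b1 c1] [-> -> ->].
pose Q3 s' := [/\ holds_vec s' W, frame (fun r => 18 <= r) (fun r => 10 <= r) s s' &
  io s' = (flips s, rcons (queries s) (size (answers s)), answers s)].
apply: (triple_seq (Q1 := Q3)).
  apply: triple_do => //=; split=> /=.
  - by move=> i; rewrite /= (f12.1 14 isT) h14 write_vec_read hp ioC.
  - split=> r hr /=; first exact: f12.1.
    rewrite (f12.1 14 isT) h14 /write_vec ifF ?f12.2 //; lia.
  - by rewrite /io /= ioA ioB ioC.
move=> s3 [hW f3 hio3]; apply: triple_seq.
  apply: (round_spec (W := W)) => //; rewrite ?(f3.1 4 isT) ?(f3.1 17 isT) ?(f3.1 2 isT)
    ?(f3.1 3 isT) ?(f3.1 14 isT) ?(f3.1 15 isT) ?(f3.2 3 isT) ?(f3.2 4 isT) //.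
move=> s4 [hr f4 hio4]; apply: triple_straight => //=.
have f34 := frame_trans f3 f4.
have [io4a io4b io4c] : [/\ flips s4 = flips s, queries s4 = rcons (queries s) (size (answers s))
    & answers s4 = answers s].
  by move: hio3 hio4; rewrite /io => -[a1 b1 c1] [-> -> ->].
split; rewrite /= /upd /=.
- by rewrite (f34.1 13 isT) (f34.1 4 isT) h13 h4 addn1.
- by rewrite (f34.1 16 isT).
- apply: frame_setn => //; split=> r hr' /=; [apply: f34.1; lia|apply: f34.2; lia].
- by rewrite /io /= io4a io4b io4c (f34.1 15 isT) h15 hr.
Qed.

End Turn.

Definition label_bits (d d0 : nat) : nat := (d.-1 %/ d0).+1 * up_log 2 d0.+1.

Definition steward_half_seed (n m b ell : nat) : nat :=
  half_seed (uphalf n) (walk_length b ell) m.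

Definition steward_time (n k d d0 m g : nat) : nat :=
  let b := label_bits d d0 in
  104 + 7 * m + 5 * g + 5 * up_log 2 d0.+1 + 5 * (d.-1 %/ d0).+1 + 11 * m
  + 15 * steward_half_seed n m b (m + g) + 4 * d0
  + k * (35 + m * (26 + walk_length b (m + g) m * 43) + n * 17
     + d * (31 + (d0.+1 * d0.+1) * 23)).

Section Main.
Variables (R : realType) (n k d d0 : nat) (eps delta gamma : R).
Hypotheses (k0 : 0 < k) (d0_gt0 : 0 < d0) (d0d : d0 <= d).
Hypotheses (eps0 : (0 < eps)%R) (gamma0 : (0 < gamma)%R).
Variables (O : owner R n d) (tape : seq bool).

Let m := up_log 2 k.
Let g := gamma_exp gamma0.
Let b := label_bits d d0.
Let t := walk_length b (m + g).
Let h := steward_half_seed n m b (m + g).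

Definition steward_point (j : nat) : n.-tuple bool :=
  bits_tuple n (nth_vertex t m (load h tape (0, 0)) j).

Lemma steward_spec :
  triple O tape steward_cmd (init d [:: n; k; d; d0] [:: eps; delta; gamma])
    (steward_time n k d d0 m g)
    (fun s' => io s' = (h.*2, iota 0 k, transcript O d0 eps steward_point k)).
Proof.
set s0 := init _ _ _; set Q := (fun s' => _).
have d_gt0 : 0 < d by exact: leq_trans d0d.
apply: (@triple_weaken _ _ _ _ _ _ _
  (((12 + up_log 2 k * 7) + ((21 + g * 5) + ((16 + up_log 2 d0.+1 * 5 + (d.-1 %/ d0).+1 * 5) +
    ((10 + m * 11) + ((8 + h * 15) + (18 + d0 * 4)).+1).+1).+1).+1).+1
   + (k * (32 + m * (26 + t m * 43) + n * 17 + d * (31 + (d0.+1 * d0.+1) * 23) + 3)).+1).+1 _ Q);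
  [|by rewrite /steward_time -/b -/t -/h -/m -/g; lia|by []].
apply: (triple_seq (Q1 := fun s' =>
  [/\ frame (fun r => 4 <= r) (fun r => 3 <= r) s0 s',
      [/\ nmem s' 4 = 1, nmem s' 17 = 0, nmem s' 5 = 2 ^ m, nmem s' 6 = m & nmem s' 7 = 32 * (m + g)],
      [/\ nmem s' 9 = 2 ^ m * (16 * b), (nmem s' 11, nmem s' 12) = load h tape (0, 0),
          rmem s' 3 = (2 * eps)%R & rmem s' 4 = grid d0 eps],
      [/\ nmem s' 13 = 0, nmem s' 14 = 100, nmem s' 15 = 100 + d & nmem s' 16 = k]
    & io s' = (h.*2, [::], [::])])).
  apply: triple_seq; first by apply: (pow_spec O tape (k := k)).
  move=> s1 [[a4 a17 a5 a6] f1 io1].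
  have r2 : rmem s1 2 = gamma by rewrite f1.2.
  have gamma0' : (0 < rmem s1 2)%R by rewrite r2.
  have gE : gamma_exp gamma0' = g by exact: gamma_exp_eq.
  apply: triple_seq; first by rewrite -gE; apply: (gamma_spec O tape (m := m)).
  move=> s2 [b7 br7 f2 io2].
  have f02 : frame (fun r => 4 <= r) (fun r => 3 <= r) s0 s2.
    apply: (frame_trans (s2 := s1)); [apply: frame_sub f1|apply: frame_sub f2] => // r;
    by rewrite /among !inE; lia.
  apply: triple_seq.
    by apply: (label_spec O tape (d0 := d0)); rewrite ?(f02.1 3 isT) ?(f02.1 2 isT) ?(f2.1 4 isT).
  move=> s3 [c8 f3 io3].
  have f23 : frame (fun r => r \in [:: 7; 8; 20; 21; 22]) (fun r => r \in [:: 5; 6; 7]) s1 s3.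
    apply: (frame_trans (s2 := s2)); [apply: frame_sub f2|apply: frame_sub f3] => // r;
    by rewrite /among !inE; lia.
  have f03 : frame (fun r => 4 <= r) (fun r => 3 <= r) s0 s3.
    by apply: (frame_trans f02); apply: frame_sub f3 => // r; rewrite /among !inE; lia.
  apply: triple_seq.
    apply: (length_spec O tape (b := b) (ell := m + g) (m := m)).
    - by rewrite (f23.1 4 isT).
    - by rewrite (f23.1 17 isT).
    - by rewrite (f03.1 0 isT).
    - by rewrite c8 /b /label_bits; lia.
    - by rewrite (f3.1 7 isT) b7 gE.
    - by rewrite (f23.1 6 isT).
  move=> s4 [e9 e10 f4 io4].
  apply: triple_seq.
    apply: (seed_spec O tape (h := h)) => //.
    - by rewrite (f4.1 4 isT) (f23.1 4 isT).
    - by rewrite (f4.1 17 isT) (f23.1 17 isT).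
    - by move: io1 io2 io3 io4; rewrite /io => -[e _ _] [e' _ _] [e'' _ _] [-> _ _]; rewrite e'' e' e.
  move=> s5 [g11 f5 io5].
  have f45 : frame (fun r => r \in [:: 9; 10; 11; 12; 20; 27]) pred0 s3 s5.
    apply: (frame_trans (s2 := s4)); [apply: frame_sub f4|apply: frame_sub f5] => // r;
    by rewrite /among !inE; lia.
  have f05 : frame (fun r => 4 <= r) (fun r => 3 <= r) s0 s5.
    by apply: (frame_trans f03); apply: frame_sub f45 => // r; rewrite !inE; lia.
  apply: triple_post; first apply: (grid_spec O tape (eps := eps) (d0 := d0) (k := k)).
  - by rewrite (f45.1 4 isT) (f23.1 4 isT).
  - by rewrite (f45.1 17 isT) (f23.1 17 isT).
  - by rewrite (f05.1 1 isT).
  - by rewrite (f05.1 2 isT).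
  - by rewrite (f05.1 3 isT).
  - by rewrite (f05.2 0 isT).
  - by rewrite (f45.2 7 isT) (f3.2 7 isT).
  move=> s6 [[r3 r4] [h13 h14 h15 h16] f6 io6]; split.
  - by apply: (frame_trans f05); apply: frame_sub f6 => r; rewrite /among !inE; lia.
  - rewrite (f6.1 4 isT) (f6.1 17 isT) (f6.1 5 isT) (f6.1 6 isT) (f6.1 7 isT).
    rewrite (f45.1 4 isT) (f45.1 17 isT) (f45.1 5 isT) (f45.1 6 isT) (f45.1 7 isT).
    rewrite (f3.1 7 isT) b7 gE.
    by rewrite (f23.1 4 isT) (f23.1 17 isT) (f23.1 5 isT) (f23.1 6 isT).
  - by rewrite (f6.1 9 isT) (f5.1 9 isT) (f6.1 11 isT) (f6.1 12 isT).
  - by [].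
  - rewrite io6 io5; move: io1 io2 io3 io4; rewrite /io => -[_ e1 e2] [_ e1' e2'] [_ e1'' e2''].
    by move=> [_ -> ->]; rewrite e1'' e2'' e1' e2' e1 e2.
move=> s1 [f1 [h4 h17 h5 h6 h7] [h9 h11 r3 r4] [h13 h14 h15 h16] io1].
pose I i s' := [/\ nmem s' 13 = i, turn_frame s1 s' &
  io s' = (h.*2, iota 0 i, transcript O d0 eps steward_point i)].
apply: (@triple_post _ _ _ _ _ _ _ _
    (fun s' => [/\ nmem s' 4 = 1, nmem s' 16 = 0 & I k s'])); last by move=> s' [_ _ []].
apply: (triple_loop (I := I)); [by []| |exact: h4|exact: h16|].
  by split; [exact: h13|exact: frame_refl|exact: io1].
move=> i s' ik [g13 f [fl qu an]] g4 g16.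
apply: triple_post.
  apply: (@turn_spec _ _ _ O tape d0 eps eps0 d0_gt0 s' b (m + g) m i (load h tape (0, 0))) => //;
  by rewrite ?(f.1 17 isT) ?(f.1 0 isT) ?(f.1 2 isT) ?(f.1 3 isT) ?(f.1 14 isT) ?(f.1 15 isT)
     ?(f.1 7 isT) ?(f.1 5 isT) ?(f.1 9 isT) ?(f.1 6 isT) ?(f.1 11 isT) ?(f.1 12 isT)
     ?(f.2 3 isT) ?(f.2 4 isT) ?(f1.1 0 isT) ?(f1.1 2 isT) ?(f1.1 3 isT).
move=> s'' [k13 k16 f' hio]; split.
- by rewrite (f'.1 4 isT).
- by rewrite k16.
- split=> //.
    by apply: frame_setn => //; exact: frame_trans f f'.
  have -> : iota 0 i.+1 = rcons (iota 0 i) i by rewrite -addn1 iotaD -cats1.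
  by rewrite [io _]hio fl qu an size_transcript.
Qed.

(** A halted configuration is a fixed point of [step], so any [T] above the time bound gives the
    same final state. *)
Lemma run_steward T : steward_time n k d d0 m g <= T ->
  let cf := run steward_cmd [:: n; k; d; d0] [:: eps; delta; gamma] O tape T in
  cf.1 = [::] /\ io cf.2 = (h.*2, iota 0 k, transcript O d0 eps steward_point k).
Proof.
have [u [s' [uT h1 q]]] := steward_spec.
move=> TT; rewrite /= /run -(subnK (leq_trans uT TT)) iterD h1.
by elim: (T - u) => //= c [e1 e2]; case: (iter _ _ _) e1 e2 => K s'' /= -> .
Qed.

End Main.

(** * Correctness and resource bounds *)

Local Open Scope ring_scope.

Lemma descend_nth (X L : Type) (F : seq L -> X -> option L) h p h' (x0 : X) (l0 : L) :
    descend F h p = Some h' ->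
  exists u, [/\ h' = h ++ u, size u = size p &
    forall j, (j < size p)%N -> F (h ++ take j u) (nth x0 p j) = Some (nth l0 u j)].
Proof.
elim: p h => [|x p IH] h /=; first by case=> <-; exists [::]; rewrite cats0.
case e: (F h x) => [l|//] /IH[u [-> su fu]]; exists (l :: u).
split=> [||[|j] jp] /=; first by rewrite cat_rcons.
- by rewrite su.
- by rewrite cats0.
- by rewrite -cat_rcons fu.
Qed.

Lemma uprob_le (R : realType) (T : finType) (A B : {set T}) :
  A \subset B -> uprob R A <= uprob R B.
Proof. by move=> AB; rewrite /uprob ler_wpM2r ?invr_ge0 // ler_nat subset_leq_card. Qed.

(** Measurability of [f] is not assumed: the integral of a nonnegative function is a supremum over
    the simple functions below it, hence monotone in any case. *)
Lemma ge0_le_integral_cst (R : realType) disp (Om : measurableType disp)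
    (P : probability Om R) (f : Om -> R) (c : R) :
  (forall w, 0 <= f w <= c) -> (\int[P]_w (f w)%:E <= c%:E)%E.
Proof.
move=> f01; have c0 (w : Om) : 0 <= c by case/andP: (f01 w) => /le_trans; apply.
have le : (\int[P]_w (f w)%:E <= \int[P]_w (cst c%:E) w)%E.
  rewrite !ge0_integralTE; last 2 first.
  - by move=> w; rewrite lee_fin (c0 w).
  - by move=> w; rewrite lee_fin; case/andP: (f01 w).
  apply: ereal_sup_le => _ [h hf <-]; exists h => // w.
  by apply: le_trans (hf w) _; rewrite lee_fin; case/andP: (f01 w).
apply: (le_trans le); rewrite integral_cst //.
rewrite [X in (_ * X)%E](_ : _ = 1%E) ?mule1 //; exact: probability_setT.
Qed.

Section Correctness.
Variables (R : realType) (n k d d0 : nat) (eps delta gamma : R).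
Hypotheses (k0 : (0 < k)%N) (d0_gt0 : (0 < d0)%N) (d0d : (d0 <= d)%N).
Hypotheses (eps0 : 0 < eps) (gamma0 : 0 < gamma) (delta0 : 0 < delta).

Let m := up_log 2 k.
Let g := gamma_exp gamma0.
Let b := label_bits d d0.
Let t := walk_length b (m + g).
Let h := steward_half_seed n m b (m + g).

Variables (O : owner R n d) (mu : seq 'rV[R]_d -> 'rV[R]_d).
Hypothesis conc : forall hist, concentrated eps delta (O hist) (mu hist).

(** Replays the answers from the labels and the centres [mu], without the points, so that the
    function at a node of the tree is fixed. It agrees with the true transcript as long as there is
    no miss. *)
Definition decoded : seq (label d d0) -> seq 'rV[R]_d :=
  foldl (fun ys l => rcons ys (decode eps (mu ys) l)) [::].

(** The generator provides [2 ^ m] blocks, possibly more than [k]; nodes at depth [k] or more never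
    miss, so [delta] is charged only [k] times. *)
Definition steward_tree (hs : seq (label d d0)) (x : n.-tuple bool) : option (label d d0) :=
  let W := O (decoded hs) x in
  if (size hs < k)%N && (eps < `|W - mu (decoded hs)|) then None
  else Some (label_of d0 eps W).

Lemma steward_tree_miss hs :
  uprob R [set x | steward_tree hs x == None] <= if (size hs < k)%N then delta else 0.
Proof.
rewrite /steward_tree; case: (size hs < k)%N => /=; last first.
  by rewrite /uprob eq_card0 ?mul0r // => x; rewrite inE.
apply: le_trans (conc (decoded hs)); apply: uprob_le; apply/fintype.subsetP => x.
by rewrite !inE; case: ifP.
Qed.

Lemma take_transcript (x : nat -> n.-tuple bool) i j : (i <= j)%N ->
  take i (transcript O d0 eps x j) = transcript O d0 eps x i.
Proof.
elim: j => [|j IH]; first by rewrite leqn0 => /eqP ->.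
rewrite leq_eqVlt => /orP[/eqP ->|ij]; first by rewrite take_oversize // size_transcript.
by rewrite /= -cats1 takel_cat ?size_transcript ?IH.
Qed.

Lemma steward_correct (tape : (h.*2).-tuple bool) :
    descend steward_tree [::] (points (@bits_tuple n) t m (load h tape (0, 0)%N)) != None ->
  let Y := transcript O d0 eps (steward_point n k d d0 gamma0 tape) k in
  forall i : 'I_k, `|nth 0 Y i - mu (take i Y)| <= 4 * (eps * d0%:R).
Proof.
case e: (descend _ _ _) => [hs|//] _ Y i.
have [u [_ su fu]] := descend_nth (bits_tuple n (0, 0)%N) [ffun=> ord0] e.
rewrite size_points in su fu.
have km : (k <= 2 ^ m)%N by exact: up_logP.
set x := steward_point n k d d0 gamma0 tape in Y *.
have xE j : (j < k)%N -> nth (bits_tuple n (0, 0)%N)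
    (points (@bits_tuple n) t m (load h tape (0, 0)%N)) j = x j.
  by move=> jk; rewrite nth_points //; exact: leq_trans km.
have step j : (j < k)%N -> transcript O d0 eps x j = decoded (take j u) ->
    rounded d0 eps (O (transcript O d0 eps x j) (x j)) =
      decode eps (mu (transcript O d0 eps x j)) (nth [ffun=> ord0] u j).
  move=> jk ej; have := fu j (leq_trans jk km); rewrite xE //= /steward_tree -ej.
  have -> : (size (take j u) < k)%N.
    by rewrite size_takel // su (leq_trans (ltnW jk)).
  case: ltP => //= close [<-]; exact: rounded_decode.
(* Without a miss each value is [eps]-close to its centre, so the next answer is the decoded one and
   the two histories stay equal. *)
have transcriptE j : (j <= k)%N -> transcript O d0 eps x j = decoded (take j u).
  elim: j => [|j IH] jk; first by rewrite take0.
  rewrite /= (step j jk (IH (ltnW jk))) (IH (ltnW jk)).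
  rewrite (take_nth [ffun=> ord0]); last by rewrite su (leq_trans jk).
  by rewrite /decoded foldl_rcons.
have yi z : nth z Y i = decode eps (mu (transcript O d0 eps x i)) (nth [ffun=> ord0] u i).
  rewrite -(nth_take z (ltnSn i)) take_transcript //= nth_rcons size_transcript ltnn eqxx.
  have i_k := ltn_ord i.
  by rewrite (step i i_k (transcriptE i (ltnW i_k))).
rewrite yi take_transcript; last exact: ltnW.
exact: decode_close.
Qed.

Lemma steward_fails T : (steward_time n k d d0 m g <= T)%N ->
  uprob R (fails k steward_cmd [:: n; k; d; d0] [:: eps; delta; gamma]
     (4 * (eps * d0%:R)) h.*2 T O mu) <= k%:R * delta + gamma.
Proof.
move=> TT; have km : (k <= 2 ^ m)%N by exact: up_logP.
have -> : k%:R * delta = \sum_(j < 2 ^ m) (if (j < k)%N then delta else 0).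
  by rewrite -big_mkcond (big_ord_narrow km) sumr_const card_ord mulr_natl.
have Lb : (#|{: label d d0}| <= 2 ^ b)%N.
  rewrite card_label /b /label_bits mulnC expnM leq_exp2r //; exact: up_logP.
have ellP : 2 ^+ m <= 2 ^+ (m + g) * gamma.
  rewrite exprD -mulrA ler_peMr ?exprn_ge0 // ltW // mulrC /g /gamma_exp.
  by case: ex_minnP.
have dge j : 0 <= (if (j < k)%N then delta else 0) by case: ifP => // _; exact: ltW.
apply: le_trans (generator_uprob Lb gamma0 ellP dge steward_tree_miss).
apply: uprob_le; apply/fintype.subsetP => tape; rewrite !inE => /existsP[i].
have [_ io_eq] := run_steward delta k0 d0_gt0 d0d eps0 O tape TT.
have -> : answers (final steward_cmd [:: n; k; d; d0] [:: eps; delta; gamma] O tape T) =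
    transcript O d0 eps (steward_point n k d d0 gamma0 tape) k.
  by move: io_eq; rewrite /io /final => -[_ _ ->].
by move=> bad; apply: contraT => /steward_correct/(_ i); rewrite leNgt bad.
Qed.

End Correctness.

(** * Seed length and running time *)

Lemma half_seedE n m b ell : steward_half_seed n m b ell =
  (uphalf n + (32 * ((2 ^ m).-1 * b) + 64 * (m * ell)))%N.
Proof.
rewrite /steward_half_seed; elim: m => [|m /= ->]; first by rewrite !mul0n !addn0.
rewrite /walk_length expnS; have := expn_gt0 2 m; case: (2 ^ m)%N => // p _.
have -> : ((2 * p.+1).-1 = (p + p).+1)%N by lia.
by rewrite /= !mulSn mulnDl; lia.
Qed.

Lemma half_seed_double n m b g : (steward_half_seed n m b (m + g)).*2 =
  ((uphalf n).*2 + 64 * ((2 ^ m).-1 * b) + 128 * (m * m + m * g))%N.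
Proof. by rewrite half_seedE mulnDr; lia. Qed.

Lemma up_log2_bound k m : up_log 2 k = m.+1 -> (2 ^ m < k)%N.
Proof. by move=> e; rewrite ltnNge leq_pow2 e ltnn. Qed.

Lemma pow_up_log2_lt k : (0 < k)%N -> ((2 ^ up_log 2 k).-1 < 2 * k)%N.
Proof.
move=> k0; case e: (up_log 2 k) => [|m]; first by rewrite muln_gt0.
have := up_log2_bound e; rewrite expnS; have := expn_gt0 2 m; lia.
Qed.

Lemma up_log2_le k : (up_log 2 k <= k)%N.
Proof. by apply: up_log_min => //; rewrite ltnW // ltn_expl. Qed.

(** Since [ell] contains [m], the seed length contains [m * m], which has to be absorbed into
    [O(k)]. The terms [2 * m + 3] make the induction immediate: the left side at most doubles. *)
Lemma sqr_le_pow2 m : (m * m + 2 * m + 3 <= 4 * 2 ^ m)%N.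
Proof. by elim: m => // m IH; rewrite expnS; lia. Qed.

Section Bounds.
Variable R : realType.

(** The inequality 1 + x <= exp(x) at x = -1/2. *)
Lemma ln2_ge_half : 1 / 2 <= ln 2 :> R.
Proof.
have h : (2 : R)^-1 <= expR (- (1 / 2)) by apply: le_trans (expR_ge1Dx _); lra.
have : ln (2^-1) <= - (1 / 2) :> R.
  by rewrite -[leRHS]expRK ler_ln ?posrE ?expR_gt0 ?invr_gt0.
by rewrite lnV ?posrE //; lra.
Qed.

Lemma up_log2_ln k : (0 < k)%N -> (up_log 2 k)%:R <= 4 * ln k%:R :> R.
Proof.
move=> k0; case e: (up_log 2 k) => [|m].
  by rewrite mulr_ge0 // ln_ge0 // ler1n.
have mk := up_log2_bound e.
have l2 := ln2_ge_half.
have lm : m%:R * ln 2 <= ln k%:R :> R.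
  rewrite mulr_natl -lnXn // ler_ln ?posrE ?exprn_gt0 ?ltr0n //.
  by rewrite -natrX ler_nat ltnW.
have l2k : ln 2 <= ln k%:R :> R.
  rewrite ler_ln ?posrE ?ltr0n // ler_nat; apply: leq_ltn_trans mk.
  by rewrite expn_gt0.
have : m%:R <= 2 * ln k%:R :> R.
  by apply: le_trans (_ : m%:R * (2 * ln 2) <= _); [rewrite ler_peMr //|]; lra.
by rewrite -(natr1 m); lra.
Qed.

Lemma gamma_exp_le (gamma : R) (gamma0 : 0 < gamma) :
  (gamma_exp gamma0)%:R <= 1 + 2 * log_inv gamma.
Proof.
have l0 : 0 <= log_inv gamma by rewrite /log_inv le_max lexx.
rewrite /gamma_exp; case: ex_minnP => -[|g] _ ming; first by lra.
have gl : gamma * 2 ^+ g <= 1.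
  by rewrite leNgt; apply/negP => /ming; rewrite ltnn.
have : g%:R * ln 2 <= log_inv gamma.
  rewrite /log_inv le_max; apply/orP; right.
  rewrite mulr_natl -lnXn // ler_ln ?posrE ?exprn_gt0 ?invr_gt0 //.
  by rewrite -[leRHS]mul1r ler_pdivlMr // mulrC.
have g0 : 0 <= g%:R :> R by [].
have l2 := ln2_ge_half.
have : g%:R * (1 / 2) <= g%:R * ln 2 :> R by rewrite ler_wpM2l.
by rewrite -(natr1 g); lra.
Qed.

Lemma seed_bound (n k d d0 : nat) (gamma : R) (gamma0 : 0 < gamma) :
    (0 < k)%N -> (0 < d0)%N -> (d0 <= d)%N ->
  (steward_half_seed n (up_log 2 k) (label_bits d d0)
     (up_log 2 k + gamma_exp gamma0)).*2%:R <=
    n%:R + (2 ^ 12)%:R * (k%:R * d%:R * ln (d0%:R + 1) / d0%:R + ln k%:R * log_inv gamma).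
Proof.
move=> k0 d0_gt0 d0d; set m := up_log 2 k; set b := label_bits d d0; set g := gamma_exp gamma0.
set X := k%:R * d%:R * ln (d0%:R + 1) / d0%:R; set Y := ln k%:R * log_inv gamma.
have l2 := ln2_ge_half.
have d0r : 0 < d0%:R :> R by rewrite ltr0n.
have l0 : 0 <= log_inv gamma by rewrite /log_inv le_max lexx.
have lnd : ln 2 <= ln (d0%:R + 1) :> R.
  by rewrite ler_ln ?posrE ?addr_gt0 // natr1 ler_nat ltnS.
have kr : 1 <= k%:R :> R by rewrite ler1n.
have dd : 1 <= d%:R / d0%:R :> R by rewrite ler_pdivlMr // mul1r ler_nat.
have XE : X = k%:R * (d%:R / d0%:R * ln (d0%:R + 1)) by rewrite /X; field; lra.
have hD : 1 / 2 <= d%:R / d0%:R * ln (d0%:R + 1) :> R.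
  by rewrite -[leLHS]mul1r ler_pM //; lra.
(* [X] is at least [k / 2], so it absorbs the additive constants, the rounding of [n] to an even
   number and the terms linear in [k]. *)
have kX : k%:R <= 2 * X.
  rewrite XE; move: hD; set D := _ * ln _ => hD.
  have : k%:R * (1 / 2) <= k%:R * D by rewrite ler_wpM2l.
  by lra.
have bX : k%:R * b%:R <= 8 * X.
  rewrite XE mulrCA ler_wpM2l //.
  have e0 : (up_log 2 d0.+1)%:R <= 4 * ln (d0%:R + 1) :> R by rewrite natr1 up_log2_ln.
  have B : (d.-1 %/ d0).+1%:R <= 2 * (d%:R / d0%:R) :> R.
    rewrite mulrA ler_pdivlMr // -!natrM ler_nat mulSn.
    have := leq_trunc_div d.-1 d0; lia.
  rewrite /b /label_bits natrM.
  apply: (le_trans (ler_pM _ _ B e0)) => //.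
  by rewrite le_eqVlt; apply/orP; left; apply/eqP; ring.
have mk : (2 ^ m).-1%:R <= 2 * k%:R :> R.
  by rewrite -natrM ler_nat ltnW // pow_up_log2_lt.
have m2 : m%:R * m%:R + 2 * m%:R <= 8 * k%:R + 1 :> R.
  have := sqr_le_pow2 m; have := pow_up_log2_lt k0; rewrite -/m.
  have := expn_gt0 2 m; case: (2 ^ m)%N => // p _ /= h1 h2.
  by rewrite -!natrM -natrD -(natrD _ _ 1) ler_nat; lia.
have mg : m%:R * g%:R <= m%:R + 8 * Y.
  apply: (@le_trans _ _ (m%:R * (1 + 2 * log_inv gamma))).
    by rewrite ler_wpM2l // gamma_exp_le.
  have : m%:R * log_inv gamma <= 4 * ln k%:R * log_inv gamma.
    by rewrite ler_wpM2r // up_log2_ln.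
  by rewrite /Y; lra.
have Y0 : 0 <= Y by rewrite mulr_ge0 // ln_ge0.
have X0 : 0 <= X by lra.
have un : (uphalf n).*2%:R <= n%:R + 1 :> R.
  by rewrite natr1 ler_nat uphalfE -[leqRHS](odd_double_half n.+1) leq_addl.
have pb : (2 ^ m).-1%:R * b%:R <= 16 * X.
  apply: (@le_trans _ _ (2 * k%:R * b%:R)); first by rewrite ler_wpM2r.
  by lra.
have -> : (steward_half_seed n m b (m + g)).*2%:R =
   (uphalf n).*2%:R + 64 * ((2 ^ m).-1%:R * b%:R) + 128 * (m%:R * m%:R + m%:R * g%:R) :> R.
  by rewrite half_seed_double !(natrD, natrM).
have -> : (2 ^ 12)%:R = 4096 :> R by rewrite natrX; ring.
have m0 : 0 <= m%:R :> R by [].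
lra.
Qed.

End Bounds.

Lemma steward_time_le : exists N : nat, forall n k d d0 g : nat,
    (0 < n)%N -> (0 < k)%N -> (0 < d0)%N -> (d0 <= d)%N ->
  (steward_time n k d d0 (up_log 2 k) g <= N * (n + k + d + g) ^ 5)%N.
Proof.
(* The degree 5 comes from [k] rounds with [m] levels each and walks of cubic length; the
   coefficients collected below stay under 8000. *)
exists (8 * 1000)%N => n k d d0 g n0 k0 d0_gt0 d0d.
set m := up_log 2 k; pose z := (n + k + d + g)%N; rewrite -/z.
have mk : (m <= k)%N by exact: up_log2_le.
have e0 : (up_log 2 d0.+1 <= d0.+1)%N by exact: up_log2_le.
have Bd : (d.-1 %/ d0 <= d.-1)%N by exact: leq_div.
have z0 : (0 < z)%N by rewrite /z; lia.
have d0z : (d0.+1 <= z)%N by rewrite /z; lia.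
have b2 : (label_bits d d0 <= z ^ 2)%N.
  by rewrite /label_bits -mulnn leq_mul // /z; lia.
have p2 : ((2 ^ m).-1 <= 2 * z)%N.
  by have := pow_up_log2_lt k0; rewrite -/m /z; lia.
have p2' : (2 ^ m <= 2 * z)%N.
  have := pow_up_log2_lt k0; rewrite -/m /z; lia.
have z12 : (z <= z ^ 2)%N by rewrite -{1}(expn1 z) leq_pexp2l.
have z23 : (z ^ 2 <= z ^ 3)%N by rewrite leq_pexp2l.
have z34 : (z ^ 3 <= z ^ 4)%N by rewrite leq_pexp2l.
have z45 : (z ^ 4 <= z ^ 5)%N by rewrite leq_pexp2l.
have tz : (walk_length (label_bits d d0) (m + g) m <= 96 * z ^ 3)%N.
  have : (2 ^ m * label_bits d d0 <= 2 * z * z ^ 2)%N by rewrite leq_mul.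
  by rewrite /walk_length -mulnA -expnS; rewrite /z in z12 z23 *; lia.
have hz : (steward_half_seed n m (label_bits d d0) (m + g) <= 193 * z ^ 3)%N.
  rewrite half_seedE.
  have : ((2 ^ m).-1 * label_bits d d0 <= 2 * z * z ^ 2)%N by rewrite leq_mul.
  have : (m * (m + g) <= z * z)%N by rewrite leq_mul // /z; lia.
  rewrite mulnn -mulnA -expnS; have : (uphalf n <= z)%N by rewrite /z; lia.
  lia.
have inner : (m * (26 + walk_length (label_bits d d0) (m + g) m * 43) <= 4154 * z ^ 4)%N.
  have z3 : (0 < z ^ 3)%N by rewrite expn_gt0 z0.
  have : (m * (26 + walk_length (label_bits d d0) (m + g) m * 43) <= z * (4154 * z ^ 3))%N.
    by apply: leq_mul; [rewrite /z; lia|lia].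
  by rewrite mulnCA -expnS.
have rnd : (d * (31 + (d0.+1 * d0.+1) * 23) <= 54 * z ^ 3)%N.
  have z2 : (0 < z ^ 2)%N by rewrite expn_gt0 z0.
  have dd : (d0.+1 * d0.+1 <= z ^ 2)%N by rewrite -mulnn leq_mul.
  have : (d * (31 + (d0.+1 * d0.+1) * 23) <= z * (54 * z ^ 2))%N.
    by apply: leq_mul; [rewrite /z; lia|lia].
  by rewrite mulnCA -expnS.
have turn : (k * (35 + m * (26 + walk_length (label_bits d d0) (m + g) m * 43) + n * 17
    + d * (31 + (d0.+1 * d0.+1) * 23)) <= 4260 * z ^ 5)%N.
  have : (k * (35 + m * (26 + walk_length (label_bits d d0) (m + g) m * 43) + n * 17
    + d * (31 + (d0.+1 * d0.+1) * 23)) <= z * (4260 * z ^ 4))%N.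
    have nz : (n <= z)%N by rewrite /z; lia.
    by apply: leq_mul; [rewrite /z; lia|lia].
  by rewrite mulnCA -expnS.
rewrite /steward_time; have : (d <= z)%N by rewrite /z; lia.
have : (g <= z)%N by rewrite /z; lia.
have : (k <= z)%N by rewrite /z; lia.
lia.
Qed.

Lemma steward_time_poly (R : realType) : exists c : nat,
    forall (n k d d0 : nat) (eps gamma : R) (gamma0 : 0 < gamma),
    (0 < n)%N -> (0 < k)%N -> (0 < d0)%N -> (d0 <= d)%N ->
  (steward_time n k d d0 (up_log 2 k) (gamma_exp gamma0))%:R <=
  c%:R * (1 + n%:R + k%:R + d%:R + log_inv eps + log_inv gamma) ^+ c.
Proof.
(* The factor 32 is the fifth power of the 2 in [2 * Y]; the summand 5 makes the same number large
   enough as an exponent, which may grow because [Y] is at least 1. *)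
have [N bound] := steward_time_le; exists (N * 32 + 5)%N.
move=> n k d d0 eps gamma gamma0 n0 k0 d0_gt0 d0d.
set g := gamma_exp gamma0.
set Y := (1 + n%:R + k%:R + d%:R + log_inv eps + log_inv gamma).
have le0 : 0 <= log_inv eps by rewrite /log_inv le_max lexx.
have lg0 : 0 <= log_inv gamma by rewrite /log_inv le_max lexx.
have Y1 : 1 <= Y by rewrite /Y -!addrA lerDl !addr_ge0.
have zY : (n + k + d + g)%:R <= 2 * Y.
  rewrite !natrD; have := gamma_exp_le gamma0; rewrite -/g /Y => gg.
  have := ler0n R n; have := ler0n R k; have := ler0n R d; lra.
apply: (@le_trans _ _ (N%:R * (2 * Y) ^+ 5)).
  apply: (@le_trans _ _ ((N * (n + k + d + g) ^ 5)%N%:R)); first by rewrite ler_nat bound.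
  rewrite natrM natrX ler_wpM2l //.
  by rewrite lerXn2r ?nnegrE //; lra.
have -> : N%:R * (2 * Y) ^+ 5 = (N * 32)%:R * Y ^+ 5 by rewrite natrM; ring.
apply: ler_pM => //; first by apply: exprn_ge0; lra.
  by rewrite ler_nat leq_addr.
by rewrite ler_weXn2l // leq_addl.
Qed.


Theorem theorem5p2 (R : realType) :
  exists (S : cmd) (C1 C2 c : nat),
  forall (n k d d0 : nat) (eps delta gamma : R),
    (0 < n)%N -> (0 < k)%N -> (0 < d0)%N -> (d0 <= d)%N ->
    0 < eps -> 0 < delta -> 0 < gamma ->
  exists r T : nat,
    let nin := [:: n; k; d; d0] in
    let rin := [:: eps; delta; gamma] in
    [/\ is_steward n k d eps delta S nin rin
          (C1%:R * (eps * d0%:R)) (k%:R * delta + gamma) r T,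
        one_query n k d eps delta S nin rin r T,
        uses_bits n d eps delta S nin rin r T
          /\ r%:R <= n%:R
               + C2%:R * (k%:R * d%:R * ln (d0%:R + 1) / d0%:R
                          + ln k%:R * log_inv gamma)
      & runs_in_time n k d eps delta S nin rin r T
          /\ T%:R <= c%:R * (1 + n%:R + k%:R + d%:R
                             + log_inv eps + log_inv gamma) ^+ c].
Proof.
have [c time] := steward_time_poly R.
exists steward_cmd, 4%N, (2 ^ 12)%N, c.
move=> n k d d0 eps delta gamma n0 k0 d0_gt0 d0d eps0 delta0 gamma0.
set m := up_log 2 k; pose g := gamma_exp gamma0.
have [T TE] : exists T, T = steward_time n k d d0 m g by exists (steward_time n k d d0 m g).
have TT : (steward_time n k d d0 m g <= T)%N by rewrite TE.
exists (steward_half_seed n m (label_bits d d0) (m + g)).*2, T => nin rin.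
have halts (O : owner R n d) tape := run_steward delta k0 d0_gt0 d0d eps0 O tape TT.
split.
- move=> disp Om P O mu conc; apply: ge0_le_integral_cst => w; apply/andP; split.
    by rewrite /uprob divr_ge0.
  exact: steward_fails.
- move=> O tape _; have [_ io_eq] := halts O tape.
  move: io_eq; rewrite /io /final => -[_ -> _]; rewrite iota_uniq; split=> //.
  by apply/allP => i; rewrite mem_iota.
- split; last exact: seed_bound.
  by move=> O tape _; have [_] := halts O tape; rewrite /io /final => -[-> _ _].
- split; last by rewrite TE; exact: time.
  move=> O tape _; have [halt io_eq] := halts O tape; split; first exact: halt.
  by move: io_eq; rewrite /io /final => -[_ _ ->]; exact: size_transcript.
Qed.
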